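(* The group $\mathrm{Aut}_4(J)$ is a normal Sylow $p$-subgroup of $\mathrm{Aut}(J)$ of order $p^{8m}$ and index $2$ in $\mathrm{Aut}(J)$. It is generated by $a=A\delta$, $b=B\delta$, $x$, and $\Delta$, where $x$ is the automorphism of $J$ given by $A\mapsto AA^{p^{2m}}$, $B\mapsto BA^{-p^{2m}}$, and $\Delta$ is the automorphism of $J$ given by $A\mapsto AB^{p^m}$, $B\mapsto BB^{-(2-d)p^m}A^{p^m}$, subject to the defining relations $$a^{[a,b]}=a^\alpha,\quad b^{[b,a]}=b^\alpha,\quad a^{p^{2m}}=1,\quad b^{p^{2m}}=1,$$ $$x^{p^m}=1,\quad a^x=a,\quad b^x=b,$$ $$\Delta^{p^m}=[a,b]^{up^m}x^v,$$ $$a^\Delta=ab^{p^m},\quad b^\Delta=bb^{-(2-d)p^m}a^{p^m},\quad x^\Delta=x,$$ where $d=0$ if $p\neq 3$ and $d=3^{m-1}\ell$ if $p=3$, and $u,v\in\mathbb Z$ are the integers, uniquely determined modulo $p^m$, satisfying $-1\equiv u\ell+v \bmod p^m$ and $3-d\equiv u\ell-v\bmod p^m$.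
   Context: $p$ is an odd prime, $m\geq 1$ an integer, and $\alpha>1$ an integer with $v_p(\alpha-1)=m$ ($v_p$ is the $p$-adic valuation); if $p=3$ and $m=1$, it is also assumed that $(\alpha-1)/3\equiv 1\bmod 3$. Write $\alpha=1+\ell p^m$ with $\ell\in\mathbb N$ (so $p\nmid\ell$). Conventions: $[x,y]=x^{-1}y^{-1}xy$, $x^y=y^{-1}xy$, in any group (including automorphism groups); functions are composed from left to right, so the product $gh$ of automorphisms means first $g$, then $h$. $J$ is the group (a finite $p$-group of order $p^{7m}$ and nilpotency class 5) $$J=\langle A,B\,|\,A^{[A,B]}=A^\alpha,\ B^{[B,A]}=B^\alpha,\ A^{p^{3m}}=B^{p^{3m}}=1\rangle.$$ In $J$ one has $A^{p^{2m}}B^{p^{2m}}=1$ and $Z(J)=\langle A^{p^{2m}}\rangle$. For a group $T$, $1=Z_0(T)\subseteq Z_1(T)=Z(T)\subseteq Z_2(T)\subseteq\cdots$ is the upper central series, $\mathrm{Aut}_i(T)$ is the kernel of the canonical map $\mathrm{Aut}(T)\to\mathrm{Aut}(T/Z_i(T))$, and for $t\in T$, $t\delta$ denotes the inner automorphism $y\mapsto y^t=t^{-1}yt$. Both assignments for $x$ and $\Delta$ in the claim do extend to automorphisms of $J$. *)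

(* Defs.v *)
From mathcomp Require Import all_boot all_order all_algebra all_fingroup all_solvable.

Set Implicit Arguments.
Unset Strict Implicit.
Unset Printing Implicit Defensive.

Import GroupScope.

Definition zexpg (T : groupType) (x : T) (z : int) : T :=
  match z with
  | Posz n => x ^+ n
  | Negz n => x ^- n.+1
  end.

(* [presented_by G s R]: the generators s and the relations R present G, with
   the generators of the presentation corresponding to the elements of s. The
   universal property is required with respect to all groups T, finite or not
   (unlike [_ \isog Grp (_)] of presentation.v, which only tests finite ones). *)
Definition presented_by (gT : finGroupType) (G : {set gT}) (s : seq gT)
    (R : forall T : groupType, seq T -> Prop) : Prop :=
  [/\ <<[set g in s]>> = G,
      R gT s
    & forall (T : groupType) (t : seq T), R T t ->
        exists f : gT -> T,
          {in G &, {morph f : y z / y * z}} /\ map f s = t].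

Definition J_rels (p m alpha : nat) (T : groupType) (s : seq T) : Prop :=
  match s with
  | [:: A; B] =>
      [/\ A ^ [~ A, B] = A ^+ alpha,
          B ^ [~ B, A] = B ^+ alpha,
          A ^+ (p ^ (3 * m)) = 1
        & B ^+ (p ^ (3 * m)) = 1]
  | _ => False
  end.

Definition dpar (p m l : nat) : nat :=
  if p == 3 then (3 ^ (m - 1) * l)%N else 0%N.

(* The image y * y^(-(2-d)p^m) * z^(p^m) of the second generator under Delta;
   2 - d is an integer and may be negative. *)
Definition Delta_snd (p m l : nat) (T : groupType) (y z : T) : T :=
  y * zexpg y (- (2%:Z - (dpar p m l)%:Z) * (p ^ m)%N%:Z)%R * z ^+ (p ^ m).

Definition Aut4_rels (p m l alpha : nat) (u v : int)
    (T : groupType) (s : seq T) : Prop :=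
  match s with
  | [:: a; b; x; D] =>
      [/\ a ^ [~ a, b] = a ^+ alpha,
          b ^ [~ b, a] = b ^+ alpha,
          a ^+ (p ^ (2 * m)) = 1
        & b ^+ (p ^ (2 * m)) = 1]
      /\ [/\ x ^+ (p ^ m) = 1, a ^ x = a & b ^ x = b]
      /\ D ^+ (p ^ m) = zexpg [~ a, b] (u * (p ^ m)%N%:Z)%R * zexpg x v
      /\ [/\ a ^ D = a * b ^+ (p ^ m),
             b ^ D = Delta_snd p m l b a
           & x ^ D = x]
  | _ => False
  end.

Definition uv_spec (p m l : nat) (u v : int) : Prop :=
  (-1 = u * l%:Z + v %[mod (p ^ m)%N%:Z])%Z /\
  (3 - (dpar p m l)%:Z = u * l%:Z - v %[mod (p ^ m)%N%:Z])%Z.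

Section AutZ.

Variable gT : finGroupType.

(* The automorphisms of G inducing the identity on G / 'Z_i(G). *)
Definition AutZ (i : nat) (G : {set gT}) : {set {perm gT}} :=
  [set s in Aut G | [forall y in G, coset 'Z_i(G) (s y) == coset 'Z_i(G) y]].

Lemma AutZ_group_set i (G : {group gT}) : group_set (AutZ i G).
Proof.
apply/group_setP; split=> [|s t].
  by rewrite inE group1; apply/forall_inP=> y _; rewrite perm1.
case/setIdP=> sG /forall_inP sP /setIdP[tG /forall_inP tP].
apply/setIdP; split; first exact: groupM.
apply/forall_inP=> y yG.
by rewrite permM (eqP (tP _ _)) ?(eqP (sP _ yG)) // Aut_closed.
Qed.

Canonical AutZ_group i (G : {group gT}) := Group (AutZ_group_set i G).

End AutZ.

(* Main.v *)
Require Import Defs.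
From mathcomp Require Import all_boot all_order all_algebra all_fingroup all_solvable.
From mathcomp Require Import ring zify.

Set Implicit Arguments.
Unset Strict Implicit.
Unset Printing Implicit Defensive.

Import GRing.Theory GroupScope.

(** Write [n], [N], [P] for [p^m], [p^(2m)], [p^(3m)], and [C = [~ A, B]]. Exponents are computed in
    [Z/P], where [eps = l * n] has zero cube. [C] multiplies exponents of [A] by [alpha = 1 + eps]
    and exponents of [B] by its inverse; hence [(A ^+ k) ^ B = A ^^ gs k * C ^+ k] with a geometric
    sum [gs k]. Computing [(A ^+ alpha) ^ B] in two ways ([J_key]) yields [C ^+ N = 1] and
    [A ^+ N * B ^+ N = 1].

    Every element is then a product [C ^^ k * B ^^ j * A ^^ i]. A permutation model on pairs
    [(j, i)] shows that this form is unique up to those two relations ([nf_uniq]). Consequently [A]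
    is centralized only by its powers ([centA]), the centre is generated by [A ^+ N], and ['Z_4(J)]
    is the kernel of the pair of exponent sums [eA], [eB] modulo [n] ([Z4P]).

    Upper bound: an element of [AutZ 4 J] sends [A] into [A *: 'Z_4(J)], of size at most [p^(5m)];
    if it fixes [A], it sends [B] to a central element times a conjugate of [B] by a power of [A]
    ([fix_A]), which leaves at most [p^(3m)] choices. So the order is at most [p^(8m)]
    ([card_Aut4_le]).

    Lower bound: the inner automorphisms number at least [p^(6m)]; [x] has order [n] modulo them
    ([x_Inn]), and [Delta] has order [n] modulo the group they generate with [x] ([D_Inn]). The
    bounds meet, so these elements generate [AutZ 4 J] ([Aut4_K]). The formula for the [n]-th power
    of [Delta] comes from comparing images of [A] and [B] ([D_n]): this is the linear system for [u]
    and [v].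

    Presentation: [AutZ 4 J] is obtained from the inner automorphism group, which is [J] modulo its
    centre, by two cyclic extensions. A homomorphism out of [J] killing the centre therefore extends
    step by step ([cycext_map], [Aut4_map]).

    Index: a representation of [J] by quadratic maps of [Z/N] constrains the exponent sums of any
    pair satisfying the defining relations ([rel_exponents]). If [eA (s A)] is a unit, the matrix of
    [s] on exponent sums is diagonal of determinant one ([unit_case]). The action on the centre
    makes its two entries equal ([diag_eq]), hence both are 1 or both are -1, and -1 is excluded by
    [no_inversion]. All other automorphisms are reduced to this case by exchanging [A] and [B]
    ([index2]). *)

(** * Powers with exponents in [Z/q] *)

Lemma natZ_eq q i j : 1 < q -> (i%:R = j%:R :> 'Z_q)%R <-> i = j %[mod q].
Proof.
move=> q1; have v k : val (k%:R : 'Z_q)%R = k %% q by exact: val_Zp_nat.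
by split=> [E|E]; [rewrite -!v E | apply: val_inj; rewrite !v].
Qed.

Lemma natZ_val q (x : 'Z_q) : ((x : nat)%:R = x)%R.
Proof. exact: natr_Zp. Qed.

(** The exponent is read through its least representative. When [x ^+ q = 1] the usual laws hold,
    and exponents can be manipulated by [ring]. *)
Definition zx q (T : groupType) (x : T) (e : 'Z_q) : T := x ^+ (e : nat).
Arguments zx {q T} x e.
Notation "x ^^ e" := (zx x e%R) (at level 29, left associativity) : group_scope.

Section ModularPowers.

Variables (q : nat) (T : groupType).
Hypothesis q_gt1 : 1 < q.
Implicit Types (x y : T) (e f : 'Z_q).

Lemma expg_modn x k : x ^+ q = 1 -> x ^+ (k %% q) = x ^+ k.
Proof. by move=> xq; rewrite {2}(divn_eq k q) expgnDr mulnC expgnA xq expg1n mul1g. Qed.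

Lemma zx_nat x k : x ^+ q = 1 -> x ^^ (k%:R : 'Z_q) = x ^+ k.
Proof. by move=> xq; rewrite /zx val_Zp_nat // expg_modn. Qed.

Lemma zx0 x : x ^^ (0 : 'Z_q) = 1. Proof. by []. Qed.

Lemma zx1 x : x ^^ (1 : 'Z_q) = x.
Proof. by case: q q_gt1 => [|[]] // q' _; rewrite /zx /= expg1. Qed.

Lemma zxD x e f : x ^+ q = 1 -> x ^^ (e + f) = x ^^ e * x ^^ f.
Proof. by move=> xq; rewrite -(natZ_val e) -(natZ_val f) -natrD !zx_nat // expgnDr. Qed.

Lemma zxq x e : x ^+ q = 1 -> (x ^^ e) ^+ q = 1.
Proof. by move=> xq; rewrite /zx expgnAC xq expg1n. Qed.

Lemma zxN x e : x ^+ q = 1 -> x ^^ (- e) = (x ^^ e)^-1.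
Proof. by move=> xq; apply: (mulgI (x ^^ e)); rewrite -zxD // subrr mulgV. Qed.

Lemma zxV x e : x ^+ q = 1 -> x^-1 ^^ e = x ^^ (- e).
Proof. by move=> xq; rewrite zxN // /zx expVgn. Qed.

Lemma zxM x e f : x ^+ q = 1 -> x ^^ (e * f) = x ^^ e ^^ f.
Proof.
move=> xq; rewrite -(natZ_val e) -(natZ_val f) -natrM !zx_nat //.
  by rewrite expgnA.
by rewrite expgnAC xq expg1n.
Qed.

Lemma zxMC x e f : x ^^ e ^^ f = x ^^ f ^^ e.
Proof. by rewrite /zx expgnAC. Qed.

Lemma zxJ x y e : (x ^^ e) ^ y = (x ^ y) ^^ e.
Proof. by rewrite /zx conjXg. Qed.

Lemma zxC x y e : commute x y -> commute (x ^^ e) y.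
Proof. by move=> cxy; apply/commute_sym/commuteX/commute_sym. Qed.

Lemma zxCC x e f : commute (x ^^ e) (x ^^ f).
Proof. by apply: zxC; apply/commute_sym/zxC. Qed.

Lemma zxMg x y e : commute x y -> (x * y) ^^ e = x ^^ e * y ^^ e.
Proof. exact: expgMn. Qed.

(* [x * y ^+ -r = y ^+ -r * x ^ (y ^+ -r)], so that conjugates of [x] pile up in
   front. *)
Lemma expMg_geom x y (a : 'Z_q) k : x ^+ q = 1 -> x ^ y^-1 = x ^^ a ->
  (x * y) ^+ k = x ^^ (\sum_(r < k) a ^+ r) * y ^+ k.
Proof.
move=> xq xy.
have xyr r : x ^ (y ^- r) = x ^^ (a ^+ r).
  elim: r => [|r IH]; first by rewrite expg0 invg1 conjg1 expr0 zx1.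
  by rewrite expgSr invMg conjgM xy zxJ IH exprSr zxM.
elim: k => [|k IH]; first by rewrite big_ord0 zx0 mulg1.
rewrite expgSr IH big_ord_recr zxD // -xyr expgSr !mulgA; congr (_ * _).
by rewrite /= invgK mulgVK.
Qed.

(** Each [x] is moved to the left past the earlier [y]; every such exchange leaves one [w], and
    there are ['C(k, 2)] of them. *)
Lemma expMg_step (x y w : T) k :
  y ^ x = y * w -> commute w x -> commute w y ->
  (x * y) ^+ k = x ^+ k * y ^+ k * w ^+ 'C(k, 2).
Proof.
move=> yx cwx cwy.
have ykx j : (y ^+ j) * x = x * y ^+ j * w ^+ j.
  by rewrite [LHS]conjgC conjXg yx expgMn ?mulgA //; apply: commute_sym.
elim: k => [|k IH]; first by rewrite !mulg1.
have cX j z : commute w z -> commute (w ^+ j) z.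
  by move=> cwz; apply/commute_sym/commuteX/commute_sym.
have -> : (x * y) ^+ k.+1 = x ^+ k * (y ^+ k * x) * y * w ^+ 'C(k, 2).
  rewrite expgSr IH -!mulgA; congr (_ * (_ * _)).
  by rewrite mulgA; apply: cX; apply: commuteM.
rewrite ykx binS bin1 addnC expgnDr (expgSr x) (expgSr y) !mulgA; congr (_ * _).
by rewrite -!mulgA (cX k y).
Qed.

End ModularPowers.

(** * Homomorphisms from a finite group to an arbitrary group, and tests on generators *)

Section LocalMorphism.
Variables (gT : finGroupType) (G : {group gT}) (T : groupType) (f : gT -> T).
Hypothesis fM : {in G &, {morph f : y z / y * z}}.

Lemma morphin1 : f 1 = 1.
Proof. by apply: (mulgI (f 1)); rewrite -fM ?group1 // !mulg1. Qed.

Lemma morphinV x : x \in G -> f x^-1 = (f x)^-1.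
Proof.
by move=> xG; apply: (mulgI (f x)); rewrite -fM ?groupV // !mulgV morphin1.
Qed.

Lemma morphinX x k : x \in G -> f (x ^+ k) = f x ^+ k.
Proof.
by move=> xG; elim: k => [|k IH]; rewrite ?morphin1 // !expgS fM ?groupX // IH.
Qed.

Lemma morphinJ x y : x \in G -> y \in G -> f (x ^ y) = f x ^ f y.
Proof. by move=> xG yG; rewrite !conjgE !fM ?groupM ?groupV // morphinV. Qed.

Lemma morphinR x y : x \in G -> y \in G -> f [~ x, y] = [~ f x, f y].
Proof. by move=> xG yG; rewrite !commgEl fM ?groupJ ?groupV // morphinV // morphinJ. Qed.

Lemma morphin_zx q (x : gT) (e : 'Z_q) : x \in G -> f (x ^^ e) = f x ^^ e.
Proof. exact: morphinX. Qed.

End LocalMorphism.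

Lemma zx_group q (gT : finGroupType) (G : {group gT}) x (e : 'Z_q) :
  x \in G -> x ^^ e \in G.
Proof. exact: groupX. Qed.

(** In a finite group the elements of [<<X>>] are products of elements of [X] without inverses, so
    right multiplication by generators is enough. *)
Lemma gen_ind (gT : finGroupType) (X : {set gT}) (Q : gT -> Prop) :
  Q 1 -> (forall g x, g \in <<X>> -> x \in X -> Q g -> Q (g * x)) ->
  forall g, g \in <<X>> -> Q g.
Proof.
move=> Q1 QM g /gen_prodgP[k [c cX ->]].
suff [] : \prod_(i < k) c i \in <<X>> /\ Q (\prod_(i < k) c i) by [].
elim: k c cX => [|k IH] c cX; first by rewrite big_ord0 group1.
rewrite big_ord_recr /=; have [|gX Qg] := IH (fun i => c (widen_ord (leqnSn k) i)).
  by move=> i; apply: cX.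
by split; [apply: groupM => //; apply/mem_gen/cX | apply: QM].
Qed.

(** ['Z_i.+1(G)] is the preimage of the centre of [G / 'Z_i(G)], and the elements commuting with [g]
    modulo ['Z_i(G)] form a subgroup. *)
Lemma ucnS_gen (gT : finGroupType) (G : {group gT}) (X : {set gT}) i g :
  <<X>> = G -> g \in G -> (forall x, x \in X -> [~ g, x] \in 'Z_i(G)) -> g \in 'Z_i.+1(G).
Proof.
move=> XG gG gX; have nZ := normal_norm (ucn_normal i G).
have XsG : X \subset G by rewrite -XG subset_gen.
have gN : g \in 'N('Z_i(G)) by apply: subsetP gG.
rewrite (_ : 'Z_i.+1(G) = coset 'Z_i(G) @*^-1 'Z(G / 'Z_i(G))) //.
rewrite mem_morphpre //; apply/centerP; split; first exact: mem_quotient.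
suff: <<X>> \subset coset 'Z_i(G) @*^-1 'C[coset 'Z_i(G) g].
  rewrite XG => /subsetP H _ /morphimP[y yN yG ->].
  case/morphpreP: (H y yG) => _ Hy.
  by apply: commute_sym; apply: (elimT cent1P Hy).
rewrite gen_subG; apply/subsetP=> x xX; have xG := subsetP XsG x xX.
have xN : x \in 'N('Z_i(G)) by apply: subsetP xG.
rewrite mem_morphpre //; apply/cent1P; apply: commute_sym; apply/commgP.
by rewrite -morphR //= coset_id // gX.
Qed.

(** * Additive functions, and automorphisms determined on two generators *)

Section Additive.
Variables (gT : finGroupType) (G : {group gT}) (q : nat) (e : gT -> 'Z_q).
Hypothesis eM : {in G &, forall x y, e (x * y) = (e x + e y)%R}.

Lemma add1 : e 1 = 0%R.
Proof. by apply: (addrI (e 1)); rewrite -eM ?group1 // mulg1 addr0. Qed.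

Lemma addV x : x \in G -> e x^-1 = (- e x)%R.
Proof.
by move=> xG; apply: (addrI (e x)); rewrite -eM ?groupV // mulgV add1 subrr.
Qed.

Lemma addX x k : x \in G -> e (x ^+ k) = (e x *+ k)%R.
Proof.
by move=> xG; elim: k => [|k IH]; rewrite ?add1 // expgS mulrS eM ?groupX // IH.
Qed.

Lemma addJ x y : x \in G -> y \in G -> e (x ^ y) = e x.
Proof.
by move=> xG yG; rewrite conjgE !eM ?groupM ?groupV // addV // addrC addrK.
Qed.

Lemma addR x y : x \in G -> y \in G -> e [~ x, y] = 0%R.
Proof. by move=> xG yG; rewrite commgEl eM ?groupJ ?groupV // addV // addJ // addNr. Qed.

End Additive.

Section AutGen.
Variables (gT : finGroupType) (G : {group gT}).

Lemma autM (s : {perm gT}) : s \in Aut G -> {in G &, {morph s : y z / y * z}}.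
Proof. by move=> sA; apply: (morphicP (Aut_morphic sA)). Qed.

Lemma aut_ext (A B : gT) (s t : {perm gT}) : <<[set A; B]>> = G ->
  s \in Aut G -> t \in Aut G -> s A = t A -> s B = t B -> s = t.
Proof.
move=> genG sG tG EA EB; apply: (eq_Aut sG tG) => g.
rewrite -{1}genG; move: g; apply: gen_ind; first by rewrite (morphin1 (autM sG)) (morphin1 (autM tG)).
rewrite genG => g x gG xAB IH.
have xG : x \in G by rewrite -genG mem_gen.
by rewrite (autM sG) // (autM tG) // IH; case/set2P: xAB => ->; rewrite ?EA ?EB.
Qed.

End AutGen.

(** * Order of a cyclic extension and extension of homomorphisms to it *)

Section CyclicExtension.

Variables (gT : finGroupType) (H : {group gT}) (y : gT) (n : nat).
Hypotheses (n_gt0 : 0 < n) (yN : y \in 'N(H)) (yn : y ^+ n \in H).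
Hypothesis y_min : forall k, y ^+ k \in H -> n %| k.
Let K := H <*> <[y]>.

Lemma cycextP g : reflect (exists2 h, h \in H & exists k, g = h * y ^+ k) (g \in K).
Proof.
have sN : <[y]> \subset 'N(H) by rewrite cycle_subG.
rewrite /K norm_joinEr //; apply: (iffP mulsgP) => [[h _ hH /cycleP[k ->] ->] | [h hH [k ->]]].
  by exists h => //; exists k.
by exists h (y ^+ k); rewrite ?mem_cycle.
Qed.

Lemma cycext_inj h k h' k' : h \in H -> h' \in H ->
  h * y ^+ k = h' * y ^+ k' -> k = k' %[mod n].
Proof.
wlog le : h k h' k' / k <= k'.
  move=> W hH h'H E; case: (leqP k k') => [le | /ltnW le]; first exact: (W h k h' k').
  by apply/esym; apply: (W h' k' h k).
move=> hH h'H E.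
have : y ^+ (k' - k) \in H.
  have -> : y ^+ (k' - k) = h'^-1 * h.
    by rewrite expgnFr //; apply: (mulIg (y ^+ k)); rewrite mulgVK -mulgA E mulKg.
  by rewrite groupM ?groupV.
by move/y_min; rewrite -eqn_mod_dvd // => /eqP.
Qed.

(** By the minimality of [n], the cosets of the [y ^+ k] with [k < n] are distinct. *)
Lemma card_cycext : n * #|H| <= #|K|.
Proof.
pose F (x : 'I_n * gT) := x.2 * y ^+ x.1.
rewrite -{1}(card_ord n) -cardsT -cardsX.
rewrite -(card_in_imset (f := F)).
  apply/subset_leq_card/subsetP => _ /imsetP[[k h] /setXP[_ hH] ->].
  by apply/cycextP; exists h => //; exists k.
move=> [k h] [k' h'] /setXP[_ /= hH] /setXP[_ /= h'H]; rewrite /F /= => E.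
have := cycext_inj hH h'H E; rewrite !modn_small // => /val_inj kk.
by move: E; rewrite kk => /mulIg ->.
Qed.

Variables (T : groupType) (phi : gT -> T) (t : T).
Hypothesis phiM : {in H &, {morph phi : g h / g * h}}.
Hypothesis phiJ : {in H, forall h, phi (h ^ y) = phi h ^ t}.
Hypothesis phiX : phi (y ^+ n) = t ^+ n.

(** An element of [K] is [h * y ^+ k] with [k] determined modulo [n]. Sending it to [phi h * t ^+ k]
    is well defined by [phiX] and multiplicative by [phiJ]. *)
Lemma cycext_map : exists f : gT -> T,
  [/\ {in K &, {morph f : g h / g * h}}, {in H, f =1 phi} & f y = t].
Proof.
(* The representative with [k < n] is chosen; [fE] shows that every other one gives the same value.
   The default [1] is reached only outside [K]. *)
pose f g := if [pick k : 'I_n | g * y ^- k \in H] is Some k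
            then phi (g * y ^- k) * t ^+ k else 1.
have phi_nX q : phi (y ^+ (n * q)) = t ^+ (n * q).
  by rewrite expgnA (morphinX phiM) // phiX expgnA.
have fE h k : h \in H -> f (h * y ^+ k) = phi h * t ^+ k.
  move=> hH; rewrite /f; case: pickP => [k' /= k'H | /(_ (Ordinal (ltn_pmod k n_gt0)))]; last first.
    have -> : h * y ^+ k * y ^- (k %% n) = h * (y ^+ n) ^+ (k %/ n).
      by rewrite {1}(divn_eq k n) expgnDr (mulnC _ n) expgnA -!mulgA mulgV mulg1.
    move=> W; have : h * (y ^+ n) ^+ (k %/ n) \in H := groupM hH (groupX _ yn).
    by rewrite W.
  have E : k = k' %[mod n].
    by apply: (cycext_inj hH k'H); rewrite mulgVK.
  have [q Eq] : exists q, k = k' + n * q.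
    exists (k %/ n); rewrite {1}(divn_eq k n) addnC mulnC; congr (_ + _)%N.
    by rewrite E modn_small.
  have -> : h * y ^+ k * y ^- k' = h * y ^+ (n * q).
    by rewrite Eq addnC expgnDr -!mulgA mulgV mulg1.
  rewrite phiM //; last by rewrite expgnA groupX.
  by rewrite phi_nX -mulgA -expgnDr Eq addnC.
have phiJX h k : h \in H -> h ^ (y ^+ k) \in H /\ phi (h ^ (y ^+ k)) = phi h ^ (t ^+ k).
  move=> hH; elim: k => [|k [IH1 IH2]]; first by rewrite !conjg1.
  by rewrite !expgSr !conjgM memJ_norm // phiJ // IH2.
exists f; split.
- move=> _ _ /cycextP[h hH [k ->]] /cycextP[h' h'H [k' ->]].
  have ykN : y ^- k \in 'N(H) by rewrite groupV groupX.
  set h1 := h' ^ (y ^- k).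
  have h1H : h1 \in H by rewrite memJ_norm.
  have -> : h * y ^+ k * (h' * y ^+ k') = h * h1 * y ^+ (k + k').
    by rewrite /h1 conjgE invgK expgnDr -!mulgA mulKg.
  rewrite (fE _ _ (groupM hH h1H)) (fE h) // (fE h') // phiM // expgnDr -!mulgA; congr (_ * _); rewrite !mulgA; congr (_ * _).
  have [_] := phiJX h1 k h1H; rewrite {1}/h1 conjgKV => ->.
  by rewrite -conjgC.
- by move=> h hH; rewrite -[h in LHS]mulg1 -(expg0 y) fE // mulg1.
- have := fE 1 1%N (group1 H); rewrite mul1g expg1 => ->.
  by rewrite (morphin1 phiM) mul1g.
Qed.

End CyclicExtension.

(** * Arithmetic modulo [p^(3m)] *)

Section MacdonaldGroup.

Variables p m l : nat.
Hypotheses (p_prime : prime p) (p_odd : odd p) (m_gt0 : 0 < m).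
Hypothesis p'l : ~~ (p %| l)%N.
Hypothesis case3 : p = 3 -> m = 1%N -> l = 1 %[mod 3].

Local Notation n := (p ^ m)%N.
Local Notation N := (p ^ (2 * m))%N.
Local Notation P := (p ^ (3 * m))%N.
Local Notation R := 'Z_P.
Local Notation nn := (n%:R : R)%R.

Section Arithmetic.

(** This is [n / 3] when [p = 3], and it is the residue of ['C(n, 3)] modulo [n] in all cases. Its
    product with [l] is the parameter [d] of the presentation. *)
Definition third := if p == 3 then (3 ^ (m - 1))%N else 0%N.

Lemma dparE : dpar p m l = (third * l)%N.
Proof. by rewrite /dpar /third; case: eqP. Qed.

Lemma p_gt2 : 2 < p.
Proof. by rewrite odd_prime_gt2. Qed.

Lemma n_odd : odd n. Proof. by rewrite oddX p_odd orbT. Qed.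
Lemma n_gt2 : 2 < n.
Proof.
by apply: leq_trans p_gt2 _; rewrite -{1}(expn1 p) leq_pexp2l // ltnW // ltnW // p_gt2.
Qed.
Lemma n_gt1 : 1 < n. Proof. exact: ltnW n_gt2. Qed.
Lemma n_gt0 : 0 < n. Proof. exact: leq_trans n_gt2. Qed.
Lemma NE : N = (n * n)%N. Proof. by rewrite -expnD addnn mul2n. Qed.
Lemma PE : P = (n * n * n)%N. Proof. by rewrite !mulSn addn0 addnA !expnD. Qed.
Lemma P_odd : odd P. Proof. by rewrite oddX p_odd orbT. Qed.
Lemma P_gt1 : 1 < P.
Proof. by apply: leq_trans n_gt1 _; rewrite PE leq_pmull // muln_gt0 n_gt0. Qed.
Lemma N_gt1 : 1 < N.
Proof. by apply: leq_trans n_gt1 _; rewrite NE leq_pmull ?n_gt0. Qed.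

Lemma dvdn_bin2 k : n %| k -> n %| 'C(k, 2).
Proof.
move=> nk; have := bin_ffact k 2; rewrite ffactnSr ffactn1 subn1 => E.
rewrite -(@Gauss_dvdl n 'C(k,2) 2) ?coprimen2 ?n_odd //.
have -> : ('C(k,2) * 2 = k * k.-1)%N by rewrite -E; congr (_ * _)%N.
exact: dvdn_mulr.
Qed.

(** For [p > 3] the denominator 6 is prime to [n]. For [p = 3] and [k = 3 * q], the binomial is
    [q * (3 * q - 1) * (3 * q - 2) / 2], which is [q] plus a multiple of [3 * q = k]. *)
Lemma bin3_mod k : n %| k -> 'C(k, 3) = third * (k %/ n) %[mod n].
Proof.
move=> /dvdnP[k' ->]; rewrite mulnK ?n_gt0 //.
have E := bin_ffact (k' * n) 3; rewrite !ffactnSr ffactn0 mul1n subn0 in E.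
rewrite /third; case: eqP => [p3|/eqP p'3].
  set q := (3 ^ (m - 1) * k')%N.
  have n3 : n = (3 * 3 ^ (m - 1))%N by rewrite p3 -expnS; congr (_ ^ _)%N; lia.
  have kq : (k' * n = 3 * q)%N by rewrite n3 /q mulnCA (mulnC k').
  have [q0|q_gt0] := posnP q; first by rewrite kq q0 muln0 bin0n.
  have {}E : ('C(k' * n, 3) * 2 = q * 2 + q * 3 * (q * (3 * q - 3)))%N.
    move: E q_gt0; rewrite kq; change (3`!) with 6; case: q {kq} => // q' E _.
    have {E} : ('C(3 * q'.+1, 3) * 6 = 3 * (q'.+1 * (9 * q' ^ 2 + 9 * q' + 2)))%N.
      rewrite E (_ : 3 * q'.+1 - 1 = 3 * q' + 2)%N; last by lia.
      by rewrite (_ : 3 * q'.+1 - 2 = 3 * q' + 1)%N; [ring | lia].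
    rewrite (_ : 3 * q'.+1 - 3 = 3 * q')%N; last by lia.
    move=> E; suff: (3 * ('C(3 * q'.+1, 3) * 2) =
      3 * (q'.+1 * 2 + q'.+1 * 3 * (q'.+1 * (3 * q'))))%N by lia.
    by rewrite mulnCA (_ : 3 * 2 = 6)%N // E; ring.
  apply/eqP; have c2 : coprime n 2 by rewrite coprimen2 n_odd.
  have nq : n %| q * 3 * (q * (3 * q - 3)).
    by rewrite (mulnC q) -kq -mulnA dvdn_mull // dvdn_mulr.
  have Q : 'C(k' * n, 3) * 2 = q * 2 %[mod n].
    by rewrite E -modnDmr (eqP nq) addn0.
  have [le|/ltnW le] := leqP q 'C(k' * n, 3).
    rewrite eqn_mod_dvd // -(@Gauss_dvdl _ _ 2) // mulnBl -eqn_mod_dvd ?leq_mul2r ?le //.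
    exact/eqP.
  rewrite eq_sym eqn_mod_dvd // -(@Gauss_dvdl _ _ 2) // mulnBl.
  rewrite -eqn_mod_dvd ?leq_mul2r ?le // eq_sym; exact/eqP.
rewrite mul0n; apply/eqP; rewrite mod0n; change (n %| 'C(k' * n, 3)).
have c6 : coprime n 6.
  rewrite coprimeXl // (coprimeMr p 2 3) coprimen2 p_odd /= prime_coprime //.
  by rewrite dvdn_prime2.
by rewrite -(@Gauss_dvdl n _ 6) // E -mulnA dvdn_mulr // dvdn_mull.
Qed.

(** In [Z/P]: [al] is [alpha], [ai] its inverse, [kap = 1 - ai], and [hlf] is one half. The cube of
    [eps] vanishes, and [nu], the class of [p^(2m)], annihilates all multiples of [n]. *)
Definition eps : R := ((l * n)%N%:R)%R.
Definition hlf : R := ((P.+1)./2%:R)%R.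
Definition al : R := (1 + eps)%R.
Definition ai : R := (1 - eps + eps ^+ 2)%R.
Definition kap : R := (eps - eps ^+ 2)%R.
Definition nu : R := (N%:R)%R.

Local Open Scope ring_scope.

Lemma P_eq0 : P%:R = 0 :> R.
Proof. by apply/(natZ_eq P 0 P_gt1); rewrite modnn mod0n. Qed.

Lemma eps3 : eps ^+ 3 = 0.
Proof.
rewrite /eps -natrX expnMn -[(n ^ 3)%N]expnM (mulnC m) natrM P_eq0; exact: mulr0.
Qed.

Lemma half2 : 2 * hlf = 1.
Proof.
rewrite /hlf -natrM mul2n -[X in _ = X](addr0 1) -P_eq0 nat1r.
congr (_%:R); have := odd_double_half P.+1.
by rewrite /= P_odd add0n.
Qed.

Lemma alai : al * ai = 1.
Proof. rewrite /al /ai; ring: eps3. Qed.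

Lemma ai_kap : ai = 1 - kap. Proof. rewrite /ai /kap; ring. Qed.

Lemma kap3 : kap ^+ 3 = 0. Proof. rewrite /kap; ring: eps3. Qed.

Lemma nu_mod i j : i = j %[mod n] -> nu * i%:R = nu * j%:R.
Proof.
move=> E; rewrite /nu -!natrM; apply/(natZ_eq _ _ P_gt1).
by rewrite PE NE -!muln_modr E.
Qed.

(** Multiplication by [nu] identifies [Z/n] with the ideal generated by [nu]. *)
Lemma nuE i j : nu * i%:R = nu * j%:R <-> i = j %[mod n].
Proof.
split; last exact: nu_mod.
rewrite /nu -!natrM => /(natZ_eq _ _ P_gt1).
rewrite PE NE -!muln_modr => /eqP; rewrite eqn_mul2l => /orP[|/eqP//].
by rewrite muln_eq0 -leqn0 leqNgt n_gt0.
Qed.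

Lemma nu_eps : nu * eps = 0.
Proof. by rewrite /eps (@nu_mod _ 0) ?mulr0n ?mulr0 // modnMl mod0n. Qed.

Lemma eps2 : eps ^+ 2 = nu * (l ^ 2)%:R.
Proof. by rewrite /eps /nu -natrX -natrM expnMn (mulnC (l ^ 2)%N) -expnM (mulnC m). Qed.

Lemma kap2 : kap ^+ 2 = eps ^+ 2. Proof. rewrite /kap; ring: eps3. Qed.

(* The common value of [eps ^+ 3 / 3]: it vanishes unless [p = 3]. *)
Definition theta : R := eps ^+ 2 * (third * l)%N%:R.

Lemma theta3 : 3 * theta = 0.
Proof.
rewrite /theta eps2 -mulrA mulrCA -!natrM natrM -/nu (@nu_mod _ 0) ?mulr0n ?mulr0 // mod0n.
apply/eqP; change (n %| 3 * (l ^ 2 * (third * l)))%N.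
rewrite /third; case: eqP => [p3|_]; last by rewrite mul0n !muln0.
have n3 : n = (3 * 3 ^ (m - 1))%N by rewrite p3 -expnS; congr (_ ^ _)%N; lia.
by apply/dvdnP; exists (l ^ 3)%N; rewrite n3; ring.
Qed.

Lemma theta_eps : theta * eps = 0.
Proof. rewrite /theta; ring: eps3. Qed.

Lemma theta_half : theta * hlf = - theta.
Proof.
have E : theta = - (2 * theta) by apply: (addIr (2 * theta)); rewrite addNr -theta3; ring.
by rewrite {1}E mulNr mulrAC half2 mul1r.
Qed.

(** [3 * theta = 0], and [i ^+ 3 - i] is a multiple of 3. *)
Lemma theta_cube i : theta * (i ^+ 3 - i) = 0.
Proof.
rewrite -(natZ_val i).
suff [c E] : exists c, ((i : nat) ^ 3 = i + 3 * c)%N.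
  by rewrite -natrX E natrD natrM; ring: theta3.
elim: (i : nat) => [|k [c IH]]; first by exists 0%N.
by exists (c + k ^ 2 + k)%N; lia.
Qed.

Lemma eps2_mod i j : i = j %[mod n] -> eps ^+ 2 * i%:R = eps ^+ 2 * j%:R.
Proof. by move=> E; rewrite eps2 -!mulrA !(mulrCA _ (l ^ 2)%:R) (nu_mod E). Qed.

Lemma bin2_half k : ('C(k, 2))%:R = hlf * k%:R * (k%:R - 1) :> R.
Proof.
elim: k => [|k IH]; first by rewrite bin0n mulr0 mul0r.
rewrite binS bin1 natrD IH -natr1; apply/eqP; rewrite -subr_eq0; apply/eqP.
by transitivity ((1 - 2 * hlf) * k%:R); [ring | rewrite half2 subrr mul0r].
Qed.

Lemma geom_sum (S : comPzRingType) (y : S) k : y ^+ 3 = 0 ->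
  (1 + y) ^+ k = 1 + k%:R * y + 'C(k, 2)%:R * y ^+ 2
  /\ \sum_(r < k) (1 + y) ^+ r = k%:R + 'C(k, 2)%:R * y + 'C(k, 3)%:R * y ^+ 2.
Proof.
move=> y3; elim: k => [|k [IH1 IH2]].
  by rewrite !bin0n big_ord0 expr0 /= ; split; ring.
rewrite big_ord_recr IH2 exprS IH1 /= !binS bin1 !natrD -natr1.
by split; ring: y3.
Qed.

(** The exponent of [A] in [(A ^+ k) ^ B], see [expA_B]. As [kap ^+ 3 = 0], it involves only
    binomials up to ['C(k, 3)]. *)
Definition gs k : R := \sum_(r < k) ai ^+ r.

Lemma gsE k : gs k = k%:R - 'C(k, 2)%:R * kap + 'C(k, 3)%:R * eps ^+ 2.
Proof.
rewrite /gs ai_kap; have y3 : (- kap) ^+ 3 = 0 by ring: kap3.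
by have [_ ->] := geom_sum k y3; ring: kap2.
Qed.

Lemma aiX k : ai ^+ k = 1 - k%:R * kap + 'C(k, 2)%:R * eps ^+ 2.
Proof.
rewrite ai_kap; have y3 : (- kap) ^+ 3 = 0 by ring: kap3.
by have [-> _] := geom_sum k y3; ring: kap2.
Qed.

Lemma alX k : al ^+ k = 1 + k%:R * eps + 'C(k, 2)%:R * eps ^+ 2.
Proof. by have [] := geom_sum k eps3. Qed.

Lemma coprime_nl : coprime n l.
Proof. by rewrite coprimeXl // prime_coprime. Qed.

End Arithmetic.

Local Notation d := ((third * l)%:R : R)%R.

Section Exponents.

Local Open Scope ring_scope.

Lemma mod_N_nu k (c : R) a : k%:R = a%:R + nu * c -> k = a %[mod N].
Proof.
rewrite -(natZ_val c) -natrM -natrD => /(natZ_eq _ _ P_gt1) E.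
have dN : (N %| P)%N by rewrite dvdn_exp2l // leq_mul2r orbT.
by rewrite -(modn_dvdm k dN) E modn_dvdm // addnC mulnC modnMDl.
Qed.

Lemma nu_surj k : (k = 0 %[mod N])%N -> exists c, k = (N * c)%N.
Proof. by move/eqP; rewrite mod0n => /dvdnP[c ->]; exists c; rewrite mulnC. Qed.

Lemma nu_kap : nu * kap = 0.
Proof. have ne : nu * eps = 0 by exact: nu_eps.
rewrite /kap; ring: ne. Qed.

(** The quadratic term vanishes since [nu * kap = 0], and the cubic one since ['C(k, 3)] is a
    multiple of [n] by [bin3_mod]. *)
Lemma gs_nu k c : k%:R = nu * c -> gs k = k%:R.
Proof.
move=> E; have [|k' Ek] := @nu_surj k; first by apply: (@mod_N_nu k c 0); rewrite add0r.
rewrite gsE // bin2_half // E.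
have -> : hlf * (nu * c) * (nu * c - 1) * kap = hlf * c * (nu * c - 1) * (nu * kap) by ring.
rewrite nu_kap mulr0 subr0 (@mulrC _ _ (eps ^+ 2)).
rewrite (@eps2_mod _ 0) ?mulr0n ?mulr0 ?addr0 //.
rewrite bin3_mod // Ek NE.
  rewrite -[(n * n * k')%N]mulnA mulKn ?n_gt0 // mulnCA modnMr mod0n //.
by rewrite -mulnA dvdn_mulr.
Qed.

Lemma gs_P : gs P = 0.
Proof.
rewrite (@gs_nu _ 0) ?mulr0; exact: P_eq0.
Qed.

Lemma theta_bin k : (k = l * n %[mod N])%N -> 'C(k, 3)%:R * eps ^+ 2 = theta.
Proof.
move=> E; rewrite /theta mulrC; apply: eps2_mod => //.
have nk : (n %| k)%N.
  have dN : (n %| N)%N by rewrite NE dvdn_mulr.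
  by rewrite /dvdn -(modn_dvdm k dN) E modn_dvdm // modnMl.
rewrite bin3_mod //; have [k' Ek] := dvdnP nk.
rewrite Ek mulnK ?n_gt0 //; move/eqP: E.
rewrite Ek NE -!muln_modl eqn_mul2r => /orP[|/eqP E].
  by rewrite -leqn0 leqNgt n_gt0.
by rewrite -modnMmr E modnMmr.
Qed.

Lemma kap_mod : exists c, kap = eps + nu * c.
Proof.
by exists (- (l ^ 2)%:R); rewrite /kap eps2 // mulrN.
Qed.

Lemma val_kap_mod : (kap : nat) = l * n %[mod N].
Proof.
have [c E] := kap_mod.
by apply: (@mod_N_nu _ c); rewrite natZ_val E.
Qed.

Lemma gs_kap : kap - gs kap = - (hlf * eps ^+ 2) - theta.
Proof.
rewrite gsE // natZ_val theta_bin ?val_kap_mod // bin2_half //.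
have -> : (kap : nat)%:R = kap := natZ_val kap.
have -> : kap - (kap - hlf * kap * (kap - 1) * kap + theta) =
  hlf * kap ^+ 3 - hlf * kap ^+ 2 - theta by ring.
by rewrite kap3 // kap2 // mulr0 sub0r.
Qed.

Lemma alE : (1 + l * n)%:R = al.
Proof. by rewrite natrD. Qed.

Lemma bin2_al : 'C(1 + l * n, 2)%:R = hlf * al * eps.
Proof. by rewrite bin2_half // alE /al; ring. Qed.

Lemma bin3_al : 'C(1 + l * n, 3)%:R * eps ^+ 2 = theta.
Proof.
rewrite add1n binS natrD mulrDl theta_bin // bin2_half // -/eps.
have -> : hlf * eps * (eps - 1) * eps ^+ 2 = hlf * (eps - 1) * eps ^+ 3 by ring.
by rewrite eps3 // mulr0 addr0.
Qed.

Lemma gs_al : gs (1 + l * n) = al - hlf * eps ^+ 2 + theta.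
Proof.
rewrite gsE // bin3_al bin2_al alE /kap /al.
have e3 : eps ^+ 3 = 0 by exact: eps3.
ring: e3.
Qed.

Lemma unit_coprime k : coprime p k -> (k%:R : R) \is a GRing.unit.
Proof. by move=> c; rewrite unitZpE ?P_gt1 // coprimeXl. Qed.

Definition drest : R := hlf - (third * l)%:R.

Lemma p_cases : p = 3%N \/ third = 0%N.
Proof. by rewrite /third; case: eqP; [left | right]. Qed.

Lemma third_coprime : p = 3%N -> coprime 3 (third * l).*2.-1 /\ (0 < third * l)%N.
Proof.
move=> p3; have l0 : (0 < l)%N by case: l p'l => //; rewrite dvdn0.
rewrite /third p3 eqxx; split; last by rewrite muln_gt0 expn_gt0.
case E: (m == 1%N).
  move: (case3 p3 (eqP E)) => l1; rewrite (eqP E) expn0 mul1n prime_coprime //.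
  apply/negP=> d; move: l0 l1 d; lia.
have [k E3] : exists k, (3 ^ (m - 1) * l = 3 * k)%N.
  exists (3 ^ (m - 2) * l)%N; rewrite mulnA -expnS; congr (3 ^ _ * _)%N.
  by move/eqP: E; lia.
have : (0 < 3 ^ (m - 1) * l)%N by rewrite muln_gt0 expn_gt0.
by rewrite E3 prime_coprime //; case: k {E3} => // k; lia.
Qed.

(** Twice [drest] is [1 - 2 * d]. For [p > 3] this is 1. For [p = 3] it is prime to 3: either
    [m > 1] and 3 divides [d], or [m = 1] and [d = l] is 1 modulo 3 by [case3]. *)
Lemma drest_unit : drest \is a GRing.unit.
Proof.
have h_unit : (2 : R) \is a GRing.unit.
  by apply: unit_coprime; rewrite prime_coprime // gtnNdvd // p_gt2.
suff: 2 * drest \is a GRing.unit by rewrite unitrM h_unit.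
rewrite mulrBr half2 //.
have [p3|->] := p_cases; last by rewrite mul0n mulr0 subr0 unitr1.
have [c d0] := third_coprime p3.
have -> : 1 - 2 * (third * l)%:R = - ((third * l).*2.-1)%:R :> R.
  rewrite -natrM mul2n -{1}(prednK (_ : 0 < (third * l).*2)%N) ?double_gt0 //.
  by rewrite -natr1 opprD addrCA subrr addr0.
by rewrite unitrN; apply: unit_coprime; rewrite [p in coprime p]p3.
Qed.

Lemma eps2_drest : exists g, eps ^+ 2 * drest * g = nu.
Proof.
exists (drest^-1 * (l ^ 2)%:R^-1).
have u2 : (l ^ 2)%:R \is a @GRing.unit R.
  by apply: unit_coprime; rewrite prime_coprime // Euclid_dvdX // (negPf p'l).
by rewrite eps2 // -!mulrA (mulrA drest) mulrV ?drest_unit // mul1r (mulrV u2) mulr1.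
Qed.

End Exponents.

(** * Consequences of the defining relations in an arbitrary group *)

Section Half.
Variables (T : groupType) (A B : T).
Hypothesis rels : J_rels p m (1 + l * n) [:: A; B].
Local Notation C := [~ A, B].

Lemma J_AP : A ^+ P = 1. Proof. by case: rels. Qed.
Lemma J_BP : B ^+ P = 1. Proof. by case: rels. Qed.
Lemma J_AC : A ^ C = A ^^ al.
Proof. by case: rels => -> _ AP _; rewrite -(zx_nat P_gt1) // natrD. Qed.
Lemma J_BCV : B ^ C^-1 = B ^^ al.
Proof. by case: rels => _ + _ BP; rewrite invgR => ->; rewrite -(zx_nat P_gt1) // natrD. Qed.

Lemma J_zxK (x y : T) a b : x ^+ P = 1 -> (a * b = 1 :> R)%R -> x ^ y = x ^^ a -> x ^ y^-1 = x ^^ b.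
Proof.
move=> xP ab xy; apply: (canLR (conjgK y)).
by rewrite zxJ xy -zxM ?P_gt1 // ab zx1 ?P_gt1.
Qed.

Lemma J_ACV : A ^ C^-1 = A ^^ ai.
Proof. by apply: (J_zxK J_AP _ J_AC); exact: alai. Qed.
Lemma J_BC : B ^ C = B ^^ ai.
Proof. by rewrite -{1}[C]invgK; apply: (J_zxK J_BP _ J_BCV); exact: alai. Qed.

Lemma zx_conjX (x y : T) (a e : R) k : x ^+ P = 1 -> x ^ y = x ^^ a ->
  (x ^^ e) ^ (y ^+ k) = x ^^ (e * a ^+ k)%R.
Proof.
move=> xP xy; elim: k => [|k IH]; first by rewrite conjg1 mulr1.
by rewrite expgSr conjgM IH zxJ xy -zxM ?P_gt1 // exprS mulrCA.
Qed.

Lemma conjA_C e k : (A ^^ e) ^ (C ^+ k) = A ^^ (e * al ^+ k)%R.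
Proof. exact: zx_conjX J_AP J_AC. Qed.
Lemma conjB_C e k : (B ^^ e) ^ (C ^+ k) = B ^^ (e * ai ^+ k)%R.
Proof. exact: zx_conjX J_BP J_BC. Qed.

Lemma J_AB : A ^ B = A * C. Proof. by rewrite commgEl mulKVg. Qed.

Lemma expAC k : (A * C) ^+ k = A ^^ (gs k) * C ^+ k.
Proof. exact: expMg_geom P_gt1 _ _ _ _ J_AP J_ACV. Qed.

(** [A ^ B = A * C], and [C^-1] multiplies exponents of [A] by [ai], so collecting [(A * C) ^+ k]
    produces a geometric sum. *)
Lemma expA_B k : (A ^+ k) ^ B = A ^^ (gs k) * C ^+ k.
Proof. by rewrite conjXg J_AB expAC. Qed.

(** Conjugate [A ^+ P = 1] by [B] and use [gs P = 0]. *)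
Lemma expC_P : C ^+ P = 1.
Proof.
by have := expA_B P; rewrite J_AP conj1g gs_P // zx0 mul1g => <-.
Qed.

End Half.

(** Exchanging the generators inverts [C]; through this symmetry each result about [A] has a mirror
    image about [B]. *)
Lemma J_relsC (T : groupType) (A B : T) :
  J_rels p m (1 + l * n) [:: A; B] -> J_rels p m (1 + l * n) [:: B; A].
Proof. by case. Qed.

Lemma conjg_swap (T : groupType) (x y : T) : x ^ y = x * (y ^ x)^-1 * y.
Proof. by rewrite !conjgE !invMg !invgK !mulgA mulgV mul1g. Qed.

Section Full.
Variables (T : groupType) (A B : T).
Hypothesis rels : J_rels p m (1 + l * n) [:: A; B].
Local Notation C := [~ A, B].
Let AP := J_AP rels.
Let BP := J_BP rels.
Let CP := expC_P rels.

Lemma expB_A k : (B ^+ k) ^ A = B ^^ (gs k) * C ^- k.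
Proof. by rewrite (expA_B (J_relsC rels)) -expVgn invgR. Qed.

Lemma conjA_BX k : A ^ (B ^+ k) = A * C ^+ k * B ^^ (k%:R - gs k)%R.
Proof.
have E : A ^ (B ^+ k) = A * ((B ^+ k) ^ A)^-1 * B ^+ k.
  by rewrite !conjgE !invMg !invgK !mulgA mulgV mul1g.
by rewrite E expB_A invMg invgK addrC zxD ?P_gt1 // zxN ?P_gt1 // zx_nat ?P_gt1 // !mulgA.
Qed.

Lemma conjC_B : C ^ B = C * B ^^ kap.
Proof.
rewrite conjg_swap (J_BC rels) -zxN ?P_gt1 // -[X in _ * X = _](zx1 P_gt1 B) -mulgA -zxD ?P_gt1 //.
by rewrite ai_kap opprB subrK.
Qed.

Lemma conjC_A : C ^ A = C * A ^^ (- eps)%R.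
Proof.
rewrite conjg_swap (J_AC rels) -zxN ?P_gt1 // -[X in _ * X = _](zx1 P_gt1 A) -mulgA -zxD ?P_gt1 //.
by rewrite /al opprD addrAC addNr add0r.
Qed.

Lemma conjCX_BX k : C ^ (B ^+ k) = C * B ^^ (k%:R * kap)%R.
Proof.
elim: k => [|k IH]; first by rewrite conjg1 mul0r mulg1.
rewrite expgSr conjgM IH conjMg conjC_B zxJ [B ^ B]conjgE mulKg -mulgA -zxD ?P_gt1 //.
by rewrite -natr1 mulrDl mul1r addrC.
Qed.

Lemma kap_al : (kap * al = eps)%R.
Proof.
have e3 : (eps ^+ 3 = 0)%R by exact: eps3.
rewrite /kap /al; ring: e3.
Qed.

Lemma nu_al c : (nu * c * al = nu * c)%R.
Proof.
have ne : (nu * eps = 0)%R by exact: nu_eps.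
rewrite /al; ring: ne.
Qed.

Lemma nu_ai c : (nu * c * ai = nu * c)%R.
Proof.
have ne : (nu * eps = 0)%R by exact: nu_eps.
rewrite /ai; ring: ne.
Qed.

Lemma commB_C c : commute (B ^^ (nu * c)%R) C.
Proof. by apply/commgP/conjg_fixP; rewrite zxJ (J_BC rels) -zxM ?P_gt1 // mulrC nu_ai. Qed.

Lemma conjnuB_A c : (B ^^ (nu * c)%R) ^ A = B ^^ (nu * c)%R * C ^^ (- (nu * c))%R.
Proof.
rewrite -{1}(natZ_val (nu * c)%R) zx_nat ?P_gt1 // expB_A.
rewrite (@gs_nu _ c) // natZ_val //.
by rewrite zxN ?P_gt1 // ?natZ_val.
Qed.

Lemma conjnuA_B c : (A ^^ (nu * c)%R) ^ B = A ^^ (nu * c)%R * C ^^ (nu * c)%R.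
Proof.
rewrite -{1}(natZ_val (nu * c)%R) zx_nat ?P_gt1 // (expA_B rels).
by rewrite (@gs_nu _ c) // natZ_val //.
Qed.

Lemma al_nu c : (al ^+ ((nu * c)%R : nat) = 1)%R.
Proof.
rewrite alX // bin2_half // natZ_val.
have ne : (nu * eps = 0)%R by exact: nu_eps.
ring: ne.
Qed.
Lemma ai_nu c : (ai ^+ ((nu * c)%R : nat) = 1)%R.
Proof.
rewrite aiX // bin2_half // natZ_val /kap.
have ne : (nu * eps = 0)%R by exact: nu_eps.
ring: ne.
Qed.

Lemma commC_A c : commute (C ^^ (nu * c)%R) A.
Proof.
apply/commute_sym/commgP/conjg_fixP; rewrite -{1}(zx1 P_gt1 A).
by rewrite [LHS](conjA_C rels) mul1r al_nu zx1 ?P_gt1.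
Qed.

Lemma commC_B c : commute (C ^^ (nu * c)%R) B.
Proof.
apply/commute_sym/commgP/conjg_fixP; rewrite -{1}(zx1 P_gt1 B).
by rewrite [LHS](conjB_C rels) mul1r ai_nu zx1 ?P_gt1.
Qed.

Lemma ai_kapX r : ((ai ^+ (kap : nat)) ^+ r = 1 - r%:R * eps ^+ 2)%R.
Proof.
have e3 : (eps ^+ 3 = 0)%R by exact: eps3.
have -> : (ai ^+ (kap : nat) = 1 + - eps ^+ 2)%R.
  rewrite aiX // bin2_half //; have -> : ((kap : nat)%:R = kap)%R := natZ_val kap.
  rewrite /kap; ring: e3.
have y3 : ((- eps ^+ 2) ^+ 3 = 0 :> R)%R by ring: e3.
by have [-> _] := geom_sum r y3; ring: e3.
Qed.

Lemma sum_ai_kapX : (\sum_(r < 1 + l * n) (ai ^+ (kap : nat)) ^+ r = al)%R.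
Proof.
have e3 : (eps ^+ 3 = 0)%R by exact: eps3.
have E1 := ai_kapX 1; rewrite expr1 mul1r in E1; rewrite E1.
have y3 : ((- eps ^+ 2) ^+ 3 = 0 :> R)%R by ring: e3.
have [_ ->] := geom_sum (1 + l * n) y3.
rewrite bin2_al // alE; ring: e3.
Qed.

(** Two evaluations of [(A ^+ alpha) ^ B] are compared: as [(A * C) ^+ alpha], and as [A ^ (C * B)],
    expanded through the conjugates of [A] and [C] by [B ^^ kap]. After cancelling [C ^^ al], a
    power of [A] and a power of [B] remain, both with exponent [eps ^+ 2 * (1/2 - d)]. *)
Lemma J_key : A ^^ (eps ^+ 2 * drest)%R * B ^^ (eps ^+ 2 * drest)%R = 1.
Proof.
have e3 : (eps ^+ 3 = 0)%R by exact: eps3.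
have te : (theta * eps = 0)%R by exact: theta_eps.
(* The error [kap - gs kap] is displayed as a multiple of [nu], so that [B ^^ e] commutes with [C]
   and changes under conjugation by [A] only by a power of [C] commuting with [A] and [B]. *)
pose c0 : R := ((l ^ 2)%:R * (- hlf - (third * l)%:R))%R.
pose e := (nu * c0)%R.
have eE : (kap - gs kap = e)%R.
  by rewrite gs_kap // /e /c0 /theta eps2 //; ring.
have ee : (e * eps = 0)%R by rewrite -eE gs_kap //; ring: e3 te.
have H1 : A ^ (B ^^ kap) = A * C ^^ kap * B ^^ e.
  by rewrite [LHS]conjA_BX natZ_val eE.
have H2 : C ^ (B ^^ kap) = C * B ^^ (eps ^+ 2).
  by rewrite [LHS]conjCX_BX natZ_val -expr2 kap2.
have Aal : A ^+ (1 + l * n) = A ^^ al by rewrite -(zx_nat P_gt1) // alE.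
(* [A ^+ alpha] is [A ^ C], and [C * B = B * (C * B ^^ kap)]; thus [A ^ (C * B)] is the conjugate of
   [(A * C) ^ C = A ^^ al * C] by [B ^^ kap]. *)
have H3 : (A ^^ al * C) ^ (B ^^ kap) = A ^^ (gs (1 + l * n)) * C ^+ (1 + l * n).
  have CB : C * B = B * (C * B ^^ kap) by rewrite [LHS]conjgC conjC_B.
  rewrite -(expAC rels) -(J_AB A B) -conjXg Aal -(J_AC rels) -[RHS]conjgM CB.
  by rewrite [RHS]conjgM (J_AB A B) [RHS]conjgM [(A * C) ^ C]conjMg [C ^ C]conjgE mulKg.
have cBC c : commute (B ^^ (nu * c)%R) C by exact: commB_C.
have x_y : (B ^^ e) ^ (A * C ^^ kap) = B ^^ e * C ^^ (- e)%R.
  rewrite conjgM conjnuB_A conjMg; congr (_ * _).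
    by apply/conjg_fixP/commgP; apply/commuteX/cBC.
  by apply/conjg_fixP/commgP/zxCC.
have H5 : (A * C ^^ kap * B ^^ e) ^+ (1 + l * n) = A ^^ al * C ^^ eps * B ^^ e.
  have w_nu : (- e = nu * - c0)%R by rewrite /e mulrN.
  have cw z : z = A \/ z = B -> commute (C ^^ (- e)%R) z.
    by rewrite w_nu => -[->|->]; [exact: commC_A | exact: commC_B].
  rewrite (expMg_step _ x_y); last 2 first.
  - apply: commuteM; first by apply: cw; left.
    exact: zxCC.
  - by apply: commuteX; apply: cw; right.
  have -> : C ^^ (- e)%R ^+ 'C(1 + l * n, 2) = 1.
    rewrite -(zx_nat P_gt1) ?zxq // -zxM ?P_gt1 // bin2_al //.
    by rewrite (_ : - e * (hlf * al * eps) = 0)%R ?zx0 //; ring: ee.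
  have -> : B ^^ e ^+ (1 + l * n) = B ^^ e.
    rewrite -(zx_nat P_gt1) ?zxq // -zxM ?P_gt1 // alE.
    by rewrite /al mulrDr mulr1 ee addr0.
  rewrite mulg1.
  congr (_ * _).
  rewrite (expMg_geom P_gt1 (a := (ai ^+ (kap : nat))%R) _ AP).
    by rewrite sum_ai_kapX -(zx_nat P_gt1) ?zxq // -zxM ?P_gt1 // alE kap_al.
  apply: (canLR (conjgK _)).
  rewrite [RHS](conjA_C rels) -exprMn mulrC alai // expr1n.
  by rewrite zx1 ?P_gt1.
move: H3; rewrite -{1}Aal conjMg conjXg H1 H2 H5.
rewrite -(zx_nat P_gt1 (1 + l * n) CP) alE.
have e2nu : (eps ^+ 2 = nu * (l ^ 2)%:R)%R by exact: eps2.
have cX c f : commute (B ^^ (nu * c)%R) (C ^^ f) by apply: commuteX.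
have -> : A ^^ al * C ^^ eps * B ^^ e * (C * B ^^ (eps ^+ 2)) =
    A ^^ al * B ^^ (e + eps ^+ 2)%R * C ^^ al.
  rewrite -(mulgA (A ^^ al) (C ^^ eps)) -!(mulgA (A ^^ al)); congr (_ * _).
  rewrite (_ : e + eps ^+ 2 = nu * (c0 + (l ^ 2)%:R))%R; last by rewrite e2nu mulrDr.
  rewrite [X in _ = X]cX mulrDr -/e -e2nu (zxD P_gt1 e _ BP) mulgA -(mulgA (C ^^ eps)).
  rewrite (cBC c0) (mulgA (C ^^ eps) C) (mulgA (C ^^ al)).
  by rewrite /al addrC (zxD P_gt1 _ _ CP) zx1 ?P_gt1.
move/mulIg => E.
have {E} : A ^^ (al - gs (1 + l * n))%R * B ^^ (e + eps ^+ 2)%R = 1.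
  by rewrite addrC zxD ?P_gt1 // zxN ?P_gt1 // -mulgA E mulVg.
have -> : (al - gs (1 + l * n) = eps ^+ 2 * drest)%R.
  by rewrite gs_al // /drest /theta; ring.
suff -> : (e + eps ^+ 2 = eps ^+ 2 * drest)%R by [].
apply/eqP; rewrite -subr_eq0 -eE gs_kap // /drest /theta; apply/eqP.
transitivity (eps ^+ 2 * (1 - 2 * hlf))%R; first by ring.
by rewrite half2 // subrr mulr0.
Qed.

Let f := (eps ^+ 2 * drest)%R.

Lemma eps2_drest_nu : exists c, f = (nu * c)%R.
Proof. by exists ((l ^ 2)%:R * drest)%R; rewrite /f eps2 // mulrA. Qed.

(** By [J_key], [A ^^ f] is a power of [B], hence fixed by [B]. Conjugation by [B] also multiplies
    it by [C ^^ f], so [C ^^ f = 1], and [nu] is a multiple of [f]. *)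
Lemma J_CN : C ^+ N = 1.
Proof.
have [c fc] := eps2_drest_nu; have [g fg] := eps2_drest.
have /eqP := J_key; rewrite -/f mulg_eq1 => /eqP Af.
have : C ^^ f = 1.
  have := conjnuA_B c; rewrite -fc => E.
  apply: (mulgI (A ^^ f)); rewrite -E mulg1 Af.
  by rewrite conjVg zxJ [B ^ B]conjgE mulKg.
move=> Cf; rewrite -(zx_nat P_gt1) // -/nu -fg (zxM P_gt1) // -/f Cf.
by rewrite /zx expg1n.
Qed.

Lemma zxC_nu c : C ^^ (nu * c)%R = 1.
Proof. by rewrite (zxM P_gt1) // zx_nat ?P_gt1 // J_CN /zx expg1n. Qed.

Lemma commnuA_B c : commute (A ^^ (nu * c)%R) B.
Proof. by apply/commgP/conjg_fixP; rewrite conjnuA_B zxC_nu mulg1. Qed.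

(** [J_key] is raised to the power [g] with [f * g = nu]; its two factors commute because
    [C ^+ N = 1]. *)
Lemma J_ANBN c : B ^^ (nu * c)%R = A ^^ (- (nu * c))%R.
Proof.
suff E : A ^^ nu * B ^^ nu = 1.
  have {}E : B ^^ nu = (A ^^ nu)^-1 by apply/esym; apply: mulg1_eq.
  by rewrite (zxM P_gt1) // E zxN ?P_gt1 // (zxM P_gt1) // /zx expVgn.
have [c' fc] := eps2_drest_nu; have [g fg] := eps2_drest.
rewrite -fg -/f !(zxM P_gt1 f) // -zxMg ?J_key /zx ?expg1n //.
by rewrite fc; apply: commuteX; apply: commnuA_B.
Qed.

End Full.

(** * A permutation model on pairs of exponents *)

Section Model.

Local Open Scope ring_scope.

(* One third of [eps ^+ 2]. *)
Definition third_eps2 : R :=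
  if p == 3 then (n * third * l ^ 2)%N%:R else eps ^+ 2 * 3^-1.

Lemma omega3 : 3 * third_eps2 = eps ^+ 2.
Proof.
rewrite /third_eps2; case: eqP => [p3|p'3].
  have E : (n = 3 * third)%N.
    by rewrite /third p3 eqxx -expnS; congr (_ ^ _)%N; lia.
  rewrite eps2 // /nu -!natrM; congr (_%:R); rewrite NE {2}E; ring.
rewrite mulrCA mulrV ?mulr1 //; apply: unit_coprime => //.
by rewrite prime_coprime // dvdn_prime2 //; apply/eqP.
Qed.

Lemma omega_eps : eps * third_eps2 = theta.
Proof.
rewrite /third_eps2 /theta; case: eqP => [p3|p'3].
  rewrite eps2 // /eps /nu -!natrM; congr (_%:R); rewrite NE; ring.
have e3 : (eps ^+ 3 = 0)%R by exact: eps3.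
by rewrite mulrA -exprS e3 mul0r /third; case: eqP => // _; rewrite mul0n mulr0n mulr0.
Qed.

Let e3 : eps ^+ 3 = 0. Proof. exact: eps3. Qed.
Let th3 : 3 * theta = 0. Proof. exact: theta3. Qed.
Let the : eps * theta = 0. Proof. by rewrite mulrC theta_eps. Qed.
Let thh : hlf * theta = - theta. Proof. by rewrite mulrC theta_half. Qed.
Let thc i : i ^+ 3 * theta = i * theta.
Proof. by apply/eqP; rewrite -subr_eq0 -mulrBl mulrC theta_cube. Qed.
Let tho : third_eps2 * theta = 0.
Proof.
transitivity (eps * (eps * third_eps2) * (third * l)%:R); first by rewrite /theta; ring.
by rewrite omega_eps the mul0r.
Qed.
Let h2 : 2 * hlf = 1. Proof. exact: half2. Qed.

Definition f1 (i : R) : R := hlf * (i * (i + 1)).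
(** At a natural number [i] this is [eps ^+ 2 * 'C(i + 1, 3)], and [f1 i] is ['C(i + 1, 2)]. The
    polynomial form makes sense on all of [Z/P], also for [p = 3]. *)
Definition g (i : R) : R := hlf * third_eps2 * (i ^+ 3 - i).

Lemma eg i : eps * g i = 0.
Proof. by rewrite /g mulrA mulrCA omega_eps -mulrA mulrBr !(mulrC theta) thc subrr mulr0. Qed.

Lemma og i : third_eps2 * g i = 0.
Proof.
suff [c E] : exists c, third_eps2 * (i ^+ 3 - i) = eps ^+ 2 * c.
  transitivity (hlf * third_eps2 * (third_eps2 * (i ^+ 3 - i))); first by rewrite /g; ring.
  rewrite E; transitivity (hlf * c * (eps * (eps * third_eps2))); first by ring.
  by rewrite omega_eps the mulr0.
rewrite -(natZ_val i).
suff [c E] : exists c, ((i : nat) ^ 3 = i + 3 * c)%N.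
  exists c%:R; rewrite -omega3 -natrX E natrD natrM; ring.
elim: (i : nat) => [|k [c IH]]; first by exists 0%N.
by exists (c + k ^ 2 + k)%N; lia.
Qed.

(** [bcoef i] and [tcoef i] are the polynomial forms of [ai ^+ i] and [gs i * al ^+ i]. *)
Definition bcoef (i : R) : R := 1 - eps * i + eps ^+ 2 * f1 i.
Definition tcoef (i : R) : R := i + eps * f1 i + g i.

(** The pair [(j, i)] stands for the right coset of [<[C]>] containing [B ^^ j * A ^^ i]; the three
    maps are right multiplication by [A], [B] and [C], as dictated by collection in [J]. *)
Definition fA (s : R * R) : R * R := (s.1, s.2 + 1).
Definition fB (s : R * R) : R * R := ((s.1 + 1) * bcoef s.2, tcoef s.2).
Definition fC (s : R * R) : R * R := (ai * s.1, al * s.2).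

(** [JJ] and [TT] are closed forms for the two coordinates of the [k]-th iterate of [fB], see
    [iter_fB]. *)
Definition TT (k : nat) (i : R) : R :=
  i + eps * k%:R * f1 i + k%:R * g i
  + 'C(k, 2)%:R * f1 i * (eps ^+ 2 * (i + hlf) + theta).
Definition JJ (k : nat) (j i : R) : R :=
  j + k%:R - eps * i * (j * k%:R + 'C(k.+1, 2)%:R)
  + eps ^+ 2 * (i ^+ 2 * (j * 'C(k, 2)%:R + 'C(k.+1, 3)%:R)
     + f1 i * ((j + 1) * (k%:R - 'C(k, 2)%:R) - 2 * 'C(k, 3)%:R)).

Lemma tf_TT k i : tcoef (TT k i) = TT k.+1 i.
Proof.
rewrite /TT binS bin1 natrD -natr1.
set K := k%:R; set K2 := 'C(k, 2)%:R.
set d := eps * K * f1 i + K * g i + K2 * f1 i * (eps ^+ 2 * (i + hlf) + theta).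
have Ti : i + eps * K * f1 i + K * g i + K2 * f1 i * (eps ^+ 2 * (i + hlf) + theta) = i + d.
  by rewrite /d; ring.
have ed : eps * d = eps ^+ 2 * K * f1 i.
  transitivity (eps ^+ 2 * K * f1 i + K * (eps * g i) +
    K2 * f1 i * (eps ^+ 3 * (i + hlf) + eps * theta)); first by rewrite /d; ring.
  by rewrite eg e3 the; ring.
have od : third_eps2 * d = theta * K * f1 i.
  have og' := og i; rewrite /d; set gg := g i in og' *; have oe := omega_eps. 
  transitivity (eps * third_eps2 * K * f1 i + K * (third_eps2 * gg) + K2 * f1 i * (eps * (eps * third_eps2) * (i + hlf) + third_eps2 * theta)); first ring.
  by rewrite og' oe the tho; ring.
have edd : eps * (d * d) = 0 by rewrite mulrA ed; transitivity (eps * K * f1 i * (eps * d)); [ring | rewrite ed; ring: e3].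
rewrite Ti /tcoef.
have -> : eps * f1 (i + d) = eps * f1 i + eps ^+ 2 * K * f1 i * (i + hlf).
  transitivity (eps * f1 i + (eps * d) * ((2 * hlf) * i + hlf) + hlf * (eps * (d * d))).
    by rewrite /f1; ring.
  by rewrite edd ed h2; ring.
have -> : g (i + d) = g i + theta * K * f1 i.
  transitivity (g i + hlf * (third_eps2 * d) * (3 * i ^+ 2 + 3 * i * d + d * d - 1)).
    by rewrite /g; ring.
  rewrite od; set F := f1 i.
  have td : theta * d * d = 0.
    transitivity (d * (third_eps2 * (eps * d))); first by rewrite -omega_eps; ring.
    rewrite ed; transitivity (d * K * F * eps * (eps * third_eps2)); first by rewrite /F; ring.
    by rewrite omega_eps -mulrA the mulr0.
  transitivity (g i + K * F * hlf * ((i ^+ 2 + i * d) * (3 * theta) + theta * d * d)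
     - K * F * (hlf * theta)); first ring.
  by rewrite th3 td thh; ring.
rewrite -Ti; ring.
Qed.

Lemma bf_TT k i : bcoef (TT k i) = 1 - eps * i + eps ^+ 2 * (1 - k%:R) * f1 i.
Proof.
rewrite /TT.
set K := k%:R; set K2 := 'C(k, 2)%:R.
set d := eps * K * f1 i + K * g i + K2 * f1 i * (eps ^+ 2 * (i + hlf) + theta).
have Ti : i + eps * K * f1 i + K * g i + K2 * f1 i * (eps ^+ 2 * (i + hlf) + theta) = i + d.
  by rewrite /d; ring.
have ed : eps * d = eps ^+ 2 * K * f1 i.
  transitivity (eps ^+ 2 * K * f1 i + K * (eps * g i) +
    K2 * f1 i * (eps ^+ 3 * (i + hlf) + eps * theta)); first by rewrite /d; ring.
  by rewrite eg e3 the; ring.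
have eed : eps * (eps * d) = 0 by rewrite ed; ring: e3.
rewrite Ti /bcoef; transitivity (1 - eps * i - eps * d + eps ^+ 2 * f1 i +
   hlf * (eps * (eps * d)) * (2 * i + d + 1)); first by rewrite /f1; ring.
by rewrite eed ed; ring.
Qed.

Lemma JJS k j i : (JJ k j i + 1) * bcoef (TT k i) = JJ k.+1 j i.
Proof.
rewrite bf_TT /JJ !binS !bin1 !bin0 !natrD -!natr1.
set K := k%:R; set K2 := 'C(k, 2)%:R; set K3 := 'C(k, 3)%:R; set F := f1 i.
have KK : K ^+ 2 = 2 * K2 + K.
  rewrite /K2 bin2_half // -/K; transitivity ((2 * hlf) * K * (K - 1) + K); last by ring.
  by rewrite h2; ring.
ring: e3 KK.
Qed.

Lemma iter_fB k s : iter k fB s = (JJ k s.1 s.2, TT k s.2).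
Proof.
elim: k => [|k IH].
  case: s => j i /=; rewrite /JJ /TT !bin0n /= (_ : 'C(1, 2) = 0%N) // (_ : 'C(1, 3) = 0%N) //.
  by congr (_, _); ring.
by rewrite iterS IH /fB /= JJS tf_TT.
Qed.

(** The binomials of [P] vanish in the closed form, the last one after multiplication by [eps ^+ 2].
    Besides a relation of [J], this gives the injectivity of [fB]. *)
Lemma iter_fBP s : iter P fB s = s.
Proof.
have P0 := P_eq0.
have C2 : 'C(P, 2)%:R = 0 :> R by rewrite bin2_half // P0 mulr0 mul0r.
have nP : (n %| P)%N by rewrite dvdn_exp2l // leq_pmull.
have C3 : eps ^+ 2 * 'C(P, 3)%:R = 0.
  rewrite (@eps2_mod _ 0) ?mulr0n ?mulr0 // bin3_mod //.
  by rewrite PE // mulnK ?n_gt0 // mulnA modnMl mod0n.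
rewrite iter_fB; case: s => j i; congr (_, _); rewrite /= ?/TT ?/JJ.
  rewrite !binS bin1 !natrD P0 C2.
  transitivity (j + (i ^+ 2 - 2 * f1 i) * (eps ^+ 2 * 'C(P, 3)%:R)); first by ring.
  by rewrite C3; ring.
by rewrite P0 C2; ring.
Qed.

Let ne : nu * eps = 0. Proof. exact: nu_eps. Qed.
Let oe : eps * third_eps2 = theta. Proof. exact: omega_eps. Qed.
Let aa : al * ai = 1. Proof. exact: alai. Qed.

Lemma fA_inj : injective fA.
Proof.
by apply: (can_inj (g := fun s => (s.1, s.2 - 1))) => -[j i]; rewrite /fA /= addrK.
Qed.

Lemma iter_id_inj (T : Type) (f : T -> T) k :
  (0 < k)%N -> (forall x, iter k f x = x) -> injective f.
Proof. by case: k => // k _ H x y E; rewrite -(H x) -(H y) !iterSr E. Qed.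

Lemma fB_inj : injective fB.
Proof. by apply: (@iter_id_inj _ _ P); [apply: ltnW P_gt1 | apply: iter_fBP]. Qed.

Lemma fC_inj : injective fC.
Proof.
apply: (can_inj (g := fun s => (al * s.1, ai * s.2))) => -[j i].
by rewrite /fC /= !mulrA (mulrC ai) aa !mul1r.
Qed.

Definition pA : {perm R * R} := perm fA_inj.
Definition pB : {perm R * R} := perm fB_inj.
Definition pC : {perm R * R} := perm fC_inj.

Lemma bf_S i : bcoef (i + 1) = ai * bcoef i.
Proof.
rewrite /bcoef /ai.
transitivity (1 - eps * i - eps + eps ^+ 2 * f1 i + (2 * hlf) * eps ^+ 2 * (i + 1)).
  by rewrite /f1; ring.
by rewrite h2; ring: e3.
Qed.

Lemma tf_S i : tcoef (i + 1) = al * (tcoef i + 1).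
Proof.
rewrite /tcoef /al.
have -> : g (i + 1) = g i + eps ^+ 2 * f1 i.
  transitivity (g i + (3 * third_eps2) * f1 i); first by rewrite /g /f1; ring.
  by rewrite omega3.
have eg' : eps * g i = 0 by exact: eg.
transitivity (i + 1 + (2 * hlf) * eps * (i + 1) + eps * f1 i + eps ^+ 2 * f1 i + g i).
  by rewrite /f1; ring.
rewrite h2; transitivity ((1 + eps) * (i + eps * f1 i + 1) + g i + eps * g i); last by ring.
by rewrite eg'; ring.
Qed.

Lemma model_AB : (pA * pB = pB * (pA * pC))%g.
Proof.
apply/permP=> -[j i]; rewrite !permM !permE /fB /fA /fC /= bf_S tf_S.
by congr (_, _); ring.
Qed.

Lemma model_C : [~ pA, pB]%g = pC.
Proof.
rewrite commgEl conjgE model_AB mulKg; exact: mulKg.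
Qed.

Lemma permX (T : finType) (s : {perm T}) k x : (s ^+ k)%g x = iter k s x.
Proof. by elim: k x => [|k IH] x; rewrite ?expg0 ?perm1 // expgSr permM IH. Qed.

Lemma model_AX k s : (pA ^+ k)%g s = (s.1, s.2 + k%:R).
Proof.
elim: k => [|k IH]; first by rewrite perm1 addr0; case: s.
by rewrite expgSr permM IH permE /fA /= -natr1 addrA.
Qed.

Lemma model_BX k s : (pB ^+ k)%g s = (JJ k s.1 s.2, TT k s.2).
Proof.
rewrite permX -iter_fB //; apply: eq_iter => x; exact: permE.
Qed.

Lemma model_CX k s : (pC ^+ k)%g s = (ai ^+ k * s.1, al ^+ k * s.2).
Proof.
elim: k => [|k IH]; first by rewrite perm1 !mul1r; case: s.
by rewrite expgSr permM IH permE /fC /= !exprS !mulrA.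
Qed.

Lemma model_AC : (pA ^ pC = pA ^+ (1 + l * n))%g.
Proof.
apply: (mulgI pC); rewrite -conjgC; apply/permP => s.
rewrite !permM model_AX !permE /fA /fC /= alE // .
by congr (_, _); ring.
Qed.

(** Since [B ^+ N * A ^+ N = 1] in [J], the pairs [(j, i)] and [(j + nu * z, i + nu * z)] stand for
    the same coset, and the relation for [B] is only expected up to such shifts. The shift may vary
    with the point. [J] is represented in the normalizer of [shiftK] modulo [shiftK]. *)
Definition shiftK := [set s : {perm R * R} | [forall x, [exists z,
   s x == (x.1 + nu * z, x.2 + nu * z)]]].

Lemma shiftKP (s : {perm R * R}) :
  reflect (forall x, exists z, s x = (x.1 + nu * z, x.2 + nu * z)) (s \in shiftK).
Proof.
rewrite inE; apply: (iffP forallP) => H x.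
  by have /existsP[z /eqP] := H x; exists z.
by have [z E] := H x; apply/existsP; exists z; rewrite E.
Qed.

Lemma shiftK_group_set : group_set shiftK.
Proof.
apply/group_setP; split=> [|s t /shiftKP sK /shiftKP tK].
  by apply/shiftKP=> x; exists 0; rewrite perm1 mulr0 !addr0; case: x.
apply/shiftKP=> x; have [z Ez] := sK x; have [w Ew] := tK (s x).
by exists (z + w); rewrite permM Ew Ez /= -!addrA !mulrDr.
Qed.
Canonical shiftK_group := Group shiftK_group_set.

Lemma shift_norm (t : {perm R * R}) :
  (forall x z, exists w, t (x.1 + nu * z, x.2 + nu * z) = ((t x).1 + nu * w, (t x).2 + nu * w)) ->
  t \in 'N(shiftK).
Proof.
move=> H; rewrite inE; apply/subsetP=> _ /imsetP[s /shiftKP sK ->].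
apply/shiftKP=> y; rewrite -(permKV t y) permJ.
by have [z ->] := sK (t^-1%g y); apply: H.
Qed.

Lemma nu2 : nu * nu = 0.
Proof.
rewrite /nu -natrM; apply/(natZ_eq _ 0 P_gt1).
by apply/eqP; rewrite mod0n -expnD; apply: dvdn_exp2l; lia.
Qed.

Lemma nu_omega : nu * third_eps2 = 0.
Proof.
rewrite /third_eps2; case: ifP => _.
  rewrite -[RHS](mulr0 nu) -(mulr0n 1); apply: nu_mod => //.
  by rewrite mod0n -mulnA modnMr.
rewrite mulrA; have -> : nu * eps ^+ 2 = 0 by ring: ne.
exact: mul0r.
Qed.

Lemma pA_norm : pA \in 'N(shiftK).
Proof.
apply: shift_norm => -[j i] z; exists z; rewrite !permE /fA /=.
by congr (_, _); ring.
Qed.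

Lemma pB_norm : pB \in 'N(shiftK).
Proof.
apply: shift_norm => -[j i] z; exists z; rewrite !permE /fB /=.
have no := nu_omega; have n2 := nu2; have ne' := ne.
congr (_, _).
  rewrite /bcoef /f1.
  transitivity ((j + 1) * (1 - eps * i + eps ^+ 2 * (hlf * (i * (i + 1)))) + nu * z
   + (nu * eps) * (- z * i + z * eps * (hlf * (i * (i + 1))) + (j + 1 + nu * z) * (- z + eps * hlf * z * (2 * i + nu * z + 1)))).
    by ring.
  by rewrite ne' mul0r addr0.
rewrite /tcoef /f1 /g.
transitivity (i + eps * (hlf * (i * (i + 1))) + hlf * third_eps2 * (i ^+ 3 - i) + nu * z
  + (nu * eps) * (hlf * z * (2 * i + nu * z + 1))
  + (nu * third_eps2) * hlf * z * (3 * i ^+ 2 + 3 * i * (nu * z) + (nu * z) ^+ 2 - 1)); first by ring.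
by rewrite ne' no; ring.
Qed.

Lemma model_BC : (pB ^ pC^-1 * (pB ^+ (1 + l * n))^-1)%g \in shiftK.
Proof.
suff H x : exists z, (pC * pB)%g x =
    (((pB ^+ (1 + l * n) * pC)%g x).1 + nu * z, ((pB ^+ (1 + l * n) * pC)%g x).2 + nu * z).
  have CK : pC \in 'N(shiftK).
    by rewrite -model_C groupR ?pA_norm ?pB_norm.
  have -> : (pB ^ pC^-1 * (pB ^+ (1 + l * n))^-1 =
     ((pB ^+ (1 + l * n) * pC)^-1 * (pC * pB)) ^ (pB ^+ (1 + l * n) * pC)^-1)%g.
    by rewrite !conjgE !invgK -(mulgA (_^-1)%g) mulVKg invMg !mulgA.
  rewrite memJ_norm; last by rewrite groupV groupM ?groupX ?pB_norm.
  apply/shiftKP=> x; rewrite permM; have [z Ez] := H ((pB ^+ (1 + l * n) * pC)^-1%g x).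
  by exists z; rewrite Ez permKV.
case: x => j i; rewrite !permM model_BX !permE /fC /fB /= /JJ /TT.
have qE := alE.
have C2 : 'C(1 + l * n, 2)%:R = hlf * al * eps by exact: bin2_al.
have C3 : eps ^+ 2 * 'C(1 + l * n, 3)%:R = theta by rewrite mulrC; exact: bin3_al.
move: (1 + l * n)%N qE C2 C3 => q qE C2 C3.
rewrite !binS bin1 (natrD _ 'C(q, 2) q) (natrD _ 'C(q, 3) 'C(q, 2)) qE C2; set c3 := 'C(q, 3)%:R in C3 *.
(* The discrepancy between the two sides is [(theta - eps ^+ 2 / 2) * i] in both coordinates, a
   multiple of [nu]. *)
exists ((l ^ 2)%:R * (- hlf * i + (third * l)%:R * i)).
have -> : nu * ((l ^ 2)%:R * (- hlf * i + (third * l)%:R * i)) = - hlf * eps ^+ 2 * i + theta * i.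
  by rewrite /theta eps2 //; ring.
congr (_, _).
  transitivity (ai * (j + al - eps * i * (j * al + (hlf * al * eps + al)) +
     eps ^+ 2 * (i ^+ 2 * (j * (hlf * al * eps) + hlf * al * eps) +
       f1 i * ((j + 1) * (al - hlf * al * eps)))) + theta * (i ^+ 2 - 2 * f1 i) +
     (- hlf * eps ^+ 2 * i + theta * i) - (1 - 2 * hlf) * (eps ^+ 2 * i + theta * (i ^+ 2 + i))).
    by rewrite /bcoef /f1 /ai /al; ring: e3.
  have at_ : theta = ai * theta.
    by rewrite /ai; transitivity (theta + (eps * theta) * (eps - 1)); [rewrite the | ]; ring.
  rewrite h2 subrr mul0r subr0; congr (_ + _); rewrite {1}at_ -C3; ring.
have eg' : eps * g i = 0 by exact: eg.
have te : theta * eps = 0 by rewrite mulrC.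
transitivity (al * i + eps * hlf * al * i * (al * i + 1) + g i + theta * i).
  have gal : g (al * i) = g i + theta * i.
    transitivity (g i + hlf * (eps * third_eps2) * ((3 + 3 * eps + eps ^+ 2) * i ^+ 3 - i)).
      by rewrite /g /al; ring.
    rewrite oe; congr (_ + _).
    transitivity (hlf * ((3 * theta) * i ^+ 3 + (eps * theta) * (3 + eps) * i ^+ 3)
      - (hlf * theta) * i); first by ring.
    by rewrite th3 the thh; ring.
  by rewrite /tcoef gal /f1; ring.
transitivity (al * i + eps * al ^+ 2 * f1 i + al ^+ 2 * g i +
  al * (hlf * al * f1 i * (eps ^+ 3 * (i + hlf) + eps * theta)) + (- hlf * eps ^+ 2 * i + theta * i)).
  rewrite e3 the; transitivity (al * i + (eps + 2 * eps ^+ 2 + eps ^+ 3) * f1 i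
     + g i + (eps * g i) * (2 + eps) + (- hlf * eps ^+ 2 * i + theta * i)).
    by rewrite eg' e3 /al /f1; ring: e3.
  by rewrite /al; ring.
by ring.
Qed.

End Model.

(** * Uniqueness of the normal form *)

Section NormalForm.

Variables (gT : finGroupType) (J : {group gT}) (A B : gT).
Hypothesis presJ : presented_by J [:: A; B] (J_rels p m (1 + l * n)).
Local Notation C := [~ A, B].

Lemma pres_rels : J_rels p m (1 + l * n) [:: A; B].
Proof. by case: presJ. Qed.

Lemma pres_gen : <<[set A; B]>> = J.
Proof.
case: presJ => <- _ _; congr <<_>>; apply/setP=> x; rewrite !inE.
by [].
Qed.

Lemma memA : A \in J. Proof. by rewrite -pres_gen mem_gen // !inE eqxx. Qed.
Lemma memB : B \in J. Proof. by rewrite -pres_gen mem_gen // !inE eqxx orbT. Qed.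
Lemma memC : C \in J. Proof. by rewrite groupR ?memA ?memB. Qed.

Lemma pres_map (T : groupType) (a b : T) : J_rels p m (1 + l * n) [:: a; b] ->
  exists f : gT -> T, [/\ {in J &, {morph f : y z / y * z}}, f A = a & f B = b].
Proof. by case: presJ => _ _ H /H[f [fM [fA fB]]]; exists f. Qed.

Lemma pres_swap : presented_by J [:: B; A] (J_rels p m (1 + l * n)).
Proof.
split; first by rewrite -pres_gen; congr <<_>>; apply/setP=> x; rewrite !inE orbC.
  exact: J_relsC pres_rels.
move=> T [|b [|a []]] // /J_relsC/pres_map[f [fM fA fB]].
by exists f; split=> //=; rewrite fA fB.
Qed.

Lemma model_rels :
  J_rels p m (1 + l * n) [:: coset (shiftK) (pA);
                             coset (shiftK) (pB)].
Proof.
set pa := pA; set pb := pB.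
set pc := pC.
have aN : pa \in 'N(shiftK) by exact: pA_norm.
have bN : pb \in 'N(shiftK) by exact: pB_norm.
have cE : [~ pa, pb] = pc by exact: model_C.
have cN : pc \in 'N(shiftK) by rewrite -cE groupR.
have morphC : coset (shiftK) pc = [~ coset (shiftK) pa, coset (shiftK) pb].
  by rewrite -morphR //= cE.
split.
- rewrite -morphC -morphJ // -morphX //=; congr (coset _ _); exact: model_AC.
- rewrite -invgR -morphC -morphV // -morphJ ?groupV // -morphX //=.
  apply/eqP; rewrite -divg_eq1; apply/eqP.
  rewrite -morphV ?groupX // -morphM ?groupV ?groupX ?groupJ ?groupV //=.
  by apply: coset_id; apply: model_BC.
- rewrite -morphX //= (_ : pa ^+ P = 1) ?morph1 //; apply/permP=> s.
  by rewrite model_AX perm1 P_eq0 // addr0; case: s.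
- rewrite -morphX //= (_ : pb ^+ P = 1) ?morph1 //; apply/permP=> s.
  by rewrite permX perm1 -[RHS](iter_fBP); apply: eq_iter => x; rewrite permE.
Qed.

Lemma nu_eq0 (k : nat) : (k%:R * eps = 0 :> R)%R -> exists c, (k%:R = nu * c :> R)%R.
Proof.
rewrite -natrM => /(natZ_eq _ 0 P_gt1)/eqP; rewrite mod0n mulnA => d.
have {d} : N %| k.
  have {d} : (P %| k * l * n)%N by exact: d.
  rewrite PE // dvdn_pmul2r ?n_gt0 // => d.
  rewrite NE -(@Gauss_dvdl _ _ l) //.
  by rewrite -NE coprimeXl // prime_coprime.
by case/dvdnP=> c ->; exists (c%:R)%R; rewrite natrM mulrC.
Qed.

(** [al ^+ k - 1] is [k * eps] times [1 + y] with [y] nilpotent, so [k * eps = 0]. *)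
Lemma al_eq1 (k : nat) : (al ^+ k = 1)%R -> exists c, (k%:R = nu * c :> R)%R.
Proof.
have e3 : (eps ^+ 3 = 0)%R by exact: eps3.
rewrite alX // bin2_half // => E; apply: nu_eq0.
set K := (k%:R)%R in E *; set y := (hlf * (K - 1) * eps)%R.
have {}E : (K * eps * (1 + y) = 0)%R.
  by apply: (addrI 1%R); rewrite addr0 -[RHS]E /y; ring.
have y3 : (y ^+ 3 = 0)%R by rewrite /y !exprMn e3 mulr0.
by transitivity ((K * eps * (1 + y)) * (1 - y + y ^+ 2) - K * eps * y ^+ 3)%R;
  [ring | rewrite E y3; ring].
Qed.

(** In the model, the word sends [(0, 0)] to [(j, i)], so [j] and [i] are the same multiple of [nu].
    Then [B ^^ j] and [A ^^ i] cancel in [J], leaving [C ^^ k = 1]; evaluation at [(0, 1)] gives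
    [al ^+ k = 1]. *)
Lemma nf_uniq (k j i : R) : C ^^ k * B ^^ j * A ^^ i = 1 ->
  exists c z : R, [/\ k = nu * c, j = nu * z & i = nu * z]%R.
Proof.
set H := shiftK; set pa := pA; set pb := pB.
set pc := pC.
have aN : pa \in 'N(H) by exact: pA_norm.
have bN : pb \in 'N(H) by exact: pB_norm.
have cE : [~ pa, pb] = pc by exact: model_C.
have cN : pc \in 'N(H) by rewrite -cE groupR.
have [f [fM fA fB]] := pres_map model_rels.
have fC : f C = coset H pc.
  by rewrite (morphinR fM) ?memA ?memB // fA fB -/H -/pa -/pb -morphR //= cE.
have key (x y z : R) : C ^^ x * B ^^ y * A ^^ z = 1 ->
    forall s, exists w, (pc ^^ x * pb ^^ y * pa ^^ z) s = (s.1 + nu * w, s.2 + nu * w)%R.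
  move=> E; apply/shiftKP; apply: coset_idr; first by rewrite !groupM ?zx_group.
  rewrite !morphM ?groupM ?zx_group //= !morphX //=.
  have := congr1 f E; rewrite !fM ?groupM ?zx_group ?memA ?memB ?memC //.
  by rewrite !(morphin_zx fM) ?memA ?memB ?memC // fA fB fC (morphin1 fM).
move=> E; have [z] := key _ _ _ E (0, 0)%R.
have AP := J_AP pres_rels; have BP := J_BP pres_rels.
rewrite !permM model_CX model_BX model_AX !mulr0 /= !natZ_val.
have -> : TT j (0%R : R) = 0%R.
  by rewrite /TT /f1 /g; ring.
have -> : JJ j (0%R : R) (0%R : R) = j.
  by rewrite /JJ /f1 natZ_val; ring.
rewrite !add0r => E2; have jE := congr1 fst E2; have iE := congr1 snd E2.
move: jE iE => /= jE iE.
have Ck : C ^^ k = 1.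
  move: E; rewrite jE iE (J_ANBN pres_rels).
  by rewrite (zxN P_gt1) // mulgKV.
have [|w] := key k 0%R 0%R _ (0, 1)%R; first by rewrite Ck !mulg1.
rewrite !mulg1 model_CX mulr0 mulr1 /= add0r => E3.
have w0 := congr1 fst E3; have kw := congr1 snd E3; move: w0 kw => /= <-.
rewrite addr0 => /al_eq1[c kE].
by exists c, z; split; rewrite // -kE natZ_val.
Qed.

End NormalForm.

(** * Order of [J] and the centralizer of [A] *)

Section Structure.

Variables (gT : finGroupType) (J : {group gT}) (A B : gT).
Hypothesis presJ : presented_by J [:: A; B] (J_rels p m (1 + l * n)).
Local Notation C := [~ A, B].
Let rels := pres_rels presJ.
Let AP : A ^+ P = 1 := J_AP rels.
Let BP : B ^+ P = 1 := J_BP rels.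
Let CP : C ^+ P = 1 := expC_P rels.
Let AJ : A \in J := memA presJ.
Let BJ : B \in J := memB presJ.
Let CJ : C \in J := memC presJ.

Lemma zx_swap (x y : gT) (a e f : R) : x ^+ P = 1 -> x ^ y = x ^^ a ->
  x ^^ e * y ^^ f = y ^^ f * x ^^ (e * a ^+ (f : nat))%R.
Proof. by move=> xP xy; rewrite [LHS]conjgC; congr (_ * _); apply: zx_conjX. Qed.

Lemma expA_Bz (e : R) : A ^^ e * B = B * (A ^^ (gs e) * C ^^ e).
Proof. by rewrite [LHS]conjgC; congr (_ * _); rewrite [LHS](expA_B rels). Qed.

(** These products are stable under right multiplication by [A], and by [B] after collecting with
    [expA_Bz]. *)
Lemma J_nf g : g \in J -> exists k j i : R, g = C ^^ k * B ^^ j * A ^^ i.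
Proof.
rewrite -(pres_gen presJ); move: g; apply: gen_ind.
  by exists 0%R, 0%R, 0%R; rewrite !zx0 !mulg1.
move=> g x _; rewrite !inE => /orP[] /eqP -> [k [j [i ->]]].
  by exists k, j, (i + 1)%R; rewrite (zxD P_gt1) // (zx1 P_gt1) mulgA.
exists (k + i)%R, ((j + 1) * ai ^+ (i : nat))%R, (gs i * al ^+ (i : nat))%R.
rewrite -mulgA expA_Bz !mulgA -(mulgA _ (B ^^ j)) -{2}(zx1 P_gt1 B) -(zxD P_gt1 j 1%R BP).
rewrite (zxD P_gt1 k i CP) -!mulgA (zx_swap _ _ AP (J_AC rels)).
rewrite (mulgA (B ^^ _)) (zx_swap _ _ BP (J_BC rels)).
by rewrite !mulgA.
Qed.

Lemma nf_inj (k j i k' j' i' : R) :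
  C ^^ k * B ^^ j * A ^^ i = C ^^ k' * B ^^ j' * A ^^ i' ->
  exists c z : R, [/\ k - k' = nu * c, j - j' = nu * z & i - i' = nu * z]%R.
Proof.
move=> E.
have E1 : C ^^ (k - k')%R * B ^^ j * A ^^ (i - i')%R = B ^^ j'.
  apply: (mulgI (C ^^ k')); apply: (mulIg (A ^^ i')); rewrite -E !mulgA -(zxD P_gt1) //.
  by rewrite -[X in X = _]mulgA -(zxD P_gt1 _ _ AP) subrK addrC subrK.
have {E1}E : C ^^ (k - k')%R * B ^^ (j - j' * ai ^+ ((k - k')%R : nat))%R * A ^^ (i - i')%R = 1.
  rewrite -mulNr [(j + _)%R]addrC (zxD P_gt1 _ _ BP) mulgA.
  rewrite -(zx_swap _ _ BP (J_BC rels)).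
  by rewrite -2!mulgA (mulgA (C ^^ _)) E1 -(zxD P_gt1) // addNr zx0.
have [c [z [kE jE iE]]] := nf_uniq presJ E.
exists c, z; split=> //; move: jE; rewrite kE ai_nu // mulr1 //.
Qed.

Lemma nu_cancel (c : R) : exists2 r : nat, r < n & (nu * c = nu * r%:R)%R.
Proof.
exists ((c : nat) %% n); first by rewrite ltn_mod n_gt0.
by rewrite -{1}(natZ_val c); apply: nu_mod => //; rewrite modn_mod.
Qed.

Lemma J_Bred (j : R) : exists b : 'I_N, exists z : R, B ^^ j = B ^+ b * A ^^ (nu * z)%R.
Proof.
have N0 : 0 < N by rewrite expn_gt0 prime_gt0.
have jN : (j : nat) %% N < N by rewrite ltn_mod.
exists (Ordinal jN), (- ((j : nat) %/ N)%:R)%R => /=.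
rewrite mulrN -(J_ANBN rels).
rewrite -natrM (zx_nat P_gt1) // -expgnDr (mulnC N) addnC -divn_eq //.
Qed.

Lemma J_Cred (k : R) : exists c : 'I_N, C ^^ k = C ^+ c.
Proof.
have N0 : 0 < N by rewrite expn_gt0 prime_gt0.
have kN : (k : nat) %% N < N by rewrite ltn_mod.
exists (Ordinal kN); by rewrite /= (expg_modn _ (J_CN rels)).
Qed.

(** The exponents of [C] and [B] can be reduced below [N], the excess in [B] being absorbed by [A];
    the resulting [N * N * P] forms are distinct by [nf_inj]. *)
Lemma card_J : #|J| = (p ^ (7 * m))%N.
Proof.
pose F (x : 'I_N * 'I_N * R) := C ^+ x.1.1 * B ^+ x.1.2 * A ^^ x.2.
have NP : N <= P.
  by rewrite dvdn_leq ?expn_gt0 ?prime_gt0 // dvdn_exp2l // leq_mul2r orbT.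
have FE x : F x = C ^^ (x.1.1%:R : R)%R * B ^^ (x.1.2%:R : R)%R * A ^^ x.2.
  by rewrite /F !(zx_nat P_gt1).
have small (a b : 'I_N) c : (a%:R - b%:R = nu * c :> R)%R -> a = b.
  move=> E; have := @mod_N_nu a c b.
  rewrite addrC -E subrK => /(_ erefl); rewrite !modn_small //; exact: val_inj.
have Finj : injective F.
  move=> [[a b] i] [[a' b'] i']; rewrite !FE /= => /nf_inj[c [z [Ea Eb Ei]]].
  have ba := small _ _ _ Eb; move: Ei; rewrite -Eb ba subrr => /eqP.
  by rewrite subr_eq0 => /eqP ->; rewrite (small _ _ _ Ea).
have -> : J = F @: setT :> {set gT}.
  apply/eqP; rewrite eqEsubset; apply/andP; split; apply/subsetP => g.
    move=> /J_nf[k [j [i ->]]]; have [c ->] := J_Cred k; have [b [z ->]] := J_Bred j.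
    apply/imsetP; exists (c, b, (nu * z + i)%R); rewrite // /F /= (zxD P_gt1) //.
    by rewrite !mulgA.
  by case/imsetP=> x _ ->; rewrite !groupM ?groupX ?zx_group.
rewrite card_imset // cardsT !card_prod !card_ord Zp_cast ?P_gt1 //.
by rewrite -!expnD; congr (_ ^ _)%N; lia.
Qed.

Lemma commA_nuC (c : R) : C ^^ (nu * c)%R = 1.
Proof. exact: (zxC_nu rels). Qed.

Lemma al_nuX (k : R) : A ^ (C ^^ k) = A -> exists c : R, k = (nu * c)%R.
Proof.
rewrite -{1}(zx1 P_gt1 A) => E.
have {}E : A ^^ (al ^+ (k : nat) - 1)%R = 1.
  rewrite (zxD P_gt1) // (zxN P_gt1) // (zx1 P_gt1) -[(_ ^+ _)%R]mul1r.
  by rewrite -(conjA_C rels) [_ ^ _]E mulgV.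
have [|c [z [_ z0 E1]]] := @nf_uniq _ _ _ _ presJ
   0%R 0%R (al ^+ (k : nat) - 1)%R; first by rewrite !zx0 !mul1g.
have [|c' kE] := @al_eq1 k.
  by move/eqP: E1; rewrite -z0 subr_eq0 => /eqP.
by exists c'; rewrite -kE natZ_val.
Qed.

(** If [C ^^ k * B ^^ j * A ^^ i] fixes [A], then [A ^ (C ^^ k) = A ^ (B ^^ (- j))]. The right side
    contains [C ^^ (- j)], so [j] is a multiple of [nu] and [B ^^ j] is a power of [A]. Then
    [C ^^ k] centralizes [A] and is trivial. *)
Lemma centA g : g \in J -> commute g A -> exists i : R, g = A ^^ i.
Proof.
move=> gJ cgA; have [k [j [i E]]] := J_nf gJ.
have AA (e : R) : A ^ (A ^^ e) = A.
  by apply/conjg_fixP/commgP; apply: commuteX.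
have gA : A ^ g = A by apply/conjg_fixP/commgP; apply: commute_sym.
have kj : A ^ (C ^^ k) = A ^ (B ^^ (- j)%R).
  apply: (conjg_inj (B ^^ j)); rewrite -!conjgM -(zxD P_gt1) // addNr zx0 conjg1.
  by apply: (conjg_inj (A ^^ i)); rewrite -conjgM -E gA AA.
have [c jE] : exists c, j = (nu * c)%R.
  move: kj; rewrite [RHS](conjA_BX rels) natZ_val.
  rewrite -[in LHS](zx1 P_gt1 A) [LHS](conjA_C rels) mul1r.
  set a := (al ^+ _)%R; set w := (- j - _)%R => E1.
  have {}E1 : C ^^ (- j)%R * B ^^ w * A ^^ (0 : R)%R = C ^^ (0 : R)%R * B ^^ (0 : R)%R * A ^^ (a - 1)%R.
    rewrite !zx0 !mul1g !mulg1 [(a - 1)%R]addrC (zxD P_gt1 _ _ AP) (zxN P_gt1 1%R AP) (zx1 P_gt1) E1.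
    by rewrite -!mulgA mulKg.
  have [c [z [E2 _ _]]] := nf_inj E1; exists (- c)%R.
  by rewrite mulrN -E2 subr0 opprK.
have jA : B ^^ j = A ^^ (- j)%R.
  by rewrite jE; apply: (J_ANBN rels).
have [|c' kE] := @al_nuX k.
  by rewrite kj (zxN P_gt1 _ BP) jA; apply/conjg_fixP/commgP/commuteV/commuteX.
exists (- j + i)%R; rewrite E kE commA_nuC mul1g jA (zxD P_gt1) //.
Qed.

End Structure.

(** * The abelian subgroup generated by [A ^+ n] and [C ^+ n] *)

Section Gamma3.

Variables (gT : finGroupType) (J : {group gT}) (A B : gT).
Hypothesis presJ : presented_by J [:: A; B] (J_rels p m (1 + l * n)).
Local Notation C := [~ A, B].
Let rels := pres_rels presJ.
Let AP : A ^+ P = 1 := J_AP rels.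
Let BP : B ^+ P = 1 := J_BP rels.
Let CP : C ^+ P = 1 := expC_P rels.
Let AJ : A \in J := memA presJ.
Let BJ : B \in J := memB presJ.
Let CJ : C \in J := memC presJ.
Let ACN := J_ANBN rels.

Lemma nnE : (nn * nn = nu)%R.
Proof. by rewrite -natrM /nu NE. Qed.

Lemma nn_eps : (nn * eps = nu * l%:R)%R.
Proof. by rewrite /eps /nu -!natrM NE; congr (_%:R)%R; rewrite mulnCA mulnC. Qed.

Lemma nn_nu : (nn * nu = 0)%R.
Proof.
rewrite -natrM; apply/(natZ_eq _ 0 P_gt1); rewrite mod0n.
by apply/eqP; rewrite -expnD; apply: dvdn_exp2l; lia.
Qed.

Lemma nn_eps2 : (nn * eps ^+ 2 = 0)%R.
Proof. by rewrite eps2 // mulrA nn_nu mul0r. Qed.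

Definition hh : R := (- hlf * (nn - 1) * l%:R + 'C(n, 3)%:R * (l ^ 2)%:R)%R.

Lemma gs_nnE : gs n = (nn + nu * hh)%R.
Proof.
have nk : (nn * kap = nu * l%:R)%R.
  by rewrite /kap mulrBr nn_eps nn_eps2 subr0.
rewrite gsE // bin2_half // eps2 //.
transitivity (nn - hlf * (nn - 1) * (nn * kap) + 'C(n, 3)%:R * (nu * (l ^ 2)%:R))%R; first by ring.
by rewrite nk /hh; ring.
Qed.

(** Coordinates in which multiplication is addition ([VM]). The third one records the central part
    separately, although it could be merged with the first. *)
Definition nnw (x y z : R) : gT := A ^^ (nn * x)%R * C ^^ (nn * y)%R * A ^^ (nu * z)%R.
Arguments nnw (x y z)%_ring_scope.

Lemma commA'C' x y : commute (A ^^ (nn * x)%R) (C ^^ (nn * y)%R).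
Proof.
apply/commgP/conjg_fixP; rewrite [LHS](conjA_C rels); congr (A ^^ _).
rewrite alX // bin2_half // natZ_val.
transitivity (nn * x + (nn * (nn * eps)) * x * y + hlf * (nn * y - 1) * x * y * nn * (nn * eps ^+ 2))%R.
  by ring.
by rewrite nn_eps nn_eps2 mulrA nn_nu; ring.
Qed.

Lemma A_nu_central c g : g \in J -> commute (A ^^ (nu * c)%R) g.
Proof.
rewrite -(pres_gen presJ); move: g; apply: gen_ind; first exact: commute1.
move=> g x _; rewrite !inE => xAB cg; apply: commuteM cg _; case/orP: xAB => /eqP->.
  by apply/commute_sym/commuteX.
exact: (commnuA_B rels).
Qed.

Lemma memZX (e : R) : [/\ A ^^ e \in J, B ^^ e \in J & C ^^ e \in J].
Proof. by rewrite !zx_group. Qed.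

Lemma VM x y z x' y' z' : nnw x y z * nnw x' y' z' = nnw (x + x')%R (y + y')%R (z + z')%R.
Proof.
have [_ _ HC] := memZX (nn * y')%R; have [HA _ _] := memZX (nn * x')%R.
rewrite /nnw !mulrDr !(zxD P_gt1) // -!mulgA; congr (_ * _).
rewrite (mulgA (A ^^ (nu * z)%R)) (A_nu_central z HA) !mulgA -(commA'C' x' y).
rewrite -!mulgA; congr (_ * (_ * _)).
by rewrite mulgA (A_nu_central z HC) mulgA.
Qed.

Lemma VA x z : nnw x 0 z = A ^^ (nn * x + nu * z)%R.
Proof. by rewrite /nnw mulr0 zx0 mulg1 (zxD P_gt1). Qed.

Lemma V0 : nnw 0 0 0 = 1. Proof. by rewrite VA !mulr0 addr0 zx0. Qed.

Lemma VN x y z : (nnw x y z)^-1 = nnw (- x)%R (- y)%R (- z)%R.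
Proof. by apply: mulg1_eq; rewrite VM !subrr V0. Qed.

Lemma VX x y z k : nnw x y z ^+ k = nnw (k%:R * x)%R (k%:R * y)%R (k%:R * z)%R.
Proof.
elim: k => [|k IH]; first by rewrite !mul0r V0.
by rewrite expgS IH VM -!natr1 !mulrDl !mul1r ![(_ + _ * _)%R]addrC.
Qed.

Lemma conjA'_B x : (A ^^ (nn * x)%R) ^ B = nnw x x (hh * x)%R.
Proof.
have E : (A ^+ n) ^ B = nnw 1 1 hh.
  rewrite (expA_B rels) gs_nnE (zxD P_gt1) // /nnw !mulr1.
  have [_ _ HC] := memZX nn; rewrite -!mulgA -(zx_nat P_gt1 n CP).
  by rewrite (A_nu_central _ HC).
rewrite -{1}(natZ_val x) -natrM (zx_nat P_gt1) // expgnA conjXg E VX natZ_val !mulr1.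
by rewrite (mulrC hh).
Qed.

Lemma expC_B k : (C ^+ k) ^ B = C ^+ k * B ^^ (1 - ai ^+ k)%R.
Proof.
rewrite conjg_swap -mulgA; congr (_ * _).
rewrite addrC (zxD P_gt1) // (zx1 P_gt1) (zxN P_gt1) //; congr (_^-1 * _).
by rewrite -{1}(zx1 P_gt1 B) (conjB_C rels) mul1r.
Qed.

Lemma ai_nn y : (ai ^+ ((nn * y)%R : nat) = 1 - nu * (l%:R * y))%R.
Proof.
rewrite aiX // bin2_half // natZ_val.
transitivity (1 - y * (nn * eps - nn * eps ^+ 2) + hlf * y * (nn * y - 1) * (nn * eps ^+ 2))%R.
  by rewrite /kap; ring.
by rewrite nn_eps nn_eps2; ring.
Qed.

Lemma conjC'_B y : (C ^^ (nn * y)%R) ^ B = nnw 0 y (- (l%:R * y))%R.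
Proof.
rewrite [LHS]expC_B ai_nn opprB addrC subrK (ACN _) /nnw mulr0 zx0 mul1g mulrN //.
Qed.

Lemma conjV_B x y z : (nnw x y z) ^ B = nnw x (y + x)%R (z + hh * x - l%:R * y)%R.
Proof.
have -> : nnw x y z = A ^^ (nn * x)%R * C ^^ (nn * y)%R * A ^^ (nu * z)%R by [].
rewrite !conjMg conjA'_B conjC'_B.
have -> : (A ^^ (nu * z)%R) ^ B = nnw 0 0 z.
  rewrite VA mulr0 add0r; apply/conjg_fixP/commgP; exact: A_nu_central.
rewrite !VM; congr (nnw _ _ _); ring.
Qed.

Lemma conjV_BX x y z k : (nnw x y z) ^ (B ^+ k) =
  nnw x (y + k%:R * x)%R (z + hh * k%:R * x - l%:R * (k%:R * y + 'C(k, 2)%:R * x))%R.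
Proof.
elim: k => [|k IH]; first by rewrite conjg1 bin0n /=; congr (nnw _ _ _); ring.
rewrite expgSr conjgM IH conjV_B binS bin1 natrD -natr1.
congr (nnw _ _ _); ring.
Qed.

(** Collecting the powers of [B] in front leaves a product of iterated conjugates. As [B] acts
    unipotently on the coordinates by [conjV_B], their sums are binomial. *)
Lemma expBV x y z k : (B * nnw x y z) ^+ k = B ^+ k *
  nnw (k%:R * x)%R (k%:R * y + 'C(k, 2)%:R * x)%R
    (k%:R * z + hh * 'C(k, 2)%:R * x - l%:R * ('C(k, 2)%:R * y + 'C(k, 3)%:R * x))%R.
Proof.
elim: k => [|k IH].
  by rewrite !expg0 mul1g -[LHS]V0 !bin0n /=; congr (nnw _ _ _); ring.
have mv (g h w : gT) : g * w * (B * h) = g * B * (w ^ B * h).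
  by rewrite conjgE !mulgA mulgK.
rewrite expgSr IH mv -expgSr conjV_B VM !binS bin1 !natrD -!natr1.
congr (_ * nnw _ _ _); ring.
Qed.

End Gamma3.

(** * The upper central series up to its fourth term *)

Section Center.

Variables (gT : finGroupType) (J : {group gT}) (A B : gT).
Hypothesis presJ : presented_by J [:: A; B] (J_rels p m (1 + l * n)).
Local Notation C := [~ A, B].
Let rels := pres_rels presJ.
Let AP : A ^+ P = 1 := J_AP rels.
Let BP : B ^+ P = 1 := J_BP rels.
Let CP : C ^+ P = 1 := expC_P rels.
Let AJ : A \in J := memA presJ.
Let BJ : B \in J := memB presJ.
Let CJ : C \in J := memC presJ.
Let presS := pres_swap presJ.

(** Modulo [n], [alpha] is 1 and [P] is 0, so any two elements of [Z/n] satisfy the relations. This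
    is the exponent sum of [A]; the one of [B] comes from [pres_swap]. *)
Lemma exp_map_exists : exists e : gT -> 'Z_n,
  [/\ {in J &, forall x y, e (x * y) = (e x + e y)%R}, e A = 1%R & e B = 0%R].
Proof.
have cJ (x y : 'Z_n) : x ^ y = x by rewrite conjgE Zp_mulgC mulgK.
have [|e [eM eA eB]] := @pres_map _ _ _ _ presJ 'Z_n 1%R 0%R; last by exists e.
have nX (x : 'Z_n) k : x ^+ (n * k) = 1.
  by rewrite Zp_expg; apply: val_inj => /=; move: (x : nat) => y; rewrite Zp_cast ?n_gt1 // mulnCA modnMr.
have nP : P = (n * (n * n))%N by rewrite PE // mulnA.
split; rewrite ?cJ ?nP ?nX //.
  by rewrite expgnDr (mulnC l) nX mulg1.
by rewrite expgnDr (mulnC l) nX mulg1.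
Qed.

Lemma nn_dvd (i : R) : ((i : nat)%:R = 0 :> 'Z_n)%R -> exists x : R, i = (nn * x)%R.
Proof.
move/(natZ_eq _ 0 n_gt1)/eqP; rewrite mod0n => /dvdnP[x E].
by exists (x%:R)%R; rewrite -(natZ_val i) E natrM mulrC.
Qed.

Lemma dvd_nn (x : R) : (((nn * x)%R : nat)%:R = 0 :> 'Z_n)%R.
Proof.
apply/(natZ_eq _ 0 n_gt1)/eqP; rewrite mod0n.
rewrite -{1}(natZ_val x) -natrM val_Zp_nat ?P_gt1 //.
have nP : n %| P by rewrite PE // dvdn_mull.
by rewrite /dvdn modn_dvdm // modnMr.
Qed.

Lemma eps_nn : (eps = nn * l%:R)%R.
Proof. by rewrite /eps natrM mulrC. Qed.

Lemma kap_nn : exists x : R, kap = (nn * x)%R.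
Proof. by exists (l%:R * (1 - eps))%R; rewrite mulrA -eps_nn /kap; ring. Qed.

Lemma memcent_nu c : A ^^ (nu * c)%R \in 'Z(J).
Proof.
apply/centerP; split; first exact: zx_group.
move=> g gJ; exact: (A_nu_central presJ).
Qed.

(** A central element is a power of [A] and also a power of [B] by [centA]; [nf_uniq] compares the
    two. *)
Lemma centerE g : g \in 'Z(J) -> exists c : R, g = A ^^ (nu * c)%R.
Proof.
move=> /centerP[gJ cg].
have [i Ei] := centA presJ gJ (cg A AJ).
have [j Ej] := centA presS gJ (cg B BJ).
have [c [z [_ _ E]]] : exists c z : R, [/\ 0 = nu * c, - j = nu * z & i = nu * z]%R.
  apply: (nf_uniq presJ).
  by rewrite zx0 mul1g (zxN P_gt1) // -Ei -Ej mulVg.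
by exists z; rewrite Ei E.
Qed.

Lemma expC_A k : (C ^+ k) ^ A = C ^+ k * A ^^ (1 - al ^+ k)%R.
Proof.
rewrite conjg_swap -mulgA; congr (_ * _).
rewrite addrC (zxD P_gt1) // (zx1 P_gt1) (zxN P_gt1) //; congr (_^-1 * _).
by rewrite -{1}(zx1 P_gt1 A) (conjA_C rels) mul1r.
Qed.

Lemma commC'B y : [~ C ^^ (nn * y)%R, B] \in 'Z(J).
Proof.
rewrite commgEl (conjC'_B presJ) /nnw mulr0 zx0 mul1g mulKg.
exact: memcent_nu.
Qed.

End Center.

Section ThirdCenter.

Variables (gT : finGroupType) (J : {group gT}) (A B : gT).
Hypothesis presJ : presented_by J [:: A; B] (J_rels p m (1 + l * n)).
Local Notation C := [~ A, B].
Let rels := pres_rels presJ.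
Let AP : A ^+ P = 1 := J_AP rels.
Let BP : B ^+ P = 1 := J_BP rels.
Let CP : C ^+ P = 1 := expC_P rels.
Let AJ : A \in J := memA presJ.
Let BJ : B \in J := memB presJ.
Let CJ : C \in J := memC presJ.
Let presS := pres_swap presJ.
Let genJ : <<[set A; B]>> = J := pres_gen presJ.

(** Climbing the series: commutators of powers of [C ^+ n] with the generators are central, those of
    powers of [A ^+ n] are products of a power of [C ^+ n] and a central element ([A'_Z3]), and
    those of [C] are powers of [A ^+ n] or [B ^+ n] ([C_Z4]). *)
Lemma C'_Z2 y : C ^^ (nn * y)%R \in 'Z_2(J).
Proof.
apply: (ucnS_gen genJ); first exact: zx_group.
move=> x /set2P[] ->; rewrite ucn1.
  have := commC'B presS (- y)%R.
  by rewrite -(invgR A B) (zxV P_gt1) // mulrN opprK.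
exact: (commC'B presJ).
Qed.

Lemma A'_Z3 x : A ^^ (nn * x)%R \in 'Z_3(J).
Proof.
apply: (ucnS_gen genJ); first exact: zx_group.
move=> g /set2P[] ->.
  by rewrite (_ : [~ _, _] = 1) ?group1 //; apply/eqP/commgP/zxC.
rewrite commgEl (conjA'_B presJ) /nnw -!mulgA mulKg.
rewrite groupM ?C'_Z2 //; apply: (subsetP (ucn_sub_geq J (isT : 1 <= 2))).
rewrite ucn1; exact: (memcent_nu presJ).
Qed.

End ThirdCenter.

Section FourthCenter.

Variables (gT : finGroupType) (J : {group gT}) (A B : gT).
Hypothesis presJ : presented_by J [:: A; B] (J_rels p m (1 + l * n)).
Local Notation C := [~ A, B].
Let rels := pres_rels presJ.
Let AP : A ^+ P = 1 := J_AP rels.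
Let BP : B ^+ P = 1 := J_BP rels.
Let CP : C ^+ P = 1 := expC_P rels.
Let AJ : A \in J := memA presJ.
Let BJ : B \in J := memB presJ.
Let CJ : C \in J := memC presJ.
Let presS := pres_swap presJ.
Let genJ : <<[set A; B]>> = J := pres_gen presJ.
Let A3 := A'_Z3 presJ.
Let B3 := A'_Z3 presS.

Lemma C_Z4 : C \in 'Z_4(J).
Proof.
apply: (ucnS_gen genJ) => // g /set2P[] ->; rewrite commgEl.
  rewrite (conjC_A rels) mulKg eps_nn -mulrN; exact: A3.
rewrite (conjC_B rels) mulKg.
by have [x ->] := kap_nn; apply: B3.
Qed.

(** Commutators descend the series: [B], then [A], then [B] turn [g] successively into [C ^^ i] up
    to a power of [A ^+ n], into [A ^^ y] with [y = 1 - al ^+ i], and into a central element. The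
    last forces [y], hence [i * eps], to be a multiple of [nu]. *)
Lemma Z4_A g k j i : g = C ^^ (k : R) * B ^^ (j : R) * A ^^ (i : R) -> g \in 'Z_4(J) ->
  exists x : R, i = (nn * x)%R.
Proof.
move=> E gZ.
have ZR h x r : h \in 'Z_r.+1(J) -> x \in J -> [~ h, x] \in 'Z_r(J).
  by move=> hZ xJ; apply: (subsetP (ucn_comm r J)) (mem_commg hZ xJ).
have h4 : B ^^ j * A ^^ i \in 'Z_4(J).
  by rewrite -(groupMl _ (zx_group k C_Z4)) mulgA -E.
have comAB (e : R) : [~ A ^^ e, B] = A ^^ (gs e - e)%R * C ^^ e.
  rewrite commgEl [X in _ * X](expA_B rels) mulgA; congr (_ * _).
  by rewrite -(zxN P_gt1) // -(zxD P_gt1) // addrC.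
have gs_diff (e : R) : exists x : R, (gs e - e = nn * x)%R.
  have [x kx] := kap_nn.
  exists (- 'C(e, 2)%:R * x + 'C(e, 3)%:R * eps * l%:R)%R.
  by rewrite gsE // natZ_val kx expr2 {2}eps_nn; ring.
have h3 := ZR _ _ _ h4 BJ.
have c3 : C ^^ i \in 'Z_3(J).
  have E3 : [~ B ^^ j * A ^^ i, B] = A ^^ (gs i - i)%R * C ^^ i.
    have bj : (B ^^ j) ^ B = B ^^ j by rewrite zxJ [B ^ B]conjgE mulKg.
    by rewrite -comAB [LHS]commgEl [RHS]commgEl conjMg bj invMg !mulgA mulgVK.
  by have [x gx] := gs_diff i; rewrite -(groupMl (C ^^ i) (A3 x)) -gx -E3.
have c2 := ZR _ _ _ c3 AJ.
have E2 : [~ C ^^ i, A] = A ^^ (1 - al ^+ (i : nat))%R.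
  by rewrite commgEl [X in _ * X](expC_A presJ) mulKg.
rewrite E2 in c2; set y := (1 - al ^+ (i : nat))%R in E2 c2.
have c1 := ZR _ _ _ c2 BJ; rewrite ucn1 comAB in c1.
have [c Ec] := centerE presJ c1.
have [c' [z [Ey _ _]]] : exists c' z : R, [/\ y - 0 = nu * c', 0 - 0 = nu * z &
    (gs y - y) * al ^+ (y : nat) - nu * c = nu * z]%R.
  apply: (nf_inj presJ).
  by rewrite !zx0 !mulg1 mul1g -(zx_swap _ _ AP (J_AC rels)).
have e2 : (eps ^+ 2 = nu * (l ^ 2)%:R)%R by exact: eps2.
have Ei : (i * eps = nu * (- c' - 'C(i, 2)%:R * (l ^ 2)%:R))%R.
  move: Ey; rewrite subr0 /y alX // natZ_val e2 => Ey.
  by rewrite mulrBr mulrN -Ey; ring.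
have d : (i : nat) * (l * n) = 0 %[mod N].
  set w := (- c' - _)%R in Ei.
  apply: (mod_N_nu (c := w)).
  by rewrite natrM natZ_val add0r -Ei.
have : n %| i.
  move/eqP: d; rewrite mod0n NE mulnA => d.
  have {}d : (n * n %| i * l * n)%N by exact: d.
  move: d; rewrite dvdn_pmul2r ?n_gt0 // Gauss_dvdl //.
  exact: coprime_nl.
by case/dvdnP=> x E3; exists (x%:R)%R; rewrite -(natZ_val i) E3 natrM mulrC.
Qed.

End FourthCenter.

(** * Exponent sums modulo [n], ['Z_4(J)] and [AutZ 4 J] *)

Section ExponentSum.

Variables (gT : finGroupType) (J : {group gT}) (A B : gT).
Hypothesis presJ : presented_by J [:: A; B] (J_rels p m (1 + l * n)).
Local Notation C := [~ A, B].
Let rels := pres_rels presJ.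
Let AP : A ^+ P = 1 := J_AP rels.
Let BP : B ^+ P = 1 := J_BP rels.
Let CP : C ^+ P = 1 := expC_P rels.
Let AJ : A \in J := memA presJ.
Let BJ : B \in J := memB presJ.
Let CJ : C \in J := memC presJ.
Variable eA : gT -> 'Z_n.
Hypothesis eAM : {in J &, forall x y, eA (x * y) = (eA x + eA y)%R}.
Hypotheses (eAA : eA A = 1%R) (eAB : eA B = 0%R).

Lemma eA_nf (k j i : R) : eA (C ^^ k * B ^^ j * A ^^ i) = ((i : nat)%:R)%R.
Proof.
rewrite !eAM ?groupM ?zx_group // /zx !(addX eAM) // eAA eAB (addR eAM) //.
by rewrite !mul0rn !add0r.
Qed.

Lemma Z4_eA g : g \in 'Z_4(J) -> eA g = 0%R.
Proof.
move=> gZ; have gJ : g \in J by apply: (subsetP (ucn_sub 4 J)) gZ.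
have [k [j [i E]]] := J_nf presJ gJ.
have [x Ex] := Z4_A presJ E gZ.
by rewrite E eA_nf Ex (dvd_nn).
Qed.

End ExponentSum.

Section AutFourthCenter.

Variables (gT : finGroupType) (J : {group gT}) (A B : gT).
Hypothesis presJ : presented_by J [:: A; B] (J_rels p m (1 + l * n)).
Local Notation C := [~ A, B].
Let rels := pres_rels presJ.
Let AP : A ^+ P = 1 := J_AP rels.
Let BP : B ^+ P = 1 := J_BP rels.
Let CP : C ^+ P = 1 := expC_P rels.
Let AJ : A \in J := memA presJ.
Let BJ : B \in J := memB presJ.
Let CJ : C \in J := memC presJ.
Variables (eA eB : gT -> 'Z_n).
Hypothesis eAM : {in J &, forall x y, eA (x * y) = (eA x + eA y)%R}.
Hypothesis eBM : {in J &, forall x y, eB (x * y) = (eB x + eB y)%R}.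
Hypotheses (eAA : eA A = 1%R) (eAB : eA B = 0%R) (eBA : eB A = 0%R) (eBB : eB B = 1%R).
Let presS := pres_swap presJ.
Let genJ : <<[set A; B]>> = J := pres_gen presJ.

Lemma eB_nf (k j i : R) : eB (C ^^ k * B ^^ j * A ^^ i) = ((j : nat)%:R)%R.
Proof.
rewrite !eBM ?groupM ?zx_group // /zx !(addX eBM) // eBA eBB (addR eBM) //.
by rewrite !mul0rn addr0 add0r.
Qed.

Lemma e0_nf g : g \in J -> eA g = 0%R -> eB g = 0%R ->
  exists k y x : R, g = C ^^ k * B ^^ (nn * y)%R * A ^^ (nn * x)%R.
Proof.
move=> gJ; have [k [j [i ->]]] := J_nf presJ gJ.
rewrite (eA_nf presJ eAM eAA eAB) eB_nf => /(nn_dvd)[x ->].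
by move=> /(nn_dvd)[y ->]; exists k, y, x.
Qed.

(** [C], [A ^+ n] and [B ^+ n] lie in ['Z_4(J)]; conversely [Z4_A] and its mirror image make both
    exponents multiples of [n]. *)
Lemma Z4P g : reflect [/\ g \in J, eA g = 0%R & eB g = 0%R] (g \in 'Z_4(J)).
Proof.
apply: (iffP idP) => [gZ | [gJ g0 g1]].
  split; first by apply: (subsetP (ucn_sub 4 J)) gZ.
    exact: (Z4_eA presJ eAM eAA eAB).
  exact: (Z4_eA presS eBM eBB eBA).
have [k [y [x ->]]] := e0_nf gJ g0 g1.
have s34 : 'Z_3(J) \subset 'Z_4(J) by apply: ucn_sub_geq.
apply: groupM; first apply: groupM.
- apply: zx_group; exact: (C_Z4 presJ).
- apply: (subsetP s34); exact: (A'_Z3 presS).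
- apply: (subsetP s34); exact: (A'_Z3 presJ).
Qed.

Lemma card_Z4 : #|'Z_4(J)| <= p ^ (5 * m).
Proof.
pose F (x : 'I_N * 'I_n * 'I_N) := C ^+ x.1.1 * B ^^ (nn * x.1.2%:R)%R * A ^^ (nn * x.2%:R)%R.
have cardT : #|{: 'I_N * 'I_n * 'I_N}| = (p ^ (5 * m))%N.
  by rewrite !card_prod !card_ord -!expnD; congr (_ ^ _)%N; lia.
rewrite -cardT -cardsT; apply: leq_trans (leq_imset_card F _).
apply: subset_leq_card; apply/subsetP=> g /Z4P[gJ g0 g1].
have [k [y [x ->]]] := e0_nf gJ g0 g1.
have [c ->] := J_Cred presJ k.
have yn : (y : nat) %% n < n by rewrite ltn_mod n_gt0.
(* The multiple of [nu] in the exponent of [B] is transferred to [A] by [J_ANBN]. *)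
have E1 : (nn * y = nn * ((y : nat) %% n)%:R + nu * ((y : nat) %/ n)%:R)%R.
  by rewrite -{1}(natZ_val y) {1}(divn_eq y n) natrD natrM -[nu](nnE); ring.
have [x' x'E] : exists x' : R, x' = (x - ((y : nat) %/ n)%:R * nn)%R by eexists.
have xN : (x' : nat) %% N < N by rewrite ltn_mod expn_gt0 prime_gt0.
apply/imsetP; exists (c, Ordinal yn, Ordinal xN) => //; rewrite /F /=.
rewrite E1 (zxD P_gt1) // (J_ANBN rels) -!mulgA.
congr (_ * (_ * _)); rewrite -(zxD P_gt1) //; congr (A ^^ _).
transitivity (nn * x')%R; first by rewrite x'E -[nu](nnE); ring.
rewrite -{1}(natZ_val x') -!natrM; apply/(natZ_eq _ _ P_gt1).
by move: (x' : nat) => z; rewrite PE // -mulnA -NE -!muln_modr modn_mod.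
Qed.

Lemma add_ext (e e' : gT -> 'Z_n) :
  {in J &, forall x y, e (x * y) = (e x + e y)%R} ->
  {in J &, forall x y, e' (x * y) = (e' x + e' y)%R} ->
  e A = e' A -> e B = e' B -> {in J, e =1 e'}.
Proof.
move=> eM eM' EA EB g; rewrite -genJ; move: g; apply: gen_ind.
  by rewrite (add1 eM) (add1 eM').
rewrite genJ => g x gJ xAB IH; rewrite eM ?eM' // ?IH.
  by case/set2P: xAB => ->; rewrite ?EA ?EB.
all: by rewrite -genJ mem_gen.
Qed.

Lemma e_aut (e : gT -> 'Z_n) (s : {perm gT}) :
  {in J &, forall x y, e (x * y) = (e x + e y)%R} -> s \in Aut J ->
  {in J &, forall x y, e (s (x * y)) = (e (s x) + e (s y))%R}.
Proof.
move=> eM sA x y xJ yJ; have sM := morphicP (Aut_morphic sA).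
by rewrite sM // eM ?Aut_closed.
Qed.

(** By [Z4P], acting trivially modulo ['Z_4(J)] means preserving both exponent sums, which are
    additive and so tested on [A] and [B]. *)
Lemma Aut4P (s : {perm gT}) :
  reflect [/\ s \in Aut J, eA (s A) = 1%R /\ eB (s A) = 0%R & eA (s B) = 0%R /\ eB (s B) = 1%R]
    (s \in AutZ 4 J).
Proof.
have cosetE y : s \in Aut J -> y \in J ->
    (coset 'Z_4(J) (s y) == coset 'Z_4(J) y) = (eA (s y) == eA y) && (eB (s y) == eB y).
  move=> sA yJ; have sJ := Aut_closed sA yJ.
  have nZ := subsetP (normal_norm (ucn_normal 4 J)).
  have -> : (coset 'Z_4(J) (s y) == coset 'Z_4(J) y) = (s y * y^-1 \in 'Z_4(J)).
    apply/eqP/idP => [E | sy]; last first.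
      by apply/rcoset_kercosetP; rewrite ?nZ // mem_rcoset.
    by rewrite -mem_rcoset; apply/rcoset_kercosetP; rewrite ?nZ.
  apply/Z4P/andP; rewrite eAM ?eBM ?groupV // (addV eAM) // (addV eBM) //.
    by case=> _ /eqP + /eqP; rewrite !subr_eq0.
  by case=> /eqP-> /eqP->; rewrite !subrr groupM ?groupV.
apply: (iffP setIdP) => [[sA /forall_inP H] | [sA [A0 A1] [B0 B1]]].
  have := H A AJ; rewrite cosetE // eAA eBA => /andP[/eqP-> /eqP->].
  by have := H B BJ; rewrite cosetE // eAB eBB => /andP[/eqP-> /eqP->].
split=> //; apply/forall_inP=> y yJ; rewrite cosetE //.
apply/andP; split; apply/eqP.
  apply: (add_ext (e := fun z => eA (s z)) (e_aut eAM sA) eAM) => //.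
    by rewrite A0 eAA.
  by rewrite B0 eAB.
apply: (add_ext (e := fun z => eB (s z)) (e_aut eBM sA) eBM) => //.
  by rewrite A1 eBA.
by rewrite B1 eBB.
Qed.

End AutFourthCenter.

(** * Upper bound for the order of [AutZ 4 J] *)

Section FixedCommutator.

Variables (gT : finGroupType) (J : {group gT}) (A B : gT).
Hypothesis presJ : presented_by J [:: A; B] (J_rels p m (1 + l * n)).
Local Notation C := [~ A, B].
Let rels := pres_rels presJ.
Let AP : A ^+ P = 1 := J_AP rels.
Let BP : B ^+ P = 1 := J_BP rels.
Let CP : C ^+ P = 1 := expC_P rels.
Let AJ : A \in J := memA presJ.
Let BJ : B \in J := memB presJ.
Let CJ : C \in J := memC presJ.
Variables (eA eB : gT -> 'Z_n).
Hypothesis eAM : {in J &, forall x y, eA (x * y) = (eA x + eA y)%R}.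
Hypothesis eBM : {in J &, forall x y, eB (x * y) = (eB x + eB y)%R}.
Hypotheses (eAA : eA A = 1%R) (eAB : eA B = 0%R) (eBA : eB A = 0%R) (eBB : eB B = 1%R).
Local Notation V x y z := (@nnw gT A B x%R y%R z%R).

(** Modulo 3, [2 * d - 1] is [2 * (d - 2)], so for [p = 3] [third_coprime] gives the claim. *)
Lemma two_sub_unit : (2 - (third * l)%:R : R)%R \is a GRing.unit.
Proof.
have [p3|->] := p_cases; last first.
  rewrite mul0n subr0; apply: unit_coprime => //.
  by rewrite prime_coprime // gtnNdvd // p_gt2.
have [c d0] := third_coprime p3.
move: c d0; set d := (third * l)%N => c d0.
have [d1|d2] : d = 1%N \/ 2 <= d by lia.
  by rewrite d1 (_ : 2 - 1 = 1)%R ?unitr1 //; ring.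
rewrite -unitrN opprB -natrB //; apply: unit_coprime => //.
rewrite [X in coprime X _]p3; move: c; rewrite !prime_coprime //.
move: d d0 d2 => d; lia.
Qed.

Lemma l_unit : (l%:R : R)%R \is a GRing.unit.
Proof. by apply: unit_coprime => //; rewrite prime_coprime. Qed.

Lemma A_eq1 (i : R) : A ^^ i = 1 -> i = 0%R.
Proof.
move=> E; have [c [z [_ -> <-]]] : exists c z : R, [/\ 0 = nu * c, 0 = nu * z & i = nu * z]%R.
  by apply: (nf_uniq presJ); rewrite !zx0 !mul1g.
by [].
Qed.

Lemma nu_l_bin3 : (nu * 'C(1 + l * n, 3)%:R = nu * (third * l)%:R)%R.
Proof.
have E := bin3_al; rewrite /theta eps2 // in E.
have u2 : ((l ^ 2)%:R : R)%R \is a GRing.unit by rewrite natrX unitrX ?l_unit.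
apply: (mulrI u2); transitivity ('C(1 + l * n, 3)%:R * (nu * (l ^ 2)%:R))%R; first by ring.
by rewrite E; ring.
Qed.

(** [A ^^ (nn * w) * B] has the same commutator [C] with [A] as [B] has, and the hypothesis is the
    relation for [B] imposed on it. In the coordinates [nnw] it reduces to
    [nu * w * l * (2 - d) = 0], and [l * (2 - d)] is a unit. *)
Lemma fix_A_rel (w : R) :
  (A ^^ (nn * w)%R * B) ^ C^-1 = (A ^^ (nn * w)%R * B) ^+ (1 + l * n) ->
  exists w' : R, (nn * w = nu * w')%R.
Proof.
pose q := (1 + l * n)%N; have qE : (q%:R = al :> R)%R := alE.
have C2 : ('C(q, 2)%:R = hlf * al * eps :> R)%R by exact: bin2_al.
rewrite -/q; have aa : (al * ai = 1)%R by exact: alai.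
have BR := conjA'_B presJ w.
have -> : A ^^ (nn * w)%R * B = B * V w w (hh * w) by rewrite [LHS]conjgC BR.
rewrite (expBV presJ) qE.
have -> : (B * V w w (hh * w)) ^ C^-1 = B ^+ q * V (w * ai) (al * w * ai)
    (hh * al * w * ai - l%:R * 'C(q, 2)%:R * w * ai).
  have Bq : B ^ C^-1 = B ^+ q by rewrite (J_BCV rels) -(zx_nat P_gt1) // qE.
  have AV : (A ^^ (nn * w)%R) ^ C^-1 = V (w * ai) 0 0.
    rewrite zxJ (J_ACV rels) -(zxM P_gt1) //.
    by rewrite (VA presJ) mulr0 addr0; congr (A ^^ _); ring.
  rewrite -BR -conjgC conjMg Bq AV [LHS]conjgC; congr (_ * _).
  by rewrite (conjV_BX presJ) qE; congr (nnw _ _ _ _ _); ring.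
move/mulgI => E.
have {}E : V (al * w - w * ai) (al * w + 'C(q, 2)%:R * w - al * w * ai)
   (al * (hh * w) + hh * 'C(q, 2)%:R * w - l%:R * ('C(q, 2)%:R * w + 'C(q, 3)%:R * w)
     - (hh * al * w * ai - l%:R * 'C(q, 2)%:R * w * ai)) = 1.
  by rewrite -(VM presJ) -E
     -(VN presJ) mulgV.
have ne : (nu * eps = 0)%R by exact: nu_eps.
have ke : (nn * eps = nu * l%:R)%R by exact: nn_eps.
have ke2 : (nn * eps ^+ 2 = 0)%R by exact: (nn_eps2 presJ).
have aw (x : R) : (al * x * ai = x)%R by rewrite mulrAC aa mul1r.
have nc2 : (nn * 'C(q, 2)%:R = nu * (hlf * l%:R))%R.
  rewrite C2 /al; transitivity (hlf * (nn * eps) + hlf * (nn * eps ^+ 2))%R; first by ring.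
  by rewrite ke ke2; ring.
have uc2 : (nu * 'C(q, 2)%:R = 0)%R.
  by rewrite C2; transitivity (hlf * al * (nu * eps))%R; [ring | rewrite ne mulr0].
have una : (nu * al = nu)%R by rewrite /al mulrDr ne addr0 mulr1.
move: E; rewrite aw /nnw.
set X := (al * w - w * ai)%R; set Y := (_ - w)%R; set Z := (X in (nu * X)%R).
have -> : (nn * Y = nu * (w * (l%:R + hlf * l%:R)))%R.
  rewrite /Y /al; transitivity (w * (nn * eps + nn * 'C(q, 2)%:R))%R; first by ring.
  by rewrite ke nc2; ring.
rewrite (zxC_nu rels) mulg1 -(zxD P_gt1) // => /A_eq1 E.
have EX : (nn * X = nu * w * (2 * l%:R))%R.
  rewrite /X /al /ai; transitivity (w * (2 * (nn * eps) - nn * eps ^+ 2))%R; first by ring.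
  by rewrite ke ke2; ring.
have EZ : (nu * Z = - (nu * w * l%:R * (third * l)%:R))%R.
  rewrite /Z -(mulrA hh al) -(mulrA hh _ ai) aw.
  transitivity (hh * w * (nu * al - nu) + (nu * 'C(q, 2)%:R) * (hh * w - l%:R * w + l%:R * w * ai)
     - l%:R * w * (nu * 'C(q, 3)%:R))%R; first by ring.
  by rewrite una uc2 /q nu_l_bin3; ring.
have nw : (nu * w = 0)%R.
  have u : (l%:R * (2 - (third * l)%:R) : R)%R \is a GRing.unit.
    by rewrite unitrM l_unit two_sub_unit.
  apply: (mulIr u).
  by rewrite mul0r -E EX EZ; ring.
have : (w : nat) = 0 %[mod n].
  by apply/(@nuE); rewrite natZ_val nw mulr0n mulr0.
move/eqP; rewrite mod0n => /dvdnP[c Ec]; exists (c%:R)%R.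
by rewrite -(natZ_val w) Ec natrM -(nnE); ring.
Qed.

End FixedCommutator.

Section StabilizerA.

Variables (gT : finGroupType) (J : {group gT}) (A B : gT).
Hypothesis presJ : presented_by J [:: A; B] (J_rels p m (1 + l * n)).
Local Notation C := [~ A, B].
Let rels := pres_rels presJ.
Let AP : A ^+ P = 1 := J_AP rels.
Let BP : B ^+ P = 1 := J_BP rels.
Let CP : C ^+ P = 1 := expC_P rels.
Let AJ : A \in J := memA presJ.
Let BJ : B \in J := memB presJ.
Let CJ : C \in J := memC presJ.
Variables (eA eB : gT -> 'Z_n).
Hypothesis eAM : {in J &, forall x y, eA (x * y) = (eA x + eA y)%R}.
Hypothesis eBM : {in J &, forall x y, eB (x * y) = (eB x + eB y)%R}.
Hypotheses (eAA : eA A = 1%R) (eAB : eA B = 0%R) (eBA : eB A = 0%R) (eBB : eB B = 1%R).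
Let genJ : <<[set A; B]>> = J := pres_gen presJ.
Let Cg := centA presJ.

Lemma eA_zx (i : R) : eA (A ^^ i) = ((i : nat)%:R)%R.
Proof. by rewrite /zx (addX eAM) // eAA. Qed.

Lemma eA0_nn (i : R) : eA (A ^^ i) = 0%R -> exists x : R, i = (nn * x)%R.
Proof. by rewrite eA_zx; apply: nn_dvd. Qed.

(* [A ^ Y = A * E] with [E] in the coset [<[A]> * C] is solved by
   [Y = B * A ^^ r], since conjugating [A * C] by powers of [A] reaches every
   [A ^^ (1 + i) * C] with [i] divisible by [p ^ m]. *)
Lemma conjAC_solve (x : R) : exists r : R, A ^ (B * A ^^ r) = A ^^ (1 + nn * x)%R * C.
Proof.
exists (- x * (l%:R)^-1 * al)%R; rewrite conjgM (J_AB A B).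
set r := (_ * al)%R.
have -> : (A * C) ^ (A ^^ r) = A ^^ (1 - r + r * ai)%R * C.
  have CA : C * A ^^ r = A ^^ (r * ai)%R * C.
    by rewrite [LHS]conjgCV zxJ (J_ACV rels) -(zxM P_gt1) // mulrC.
  rewrite conjgE -mulgA CA mulgA mulgA; congr (_ * _).
  by rewrite -(zxN P_gt1) // -{2}(zx1 P_gt1 A) -!(zxD P_gt1) // [(- r + 1)%R]addrC.
congr (A ^^ _ * _).
have aa : (al * ai = 1)%R by exact: alai.
have u := l_unit.
have -> : (r * ai = - x * l%:R^-1)%R by rewrite /r -mulrA aa mulr1.
have -> : (r = - x * l%:R^-1 * (1 + eps))%R by [].
transitivity (1 + x * l%:R^-1 * eps)%R; first by ring.
rewrite (eps_nn); congr (_ + _)%R.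
transitivity (nn * x * (l%:R^-1 * l%:R))%R; first by ring.
by rewrite mulVr // mulr1.
Qed.

(** The relation for [A] shows that [[~ A, s B]] is a power of [A] times [C]. By [conjAC_solve] and
    [centA], [s B = A ^^ q * B * A ^^ r], which is a conjugate by [A ^^ r] of [A ^^ (q + r) * B].
    The exponent sum makes [q + r] a multiple of [n], and [fix_A_rel] a multiple of [nu]. *)
Lemma fix_A (s : {perm gT}) : s \in AutZ 4 J -> s A = A ->
  exists z r : R, s B = A ^^ (nu * z)%R * B ^ (A ^^ r).
Proof.
move=> /(Aut4P presJ eAM eBM eAA eAB eBA eBB)[sA _ [eY _]] As.
have sM := autM sA; set Y := s B in eY *.
have YJ : Y \in J by apply: Aut_closed.
have sC : s C = [~ A, Y] by rewrite (morphinR sM) // As.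
have relA : A ^ [~ A, Y] = A ^^ al.
  have := congr1 s (J_AC rels).
  by rewrite (morphinJ sM) // (morphin_zx sM) // sC As.
have EJ : [~ A, Y] \in J by rewrite groupR.
have [i Ei] : exists i : R, [~ A, Y] = A ^^ i * C.
  have mem : [~ A, Y] * C^-1 \in J by rewrite groupM ?groupV.
  have com : commute ([~ A, Y] * C^-1) A.
    apply: commute_sym; apply/commgP/conjg_fixP; rewrite conjgM relA -(J_AC rels).
    by rewrite conjgK.
  have [i Ei] := Cg mem com.
  by exists i; rewrite -Ei mulgVK.
have [x ix] : exists x : R, i = (nn * x)%R.
  apply: eA0_nn; have := addR eAM AJ YJ; rewrite Ei eAM ?zx_group //.
  by rewrite (addR eAM) // addr0.
have [r Er] := conjAC_solve x.
have [q Eq] : exists q : R, Y = A ^^ q * B * A ^^ r.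
  have mem : Y * (B * A ^^ r)^-1 \in J by rewrite !(groupM, groupV) ?zx_group.
  have com : commute (Y * (B * A ^^ r)^-1) A.
    apply: commute_sym; apply/commgP/conjg_fixP; rewrite conjgM; apply: (canLR (conjgK _)).
    rewrite Er -ix addrC (zxD P_gt1) // (zx1 P_gt1).
    have -> : A ^ Y = A * [~ A, Y] by rewrite commgEl mulKVg.
    by rewrite Ei mulgA -(zxC _ (commute_refl A)).
  have [q Eq] := Cg mem com.
  by exists q; rewrite -mulgA -Eq mulgVK.
have [w Ew] : exists w : R, (q + r = nn * w)%R.
  apply: eA0_nn; move: eY; rewrite Eq !eAM ?groupM ?zx_group // eAB addr0 => <-.
  by rewrite -eAM ?zx_group // -(zxD P_gt1).
have YE : Y = (A ^^ (nn * w)%R * B) ^ (A ^^ r).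
  rewrite Eq -Ew addrC (zxD P_gt1) // conjgE !mulgA mulVg mul1g //.
have Ar (g : gT) : A ^ (A ^^ r) = A by apply/conjg_fixP/commgP/commuteX.
have sB : Y ^ [~ A, Y]^-1 = Y ^+ (1 + l * n).
  have := congr1 s (J_BCV rels).
  rewrite (morphinJ sM) ?groupV // (morphinV sM) // sC (morphin_zx sM) //.
  have YP : Y ^+ P = 1 by rewrite -(morphinX sM) // BP (morphin1 sM).
  by rewrite -(zx_nat P_gt1) // (alE).
have [w' Ew'] : exists w' : R, (nn * w = nu * w')%R.
  apply: (fix_A_rel presJ).
  have EY : [~ A, Y] = C ^ (A ^^ r).
    rewrite YE -{1}(Ar 1) -conjRg; congr (_ ^ _).
    rewrite !commgEl conjgM; congr (_ * _ ^ _).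
    by apply/conjg_fixP/commgP/commuteX.
  by apply: (conjg_inj (A ^^ r)); rewrite conjJg conjVg -EY -YE conjXg -YE.
exists w', r; rewrite YE conjMg Ew'; congr (_ * _).
by apply/conjg_fixP/commgP/zxCC.
Qed.

(** In [fix_A] only [z] modulo [n] and [r] modulo [N] matter, since [A ^+ N] is central. *)
Lemma card_stab_A : #|'C_(AutZ 4 J)[A | 'P]| <= p ^ (3 * m).
Proof.
have N0 : 0 < N by rewrite expn_gt0 prime_gt0.
pose F (x : 'I_n * 'I_N) := A ^^ (nu * x.1%:R)%R * B ^ (A ^+ x.2).
have cardT : #|{: 'I_n * 'I_N}| = (p ^ (3 * m))%N.
  by rewrite card_prod !card_ord -expnD; congr (_ ^ _)%N; lia.
have sJ s : s \in 'C_(AutZ 4 J)[A | 'P] -> [/\ s \in AutZ 4 J, s \in Aut J & s A = A].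
  case/setIP=> s4 /astab1P As; split=> //.
  by case/setIdP: s4.
rewrite -(card_in_imset (f := fun s : {perm gT} => s B)); last first.
  move=> s t /sJ[_ sA As] /sJ[_ tA At] E.
  by apply: (aut_ext genJ) => //; rewrite As At.
rewrite -cardT -cardsT; apply: leq_trans (leq_imset_card F _).
apply: subset_leq_card; apply/subsetP=> _ /imsetP[s /sJ[s4 sA As] ->].
have [z [r ->]] := fix_A s4 As.
have [z' z'n ->] := nu_cancel z.
have rN : (r : nat) %% N < N by rewrite ltn_mod.
apply/imsetP; exists (Ordinal z'n, Ordinal rN) => //; rewrite /F /=; congr (_ * _).
rewrite /zx {1}(divn_eq r N) expgnDr conjgM; congr (_ ^ _).
apply/conjg_fixP/commgP/commute_sym.
have := A_nu_central presJ ((r : nat) %/ N)%:R%R BJ.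
by rewrite -natrM (zx_nat P_gt1) // mulnC.
Qed.

(** Orbit and stabilizer of [A]: the orbit lies in [A *: 'Z_4(J)]. *)
Lemma card_Aut4_le : #|AutZ 4 J| <= p ^ (8 * m).
Proof.
rewrite -(card_orbit_stab 'P [group of AutZ 4 J] A).
have -> : (p ^ (8 * m) = p ^ (5 * m) * p ^ (3 * m))%N by rewrite -expnD; congr (_ ^ _)%N; lia.
apply: leq_mul; last exact: card_stab_A.
have Z5 := card_Z4 presJ eAM eBM eAA eAB eBA eBB.
apply: leq_trans Z5; rewrite -[X in _ <= X](card_lcoset _ A).
apply: subset_leq_card; apply/subsetP=> y /imsetP[s s4 ->].
rewrite mem_lcoset -[('P)%act A s]/(s A).
have [sA [a1 b0] _] := Aut4P presJ eAM eBM eAA eAB eBA eBB _ s4.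
have sAJ : s A \in J by apply: Aut_closed.
apply/(Z4P presJ eAM eBM eAA eAB eBA eBB).
by rewrite groupM ?groupV // eAM ?eBM ?groupV // (addV eAM) // (addV eBM) // a1 b0 eAA eBA oppr0 addNr addr0.
Qed.

End StabilizerA.

(** * Power and conjugation formulas for [n]-th powers *)

Section PowersN.

Variables (gT : finGroupType) (J : {group gT}) (A B : gT).
Hypothesis presJ : presented_by J [:: A; B] (J_rels p m (1 + l * n)).
Local Notation C := [~ A, B].
Let rels := pres_rels presJ.
Let AP : A ^+ P = 1 := J_AP rels.
Let BP : B ^+ P = 1 := J_BP rels.
Let CP : C ^+ P = 1 := expC_P rels.
Let AJ : A \in J := memA presJ.
Let BJ : B \in J := memB presJ.
Let CJ : C \in J := memC presJ.
Let ACN := J_ANBN rels.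
Local Notation V x y z := (@nnw gT A B x%R y%R z%R).

Lemma nn_bin2 : exists c : R, ('C(n, 2)%:R = nn * c)%R.
Proof.
have /dvdnP[c ->] := dvdn_bin2 (dvdnn n).
by exists (c%:R)%R; rewrite natrM mulrC.
Qed.

Lemma nu_bin2n : (nu * 'C(n, 2)%:R = 0)%R.
Proof.
have [c ->] := nn_bin2; rewrite mulrA [(nu * _)%R]mulrC.
by rewrite (nn_nu presJ) mul0r.
Qed.

Lemma nu_bin3n : (nu * 'C(n, 3)%:R = nu * (third)%:R)%R.
Proof. by apply: nu_mod => //; rewrite bin3_mod // divnn n_gt0 muln1. Qed.

Lemma expBA'n : (B * A ^^ nn) ^+ n = B ^^ nn * A ^^ (nu * (1 - d))%R.
Proof.
have -> : A ^^ nn = V 1 0 0.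
  by rewrite (VA presJ) mulr0 addr0 mulr1.
rewrite (expBV presJ) -(zx_nat P_gt1 n BP); congr (_ * _).
rewrite /nnw; set X := (_ * 0 + _)%R; set Z := (_ * 0 + _ - _)%R.
have [c Ec] := nn_bin2.
have -> : (nn * X = nu * c)%R by rewrite /X Ec -(nnE); ring.
rewrite (zxC_nu rels) mulg1 -(zxD P_gt1) //; congr (A ^^ _).
rewrite /Z mulr1 (nnE).
transitivity (nu + hh * (nu * 'C(n, 2)%:R) - l%:R * (nu * 'C(n, 3)%:R))%R; first by ring.
by rewrite nu_bin2n nu_bin3n natrM; ring.
Qed.

Lemma commA'B' x y : commute (A ^^ (nn * x)%R) (B ^^ (nn * y)%R).
Proof.
apply/commgP/conjg_fixP.
have -> : A ^^ (nn * x)%R = V x 0 0.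
  by rewrite (VA presJ) mulr0 addr0.
rewrite [LHS](conjV_BX presJ) bin2_half // natZ_val /nnw.
have nnu : (nn * nu = 0)%R := nn_nu presJ.
set Y := (0 + _)%R; set Z := (_ - _)%R.
have -> : (nn * Y = nu * (y * x))%R by rewrite /Y -(nnE); ring.
have -> : (nu * Z = 0)%R.
  rewrite /Z; set h := hh.
  transitivity ((nn * nu) * (h * y * x - l%:R * hlf * y * (nn * y - 1) * x))%R; first by ring.
  by rewrite nnu mul0r.
by rewrite (zxC_nu rels) !mulr0 zx0.
Qed.

Lemma al_nn y : (al ^+ ((nn * y)%R : nat) = 1 + nu * (l%:R * y))%R.
Proof.
have ke : (nn * eps = nu * l%:R)%R by exact: nn_eps.
have ke2 : (nn * eps ^+ 2 = 0)%R by exact: (nn_eps2 presJ).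
rewrite alX // bin2_half // natZ_val.
transitivity (1 + y * (nn * eps) + hlf * y * (nn * y - 1) * (nn * eps ^+ 2))%R; first by ring.
by rewrite ke ke2; ring.
Qed.

Lemma conjA_C' u : A ^ (C ^^ (nn * u)%R) = A * A ^^ (nu * (l%:R * u))%R.
Proof.
rewrite -{1}(zx1 P_gt1 A) [LHS](conjA_C rels) mul1r al_nn.
by rewrite (zxD P_gt1) // (zx1 P_gt1).
Qed.

Lemma conjB_C' u : B ^ (C ^^ (nn * u)%R) = B * A ^^ (nu * (l%:R * u))%R.
Proof.
rewrite -{1}(zx1 P_gt1 B) [LHS](conjB_C rels) mul1r.
rewrite (ai_nn presJ) (zxD P_gt1) // (zx1 P_gt1) -mulrN.
by rewrite ACN mulrN opprK.
Qed.

Lemma conjA_form g : g \in J -> exists s t : R,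
  A ^ g = A ^^ (al ^+ (t : nat))%R * C ^^ s * B ^^ ((s - gs s) * ai ^+ (t : nat))%R.
Proof.
(* The normal form is taken for [g^-1], so that [g] begins with a power of [A], which fixes [A]. *)
move=> gJ; have [t [s [r Eg]]] : exists t s r : R, g^-1 = C ^^ t * B ^^ s * A ^^ r.
  by apply: (J_nf presJ); rewrite groupV.
have {}Eg : g = A ^^ (- r)%R * B ^^ (- s)%R * C ^^ (- t)%R.
  by rewrite -[g]invgK Eg !invMg !(zxN P_gt1) // mulgA.
move: (- s)%R (- t)%R (- r)%R Eg => {}s {}t {}r Eg; exists s, t.
have -> : A ^ g = (A ^ (B ^^ s)) ^ (C ^^ t).
  rewrite Eg !conjgM; congr ((_ ^ _) ^ _); apply/conjg_fixP/commgP; exact: commuteX.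
rewrite [A ^ _](conjA_BX rels) natZ_val !conjMg.
rewrite [(B ^^ _) ^ _](conjB_C rels); congr (_ * _ * _).
  by rewrite -{1}(zx1 P_gt1 A) [LHS](conjA_C rels) mul1r.
by apply/conjg_fixP/commgP/zxCC.
Qed.

Lemma zx_CV (e : R) : [~ B, A] ^^ e = C ^^ (- e)%R.
Proof. by rewrite -invgR (zxV P_gt1). Qed.

End PowersN.

(** * Powers of [x] and [Delta], and their orders modulo inner automorphisms *)

Section XDelta.

Variables (gT : finGroupType) (J : {group gT}) (A B : gT).
Hypothesis presJ : presented_by J [:: A; B] (J_rels p m (1 + l * n)).
Local Notation C := [~ A, B].
Let rels := pres_rels presJ.
Let AP : A ^+ P = 1 := J_AP rels.
Let BP : B ^+ P = 1 := J_BP rels.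
Let CP : C ^+ P = 1 := expC_P rels.
Let AJ : A \in J := memA presJ.
Let BJ : B \in J := memB presJ.
Let CJ : C \in J := memC presJ.
Let presS := pres_swap presJ.
Let genJ : <<[set A; B]>> = J := pres_gen presJ.
Let ACN := J_ANBN rels.
Let zJ c := A_nu_central presJ c.
Variables (x D : {perm gT}).
Hypotheses (xJ : x \in Aut J) (DJ : D \in Aut J).
Hypotheses (xA : x A = A * A ^^ nu) (xB : x B = B * A ^^ (- nu)%R).
Hypotheses (DA : D A = A * B ^^ nn) (DB : D B = B * B ^^ (nn * (d - 2))%R * A ^^ nn).
Let cAB' u v := commA'B' presJ u v.

Let nu2' : (nu * nu = 0)%R. Proof. exact: nu2. Qed.
Let nnu : (nn * nu = 0)%R. Proof. exact: (nn_nu presJ). Qed.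

Lemma x_nu c : x (A ^^ (nu * c)%R) = A ^^ (nu * c)%R.
Proof.
rewrite (morphin_zx (autM xJ)) // xA zxMg; last first.
  by apply: commute_sym; apply: zxC.
by rewrite -(zxM P_gt1) // mulrA nu2' mul0r zx0 mulg1.
Qed.

Lemma xX_A k : (x ^+ k) A = A * A ^^ (nu * k%:R)%R.
Proof.
elim: k => [|k IH]; first by rewrite perm1 mulr0 zx0 mulg1.
rewrite expgSr permM IH (autM xJ) ?zx_group // x_nu xA -mulgA -(zxD P_gt1) //.
by rewrite -natr1 mulrDr mulr1 addrC.
Qed.

Lemma xX_B k : (x ^+ k) B = B * A ^^ (- (nu * k%:R))%R.
Proof.
elim: k => [|k IH]; first by rewrite perm1 mulr0 oppr0 zx0 mulg1.
rewrite expgSr permM IH (autM xJ) ?zx_group // -mulrN x_nu xB -mulgA -(zxD P_gt1) //.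
by rewrite mulrN -opprD -natr1 mulrDr mulr1 addrC.
Qed.

Lemma x_order : x ^+ n = 1.
Proof.
apply: (aut_ext genJ) => //; rewrite ?groupX ?group1 // perm1 ?xX_A ?xX_B.
all: by rewrite mulrC nnu ?oppr0 zx0 mulg1.
Qed.

(** The mirror image of [expBA'n] computes [(A * B ^^ nn) ^+ n], and [B ^^ nu] is the inverse of
    [A ^^ nu]. *)
Lemma D_nn' : D (A ^^ nn) = A ^^ nn * A ^^ (nu * (d - 1))%R.
Proof.
have E := expBA'n presS.
rewrite {1}/zx val_Zp_nat ?P_gt1 // (expg_modn n AP) (morphinX (autM DJ)) // DA E ACN.
by congr (_ * A ^^ _); ring.
Qed.

Lemma D_A' y : D (A ^^ (nn * y)%R) = A ^^ (nn * y)%R * A ^^ (nu * ((d - 1) * y))%R.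
Proof.
rewrite (zxM P_gt1) // (morphin_zx (autM DJ)) ?zx_group // D_nn' zxMg; last exact: zxCC.
by rewrite -!(zxM P_gt1) // mulrA.
Qed.

Lemma D_nu c : D (A ^^ (nu * c)%R) = A ^^ (nu * c)%R.
Proof.
rewrite -(nnE) -mulrA D_A'.
rewrite (_ : nu * ((d - 1) * (nn * c)) = 0)%R ?zx0 ?mulg1 //.
by transitivity ((nn * nu) * ((d - 1) * c))%R; [ring | rewrite nnu mul0r].
Qed.

Lemma D_nnB : D (B ^^ nn) = B ^^ nn * A ^^ (nu * (3 - 2 * d))%R.
Proof.
have E := expBA'n presJ.
rewrite {1}/zx val_Zp_nat ?P_gt1 // (expg_modn n BP) (morphinX (autM DJ)) // DB.
set w := B ^^ (nn * (d - 2))%R.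
have wB : commute w B by apply: zxC.
have wA : commute w (A ^^ nn) by have := cAB' 1%R (d - 2)%R; rewrite mulr1 => /commute_sym.
rewrite -wB -mulgA expgMn; last exact: commuteM.
rewrite E -(zx_nat P_gt1) ?zxq // -(zxM P_gt1) //.
rewrite (_ : nn * (d - 2) * nn = nu * (d - 2))%R; last by rewrite -(nnE); ring.
have BnJ : B ^^ nn \in J by exact: zx_group.
rewrite ACN -mulrN mulgA (zJ _ BnJ) -mulgA -(zxD P_gt1) // -mulrDr.
by congr (_ * A ^^ _); ring.
Qed.

Lemma D_B' y : D (B ^^ (nn * y)%R) = B ^^ (nn * y)%R * A ^^ (nu * ((3 - 2 * d) * y))%R.
Proof.
rewrite (zxM P_gt1) // (morphin_zx (autM DJ)) ?zx_group // D_nnB zxMg; last first.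
  by apply/commute_sym/zJ/zx_group.
by rewrite -!(zxM P_gt1) // mulrA.
Qed.

Lemma DX_A k : (D ^+ k) A = A * B ^^ (nn * k%:R)%R * A ^^ (nu * ((3 - 2 * d) * 'C(k, 2)%:R))%R.
Proof.
elim: k => [|k IH]; first by rewrite perm1 bin0n /= !mulr0 !zx0 !mulg1.
rewrite expgSr permM IH !(autM DJ) ?groupM ?zx_group // D_nu DA D_B'.
rewrite -!mulgA; congr (_ * _); rewrite -(zxD P_gt1 _ _ AP) mulgA -(zxD P_gt1 _ _ BP).
rewrite binS bin1 natrD -natr1; congr (_ * _); congr (_ ^^ _); ring.
Qed.

Lemma DX_B k : (D ^+ k) B = B * B ^^ (nn * ((d - 2) * k%:R))%R * A ^^ (nn * k%:R)%R *
   A ^^ (nu * (((3 - 2 * d) * (d - 2) + (d - 1)) * 'C(k, 2)%:R))%R.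
Proof.
elim: k => [|k IH]; first by rewrite perm1 bin0n /= !mulr0 !zx0 !mulg1.
rewrite expgSr permM IH !(autM DJ) ?groupM ?zx_group // D_nu DB D_B' D_A'.
have cab v : A ^^ nn * B ^^ (nn * v)%R = B ^^ (nn * v)%R * A ^^ nn.
  by have := cAB' 1%R v; rewrite mulr1.
rewrite -!mulgA; congr (_ * _); rewrite (mulgA (A ^^ nn)) cab -!mulgA.
rewrite -!(zxD P_gt1 _ _ AP) mulgA -(zxD P_gt1 _ _ BP).
rewrite binS bin1 natrD -natr1; congr (_ * _); congr (_ ^^ _); ring.
Qed.

Lemma DX_n : (D ^+ n) A = A * A ^^ (- nu)%R /\ (D ^+ n) B = B * A ^^ (nu * (3 - d))%R.
Proof.
have n2 c : (nu * (c * 'C(n, 2)%:R) = 0)%R.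
  by rewrite mulrCA (nu_bin2n presJ) mulr0.
rewrite DX_A DX_B !n2 zx0 !mulg1 mulrCA (nnE) [(_ * nu)%R]mulrC ACN; split.
  by rewrite -{1}[nu]mulr1 ACN mulr1.
rewrite -mulgA -(zxD P_gt1) //; congr (_ * A ^^ _); ring.
Qed.

Lemma x_nnA : x (A ^^ nn) = A ^^ nn.
Proof.
rewrite (morphin_zx (autM xJ)) // xA zxMg; last exact/commute_sym/zxC.
by rewrite -(zxM P_gt1) // [(nu * _)%R]mulrC nnu zx0 mulg1.
Qed.

Lemma x_nnB y : x (B ^^ (nn * y)%R) = B ^^ (nn * y)%R.
Proof.
have cB : commute B (A ^^ (- nu)%R).
  by apply: commute_sym; have := zJ (- 1)%R BJ; rewrite mulrN1.
rewrite (morphin_zx (autM xJ)) // xB zxMg // -(zxM P_gt1) //.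
by rewrite mulrA mulNr [(nu * _)%R]mulrC nnu oppr0 mul0r zx0 mulg1.
Qed.

Lemma xD_comm : x ^ D = x.
Proof.
have xB1 := x_nnB 1; rewrite mulr1 in xB1.
have cnu g : g \in J -> commute (A ^^ nu) g by move=> /(zJ 1%R); rewrite mulr1.
have cnuN g : g \in J -> commute (A ^^ (- nu)%R) g by move=> /(zJ (- 1)%R); rewrite mulrN1.
have Dn1 : D (A ^^ nu) = A ^^ nu by have := D_nu 1%R; rewrite mulr1.
have DnN : D (A ^^ (- nu)%R) = A ^^ (- nu)%R by have := D_nu (- 1)%R; rewrite mulrN1.
apply/conjg_fixP/commgP; apply: (aut_ext genJ); rewrite ?groupM // !permM.
  rewrite xA DA !(autM DJ) ?zx_group // !(autM xJ) ?zx_group // xA DA Dn1 xB1.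
  by rewrite -!mulgA; congr (_ * _); rewrite (cnu _ (zx_group _ BJ)).
rewrite xB DB !(autM DJ) ?zx_group // !(autM xJ) ?groupM ?zx_group // xB DB DnN x_nnB x_nnA.
by rewrite -!mulgA; congr (_ * _); rewrite mulgA cnuN ?groupM ?zx_group.
Qed.

Lemma xX_nu k c : (x ^+ k) (A ^^ (nu * c)%R) = A ^^ (nu * c)%R.
Proof. by elim: k => [|k IH]; rewrite ?perm1 // expgSr permM IH x_nu. Qed.

Lemma conj_autM : {in J &, {morph conj_aut J : y z / y * z}}.
Proof.
move=> y z yJ zJ'; apply: conj_aut_morphM; exact: (subsetP (normG J)).
Qed.

Lemma conj_aut_Aut g : g \in J -> conj_aut J g \in Aut J.
Proof.
by move=> gJ; apply: (subsetP (Aut_conj_aut J J)); apply: mem_morphim => //; apply: (subsetP (normG J)).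
Qed.

Lemma conj_autJ g s : g \in J -> s \in Aut J -> conj_aut J g ^ s = conj_aut J (s g).
Proof.
move=> gJ sJ; have sg : s g \in J by apply: Aut_closed.
apply: (eq_Aut (groupJ (conj_aut_Aut gJ) sJ) (conj_aut_Aut sg)) => y yJ.
have [z zJ' ->] : exists2 z, z \in J & y = s z.
  by exists (s^-1 y); rewrite ?permKV // Aut_closed ?groupV.
by rewrite permJ !conj_autE ?Aut_closed // (morphinJ (autM sJ)).
Qed.

Lemma conj_aut_nu c : conj_aut J (A ^^ (nu * c)%R) = 1.
Proof.
have cJ : A ^^ (nu * c)%R \in J by exact: zx_group.
apply: (aut_ext genJ); rewrite ?conj_aut_Aut ?group1 // conj_autE // perm1.
  by apply/conjg_fixP/commgP/commute_sym/zJ.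
by apply/conjg_fixP/commgP/commute_sym/zJ.
Qed.

(** Conjugation by [C ^^ (nn * U)] multiplies both generators by [A ^^ (nu * l * U)], while [x ^^ W]
    multiplies [A] by [A ^^ (nu * W)] and [B] by its inverse. Matching [DX_n] on [A] and on [B]
    gives the sum and the difference in the hypotheses. *)
Lemma D_n (U W : R) : (nu * (l%:R * U + W) = - nu)%R -> (nu * (l%:R * U - W) = nu * (3 - d))%R ->
  D ^+ n = conj_aut J (C ^^ (nn * U)%R) * x ^^ W.
Proof.
move=> E1 E2; have CnJ : C ^^ (nn * U)%R \in J by exact: zx_group.
have [EA EB] := DX_n.
apply: (aut_ext genJ); rewrite ?groupM ?groupX ?conj_aut_Aut //.
  rewrite EA permM conj_autE // (conjA_C' presJ).
  rewrite (autM (groupX _ xJ)) ?zx_group // xX_nu xX_A natZ_val -mulgA -(zxD P_gt1) //.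
  by congr (_ * A ^^ _); rewrite -E1; ring.
rewrite EB permM conj_autE // (conjB_C' presJ).
rewrite (autM (groupX _ xJ)) ?zx_group // xX_nu xX_B natZ_val -mulgA -(zxD P_gt1) //.
by congr (_ * A ^^ _); rewrite -E2; ring.
Qed.

Lemma nn_nu_dvd k (z : R) : (nn * k%:R = nu * z)%R -> n %| k.
Proof.
rewrite -natrM => E; have := @mod_N_nu (n * k) z 0.
rewrite add0r -E => /(_ erefl)/eqP; rewrite mod0n NE => H.
by have {}H : (n * n %| n * k)%N by []; rewrite dvdn_pmul2l ?n_gt0 in H.
Qed.

Lemma unit2 : (2 : R)%R \is a GRing.unit.
Proof. by apply: unit_coprime => //; rewrite prime_coprime // gtnNdvd // p_gt2. Qed.

(** On [A], [x ^+ k] agrees with conjugation by [C ^^ (nn * c)] for [c = k / l], so [g] is a power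
    of [A] times this element. On [B] the effect has the opposite sign, so a power of [A] acts on
    [B] as [C ^^ (- 2 * nn * c)] does; the normal form then makes [2 * nn * c] a multiple of
    [nu]. *)
Lemma x_Inn k g : g \in J -> x ^+ k = conj_aut J g -> n %| k.
Proof.
move=> gJ E; have u := l_unit.
have gA : A ^ g = A * A ^^ (nu * k%:R)%R by rewrite -xX_A E conj_autE.
have gB : B ^ g = B * A ^^ (- (nu * k%:R))%R by rewrite -xX_B E conj_autE.
pose c : R := (l%:R^-1 * k%:R)%R.
have lc : (l%:R * c = k%:R)%R by rewrite /c mulrA mulrV // mul1r.
have CA : A ^ (C ^^ (nn * c)%R) = A * A ^^ (nu * k%:R)%R.
  by rewrite (conjA_C' presJ) lc.
have mem : g * (C ^^ (nn * c)%R)^-1 \in J by rewrite groupM ?groupV ?zx_group.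
have com : commute (g * (C ^^ (nn * c)%R)^-1) A.
  by apply: commute_sym; apply/commgP/conjg_fixP; rewrite conjgM gA -CA conjgK.
have [r Er] := centA presJ mem com.
have {Er}gE : g = A ^^ r * C ^^ (nn * c)%R by rewrite -Er mulgVK.
have BA : B ^ (A ^^ r) = B ^ (C ^^ (nn * (- c - c))%R).
  apply: (conjg_inj (C ^^ (nn * c)%R)); rewrite -!conjgM -gE gB -(zxD P_gt1) //.
  rewrite -mulrDr subrK (conjB_C' presJ) mulrN lc mulrN.
  by [].
set s := (nn * (- c - c))%R in BA.
have mem' : A ^^ r * (C ^^ s)^-1 \in J by rewrite groupM ?groupV ?zx_group.
have com' : commute (A ^^ r * (C ^^ s)^-1) B.
  by apply: commute_sym; apply/commgP/conjg_fixP; rewrite conjgM BA conjgK.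
have [t Et] := centA presS mem' com'.
have [c' [z [Ec _ _]]] : exists c' z : R, [/\ 0 - s = nu * c', 0 - t = nu * z &
    r * (al ^+ ((- s)%R : nat)) - 0 = nu * z]%R.
  apply: (nf_inj presJ).
  rewrite !zx0 !mulg1 mul1g -Et -(zxN P_gt1) //.
  rewrite (zx_swap _ _ AP (J_AC rels)).
  by rewrite mulgA -(zxD P_gt1) // subrr zx0 !mul1g.
rewrite sub0r in Ec; apply: (@nn_nu_dvd k (c' * (2^-1 * l%:R))%R).
rewrite mulrA -Ec /s; transitivity ((nn * (l%:R * c)) * (2 / 2))%R; last by ring.
by rewrite lc mulrV ?mulr1 // unit2.
Qed.

(** Evaluated at [A], the hypothesis gives a conjugate of [A] equal to
    [A ^^ (1 + nu * w) * B ^^ (nn * k)]. In [conjA_form] the absence of [C] makes [s] a multiple of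
    [nu], whence [s - gs s = 0] and the exponent of [B] is a multiple of [nu]. *)
Lemma D_Inn k g v : g \in J -> D ^+ k = conj_aut J g * x ^+ v -> n %| k.
Proof.
move=> gJ E; set g' := (x ^+ v) g.
have xvJ : x ^+ v \in Aut J by rewrite groupX.
have g'J : g' \in J by apply: Aut_closed.
have [w Ew] : exists w : R, A ^ g' = A ^^ (1 + nu * w)%R * B ^^ (nn * k%:R)%R.
  have := congr1 (fun s : {perm gT} => s A) E; rewrite /= DX_A permM conj_autE //.
  rewrite (morphinJ (autM xvJ)) // xX_A conjMg.
  have -> : (A ^^ (nu * v%:R)%R) ^ g' = A ^^ (nu * v%:R)%R by apply/conjg_fixP/commgP/zJ.
  set e := ((3 - 2 * d) * _)%R => E'.
  exists (e - v%:R)%R; apply: (mulIg (A ^^ (nu * v%:R)%R)); rewrite -E'.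
  rewrite (zxD P_gt1) // (zx1 P_gt1) -!mulgA; congr (_ * _).
  by rewrite [RHS]mulgA (zJ _ (zx_group _ BJ)) -mulgA -(zxD P_gt1) // -mulrDr subrK.
have [s [t AgE]] := conjA_form presJ g'J.
have CV := zx_CV presJ.
have [c [z [Es _ Ez]]] : exists c z : R, [/\ - s - 0 = nu * c,
    al ^+ (t : nat) * al ^+ (s : nat) - (1 + nu * w) = nu * z &
    (s - gs s) * ai ^+ (t : nat) - nn * k%:R = nu * z]%R.
  apply: (nf_inj presS).
  rewrite !CV opprK oppr0 zx0 mul1g -Ew AgE; congr (_ * _).
  by rewrite (zx_swap _ _ AP (J_AC rels)).
have Es' : ((s : nat)%:R = nu * (- c) :> R)%R.
  by rewrite natZ_val mulrN -Es subr0 opprK.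
apply: (@nn_nu_dvd k (- z)%R); rewrite mulrN -Ez.
by rewrite (gs_nu Es') natZ_val subrr mul0r sub0r opprK.
Qed.

End XDelta.

(** * A representation by quadratic maps of [Z/p^(2m)] *)

Section Quadratic.

Variables (gT : finGroupType) (J : {group gT}) (A B : gT).
Hypothesis presJ : presented_by J [:: A; B] (J_rels p m (1 + l * n)).
Local Notation C := [~ A, B].
Let rels := pres_rels presJ.
Let AP : A ^+ P = 1 := J_AP rels.
Let BP : B ^+ P = 1 := J_BP rels.
Let CP : C ^+ P = 1 := expC_P rels.
Let AJ : A \in J := memA presJ.
Let BJ : B \in J := memB presJ.
Let CJ : C \in J := memC presJ.
Variables (eA eB : gT -> 'Z_n).
Hypothesis eAM : {in J &, forall x y, eA (x * y) = (eA x + eA y)%R}.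
Hypothesis eBM : {in J &, forall x y, eB (x * y) = (eB x + eB y)%R}.
Hypotheses (eAA : eA A = 1%R) (eAB : eA B = 0%R) (eBA : eB A = 0%R) (eBB : eB B = 1%R).
Local Notation S := 'Z_N.
Let genJ : <<[set A; B]>> = J := pres_gen presJ.

Definition qe : S := ((l * n)%N%:R)%R.
Definition qh : S := ((N.+1)./2%:R)%R.
Local Notation e := qe.
Local Notation h := qh.

Local Open Scope ring_scope.

Lemma N_eq0 : N%:R = 0 :> S.
Proof. by apply/(natZ_eq N 0 N_gt1); rewrite modnn mod0n. Qed.

Lemma e2 : e ^+ 2 = 0.
Proof.
rewrite /e -natrX; apply/(natZ_eq _ 0 N_gt1).
by rewrite mod0n expnMn -expnM (mulnC m) modnMl.
Qed.

Lemma qh2 : 2 * h = 1.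
Proof.
have E : (N.+1)%:R = 1 :> S by rewrite -nat1r N_eq0 addr0.
rewrite /h -natrM (mul2n (N.+1)./2); transitivity ((N.+1)%:R : S); last exact: E.
by congr (_%:R); have := odd_double_half N.+1; rewrite /= oddX p_odd orbT add0n.
Qed.

Lemma e_mod i j : e * i%:R = e * j%:R <-> (i = j %[mod n])%N.
Proof.
rewrite /e -!natrM; split=> [/(natZ_eq _ _ N_gt1) | E].
  rewrite NE -!(mulnC n) -!mulnA -!muln_modr => /eqP; rewrite eqn_mul2l => /orP[|].
    by rewrite -leqn0 leqNgt n_gt0.
  wlog le : i j / (i <= j)%N.
    by move=> W; case: (leqP i j) => [/W // | /ltnW/W H]; rewrite eq_sym => /H.
  rewrite eq_sym eqn_mod_dvd ?leq_mul2l ?le ?orbT // -mulnBr Gauss_dvdr ?coprime_nl //.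
  by rewrite -eqn_mod_dvd // => /eqP.
apply/(natZ_eq _ _ N_gt1); rewrite NE -!(mulnC n) -!mulnA -!muln_modr; congr (_ * _)%N.
by rewrite -modnMmr E modnMmr.
Qed.

Definition qA (x : S) : S := x + 1.
Definition qB (x : S) : S := x + e * h * (x * (x + 1)).
Definition qC (x : S) : S := (1 + e) * x.

Lemma qA_inj : injective qA. Proof. exact: addIr. Qed.
Lemma qB_inj : injective qB.
Proof.
apply: (can_inj (g := fun x => x - e * h * (x * (x + 1)))) => x; rewrite /qB.
by have ee := e2; ring: ee.
Qed.
Lemma qC_inj : injective qC.
Proof.
apply: (can_inj (g := fun x => (1 - e) * x)) => x; rewrite /qC.
by have ee := e2; ring: ee.
Qed.

Definition rA : {perm S} := perm qA_inj.
Definition rB : {perm S} := perm qB_inj.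
Definition rC : {perm S} := perm qC_inj.

Lemma rAX k x : (rA ^+ k)%g x = x + k%:R.
Proof.
elim: k => [|k IH]; first by rewrite perm1 addr0.
by rewrite expgSr permM IH permE /qA -natr1 addrA.
Qed.

Lemma rBX k x : (rB ^+ k)%g x = x + k%:R * (e * h * (x * (x + 1))).
Proof.
elim: k => [|k IH]; first by rewrite perm1 mul0r addr0.
rewrite expgSr permM IH permE /qB -natr1.
by have ee := e2; ring: ee.
Qed.

Lemma rABC : [~ rA, rB]%g = rC.
Proof.
suff E : (rA * rB = rB * (rA * rC))%g by rewrite commgEl conjgE E mulKg mulKg.
apply/permP=> x; rewrite !permM !permE /qA /qB /qC.
have ee := e2.
transitivity (x + 1 + e * h * (x * (x + 1)) + (2 * h) * e * (x + 1)); first by ring.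
by rewrite qh2; ring: ee.
Qed.

Lemma quad_rels : J_rels p m (1 + l * n) [:: rA; rB].
Proof.
have ee := e2.
have NP : (N %| P)%N by rewrite dvdn_exp2l // leq_mul2r orbT.
have P0 : P%:R = 0 :> S by apply/(natZ_eq P 0 N_gt1)/eqP; rewrite mod0n.
split.
- rewrite rABC; apply: (mulgI rC); rewrite -conjgC; apply/permP=> x.
  rewrite !permM rAX !permE /qA /qC natrD -/e; ring.
- rewrite -invgR rABC; apply: (mulIg rC); rewrite -conjgCV; apply/permP=> x.
  rewrite !permM rBX !permE /qB /qC natrD -/e; ring: ee.
- by apply/permP=> x; rewrite rAX perm1 P0 addr0.
- by apply/permP=> x; rewrite rBX perm1 P0 mul0r addr0.
Qed.

(** Translations perturbed by [e] times a quadratic polynomial: as [e ^+ 2 = 0], they are closed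
    under composition. Modulo [n], [i] and [j] are the exponent sums by [quad_rep]. *)
Definition quadmap (i j k : nat) (x : S) : S :=
  x + i%:R + e * (h * j%:R * x ^+ 2 + k%:R * x).

Lemma qbin2 k : ('C(k, 2))%:R = h * k%:R * (k%:R - 1) :> S.
Proof.
elim: k => [|k IH]; first by rewrite bin0n mulr0 mul0r.
rewrite binS bin1 natrD IH -natr1; apply/eqP; rewrite -subr_eq0; apply/eqP.
by transitivity ((1 - 2 * h) * k%:R); [ring | rewrite qh2 subrr mul0r].
Qed.

Lemma quad_rep : exists f : gT -> {perm S},
  {in J &, {morph f : y z / y * z}}%g /\
  forall g, g \in J -> exists i j k, [/\ eA g = i%:R, eB g = j%:R & forall x, f g x = quadmap i j k x].
Proof.
have [f [fM fA fB]] := pres_map presJ quad_rels.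
exists f; split=> // g; rewrite -{1}genJ; move: g; apply: gen_ind.
  exists 0%N, 0%N, 0%N; rewrite (add1 eAM) (add1 eBM); split=> // x.
  by rewrite (morphin1 fM) perm1 /quadmap; ring.
rewrite genJ => g y gJ yAB [i [j [k [Ei Ej fg]]]].
have ee := e2.
case/set2P: yAB => ->.
  exists i.+1, j, k; rewrite eAM // eBM // Ei Ej eAA eBA natr1 addr0; split=> // x.
  by rewrite fM // permM fg fA permE /qA /quadmap -natr1; ring.
(* Applying [rB] also shifts the constant term by [e * h * i * (i + 1)], a multiple of [n], which
   [eA] does not see. *)
exists (i + l * n * 'C(i.+1, 2))%N, j.+1, (k + i + (N.+1)./2)%N.
rewrite eAM // eBM // Ei Ej eAB eBB natr1 addr0; split=> //.
  apply/(natZ_eq _ _ (ltnW (n_gt2))).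
  by rewrite mulnAC addnC modnMDl.
move=> x; rewrite fM // permM fg fB permE /qB /quadmap !natrD natrM -/e qbin2 -/h -!natr1.
set d := e * (h * j%:R * x ^+ 2 + k%:R * x).
have ed : e * d = 0 by rewrite /d; ring: ee.
transitivity (x + i%:R + d + e * h * ((x + i%:R) * (x + i%:R + 1)) +
   h * (e * d) * (2 * (x + i%:R) + d + 1)); first by ring.
rewrite ed mulr0 mul0r addr0 /d; apply/eqP; rewrite -subr_eq0; apply/eqP.
by transitivity (e * i%:R * x * (2 * h - 1)); [ring | rewrite qh2 subrr mulr0].
Qed.

Lemma quadmapX (f : {perm S}) i j k q : f =1 quadmap i j k ->
  forall x, (f ^+ q)%g x = x + q%:R * i%:R + e * (h * j%:R * (q%:R * x ^+ 2 +
     2 * x * i%:R * 'C(q, 2)%:R + i%:R ^+ 2 * ('C(q, 2)%:R + 2 * 'C(q, 3)%:R))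
    + k%:R * (q%:R * x + i%:R * 'C(q, 2)%:R)).
Proof.
move=> fE x; elim: q => [|q IH]; first by rewrite perm1 !bin0n /=; ring.
rewrite expgSr permM IH fE /quadmap !binS bin1 !natrD -natr1.
have KK : 2 * 'C(q, 2)%:R = q%:R * (q%:R - 1) :> S.
  by rewrite qbin2 -!mulrA mulrA qh2 mul1r.
set Q2 := 'C(q, 2)%:R in KK *; set Q3 := 'C(q, 3)%:R; set Q := q%:R in KK *.
set d := e * (h * j%:R * (Q * x ^+ 2 + _ + _) + _).
have ed : e * d = 0 by rewrite /d mulrA -expr2 e2 mul0r.
transitivity (x + (Q + 1) * i%:R + d + e * (h * j%:R * (x + Q * i%:R) ^+ 2 + k%:R * (x + Q * i%:R))
   + (e * d) * (h * j%:R * (2 * (x + Q * i%:R) + d) + k%:R)); first by ring.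
rewrite ed mul0r addr0 /d; apply/eqP; rewrite -subr_eq0; apply/eqP.
transitivity (e * h * j%:R * i%:R ^+ 2 * (Q * (Q - 1) - 2 * Q2)); first by ring.
by rewrite KK subrr mulr0.
Qed.

Lemma nat_add0 i : (i%:R = 0 :> 'Z_n) -> e * i%:R = 0 :> S.
Proof.
move/(natZ_eq _ 0 (ltnW (n_gt2))) => E.
by rewrite (proj2 (e_mod i 0) E) mulr0n mulr0.
Qed.

(* Comparing the coefficients of the quadratic maps by which [X], [Y] and
   [[X, Y]] act on Z/p^(2m). *)
Lemma rel_exponents X Y : X \in J -> Y \in J ->
    (X ^ [~ X, Y] = X ^+ (1 + l * n))%g ->
  eA X * (eA X * eB Y - eB X * eA Y) = eA X + eA X ^+ 2 * eB X * (third * l)%:R.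
Proof.
move=> XJ YJ rel; have [f [fM fE]] := quad_rep.
have ee := e2.
have [i [j [k [EiX EjX fX]]]] := fE X XJ.
have [r [s [k' [ErY EsY fY]]]] := fE Y YJ.
have EJ : [~ X, Y]%g \in J by rewrite groupR.
have [i0 [j0 [c [Ei0 Ej0 fC]]]] := fE _ EJ.
rewrite (addR eAM) // in Ei0; rewrite (addR eBM) // in Ej0.
have ei0 : e * i0%:R = 0 by apply: nat_add0.
have ej0 : e * j0%:R = 0 by apply: nat_add0.
have fCE x : f [~ X, Y]%g x = x + i0%:R + e * c%:R * x.
  rewrite fC /quadmap; transitivity (x + i0%:R + e * c%:R * x + h * x ^+ 2 * (e * j0%:R)); first by ring.
  by rewrite ej0; ring.
have comm x : f X (f Y x) + i0%:R + e * c%:R * (f X (f Y x)) = f Y (f X x).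
  rewrite -fCE; transitivity (f (Y * X * [~ X, Y])%g x).
    by rewrite (fM _ _ (groupM YJ XJ) EJ) (fM _ _ YJ XJ) !permM.
  by rewrite -(commgC X Y) (fM _ _ XJ YJ) permM.
have conj x : f [~ X, Y]%g (f X x) = (f X ^+ (1 + l * n))%g (f [~ X, Y]%g x).
  transitivity (f (X * [~ X, Y])%g x); first by rewrite (fM _ _ XJ EJ) permM.
  by rewrite (conjgC X) rel (fM _ _ EJ (groupX _ XJ)) permM (morphinX fM).
(* Subtracting the identity at [1] from the one at [0] isolates the linear coefficient: [c] is the
   determinant of the exponent sums of [X] and [Y]. *)
have eq1 : e * (s * i)%N%:R = e * (c + j * r)%N%:R.
  have E0 := comm 0; have E1 := comm 1; rewrite !fX !fY /quadmap in E0 E1.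
  apply/eqP; rewrite -subr_eq0 !natrD !natrM; apply/eqP.
  move/eqP: E0; rewrite -subr_eq0 => /eqP; set U0 := (_ - _) => E0.
  move/eqP: E1; rewrite -subr_eq0 => /eqP; set U1 := (_ - _) => E1.
  transitivity (U0 - U1 - (2 * h - 1) * e * (s%:R * i%:R - j%:R * r%:R)); last first.
    by rewrite E0 E1 qh2; ring.
  by rewrite /U0 /U1; ring: ee.
(* The relation is evaluated at [0]; the term with [d] comes from ['C(alpha, 3)]. *)
have eq2 : e * (i * c)%N%:R = e * (i + i * i * j * (third * l))%N%:R.
  have E0 := conj 0; rewrite (quadmapX _ fX) !fCE fX /quadmap in E0.
  have b2 : e * 'C(1 + l * n, 2)%:R = 0.
    by rewrite qbin2 natrD -/e; transitivity (h * (1 + e) * e ^+ 2); [ring | rewrite ee mulr0].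
  have b3 : e * 'C(1 + l * n, 3)%:R = e * (third * l)%:R.
    apply/e_mod; rewrite add1n binS -modnDm bin3_mod ?dvdn_mull // mulnK ?n_gt0 //.
    by rewrite (eqP (dvdn_bin2 (dvdn_mull l (dvdnn n)))) addn0 modn_mod.
  have a1 : (1 + l * n)%:R = 1 + e :> S by rewrite natrD.
  rewrite a1 in E0; move: b2 b3 E0.
  set Q2 := 'C(_, 2)%:R; set Q3 := 'C(_, 3)%:R; set T := (third * l)%:R => b2 b3 E0.
  apply/eqP; rewrite -subr_eq0 !natrD !natrM -/T; apply/eqP.
  move/eqP: E0; rewrite -subr_eq0 => /eqP; set U0 := (_ - _) => E0.
  transitivity (U0 + h * j%:R * (e * Q2) * i%:R * (2 * i0%:R + i%:R)  + k%:R * i%:R * (e * Q2)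
    + 2 * h * j%:R * i%:R ^+ 2 * (e * Q3 - e * T) + (2 * h - 1) * (j%:R * i%:R ^+ 2 * (e * T))
    + (e * i0%:R) * (h * j%:R * i0%:R + k%:R)).
    by rewrite /U0; ring: ee.
  by rewrite E0 b2 b3 qh2 ei0; ring.
have n_gt1 : (1 < n)%N := ltnW (n_gt2).
have {}eq1 : (s * i)%N%:R = (c + j * r)%N%:R :> 'Z_n.
  by apply/(natZ_eq _ _ n_gt1); apply/e_mod.
have {}eq2 : (i * c)%N%:R = (i + i * i * j * (third * l))%N%:R :> 'Z_n.
  by apply/(natZ_eq _ _ n_gt1); apply/e_mod.
rewrite EiX EjX ErY EsY; move: eq1 eq2; rewrite !natrD !natrM => eq1 eq2.
transitivity (i%:R * (s%:R * i%:R - j%:R * r%:R) : 'Z_n); first by ring.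
by rewrite eq1 addrK eq2; ring.
Qed.

End Quadratic.

(** * Solving the exponent equations in the local ring [Z/n] *)

Section LocalRing.
Local Notation S := 'Z_n.
Local Open Scope ring_scope.

Lemma unit_or_p (x : S) : x \is a GRing.unit \/ exists y, x = p%:R * y.
Proof.
have [px | npx] := boolP (p %| x)%N; last first.
  by left; rewrite -(natZ_val x) unitZpE ?n_gt1 // coprimeXl // prime_coprime.
by right; case/dvdnP: px => c E; exists c%:R; rewrite -natrM mulnC -E natZ_val.
Qed.

Lemma Zn_unit2 : (2 : S) \is a GRing.unit.
Proof. by rewrite unitZpE ?n_gt1 // coprimen2 n_odd. Qed.

Lemma p_third : p%:R * (third * l)%:R = 0 :> S.
Proof.
rewrite -natrM; apply/(natZ_eq _ 0 n_gt1); rewrite mod0n mulnA.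
have [p3 | ->] := p_cases; last by rewrite muln0 mul0n mod0n.
have -> : (p * third = n)%N.
  by rewrite /third p3 eqxx -expnS; congr (_ ^ _)%N; lia.
by rewrite modnMr.
Qed.

Lemma Zn_double_eq0 (x : S) : x = - x -> x = 0.
Proof.
move=> E; apply: (mulrI Zn_unit2); rewrite mulr0 mulr_natl mulr2n.
by rewrite {1}E addNr.
Qed.

(** Let [D = I * Q - J * R]. If [J] were a unit, the first two equations would give [D = - D], so
    [D = 0]. Hence [p] divides [J] and [J * d = 0], so [D = 1] and the second equation reads
    [- J = J]. With [J = 0], the fourth equation gives [Q * R * d = 0], and the third [- R = R]. *)
Lemma exponents_unit (I J R Q d : S) : p%:R * d = 0 ->
  I \is a GRing.unit -> I * Q - J * R \is a GRing.unit ->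
  I * (I * Q - J * R) = I + I ^+ 2 * J * d ->
  J * (J * R - I * Q) = J + J ^+ 2 * I * d ->
  R * (R * J - Q * I) = R + R ^+ 2 * Q * d ->
  Q * (Q * I - R * J) = Q + Q ^+ 2 * R * d ->
  [/\ J = 0, R = 0 & I * Q = 1].
Proof.
move=> pd Iu Du e1 e2 e3 e4.
have D0 : I * Q - J * R <> 0 by move=> D0; move: Du; rewrite D0 unitr0.
have eI : I * Q - J * R = 1 + I * J * d.
  by apply: (mulrI Iu); rewrite e1; ring.
have J0 : J = 0.
  have [Ju | [y Ey]] := unit_or_p J.
    case: D0; apply: Zn_double_eq0; rewrite {1}eI; apply: (mulrI Ju).
    by rewrite opprB e2; ring.
  have Jd : J * d = 0 by rewrite Ey mulrAC pd mul0r.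
  have D1 : I * Q - J * R = 1 by rewrite eI -mulrA Jd mulr0 addr0.
  apply: Zn_double_eq0; transitivity (J * (J * R - I * Q) - J * I * (J * d)).
    by rewrite e2; ring.
  have -> : J * R - I * Q = - 1 by rewrite -[LHS]opprB D1.
  by rewrite Jd; ring.
have {}eI : I * Q = 1 by move: eI; rewrite J0 mulr0 !mul0r subr0 addr0.
have Qu : Q \is a GRing.unit by apply/unitrP; exists I; split; rewrite ?eI // mulrC eI.
split=> //; apply: Zn_double_eq0.
have QRd : Q * R * d = 0.
  apply: (mulrI Qu); apply: (addrI Q); rewrite mulr0 addr0.
  by transitivity (Q + Q ^+ 2 * R * d); [ring | rewrite -e4 J0 mulr0 subr0 (mulrC Q I) eI mulr1].
transitivity (R * (R * J - Q * I) - R * (Q * R * d)); first by rewrite e3; ring.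
by rewrite QRd J0 mulr0 (mulrC Q) eI; ring.
Qed.

End LocalRing.

(** * The index of [AutZ 4 J] in [Aut J] *)

Section Transitive.

Variables (gT : finGroupType) (J : {group gT}) (A B : gT).
Hypothesis presJ : presented_by J [:: A; B] (J_rels p m (1 + l * n)).
Local Notation C := [~ A, B].
Let rels := pres_rels presJ.
Let AP : A ^+ P = 1 := J_AP rels.
Let BP : B ^+ P = 1 := J_BP rels.
Let CP : C ^+ P = 1 := expC_P rels.
Let AJ : A \in J := memA presJ.
Let BJ : B \in J := memB presJ.
Let CJ : C \in J := memC presJ.
Variables (eA eB : gT -> 'Z_n).
Hypothesis eAM : {in J &, forall x y, eA (x * y) = (eA x + eA y)%R}.
Hypothesis eBM : {in J &, forall x y, eB (x * y) = (eB x + eB y)%R}.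
Hypotheses (eAA : eA A = 1%R) (eAB : eA B = 0%R) (eBA : eB A = 0%R) (eBB : eB B = 1%R).
Let Z4P' := Z4P presJ eAM eBM eAA eAB eBA eBB.
Let Aut4P' := Aut4P presJ eAM eBM eAA eAB eBA eBB.

(** If the bound [p^(8m)] is attained, the estimates for orbit and stabilizer in [card_Aut4_le] are
    both equalities, so the orbit of [A] is the whole coset [A *: 'Z_4(J)]. *)
Lemma trans_A : p ^ (8 * m) <= #|AutZ 4 J| ->
  forall g, g \in J -> eA g = 1%R -> eB g = 0%R -> exists2 t, t \in AutZ 4 J & t A = g.
Proof.
move=> le8 g gJ g1 g0.
have stab := card_stab_A presJ eAM eBM eAA eAB eBA eBB.
have cZ := card_Z4 presJ eAM eBM eAA eAB eBA eBB.
have sub : orbit 'P [group of AutZ 4 J] A \subset A *: 'Z_4(J).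
  apply/subsetP=> _ /imsetP[s s4 ->]; rewrite mem_lcoset -[('P)%act A s]/(s A).
  have [sA [a1 b0] _] := Aut4P' s s4.
  have sAJ : s A \in J by apply: Aut_closed.
  apply/Z4P'.
  by rewrite groupM ?groupV // eAM ?eBM ?groupV // (addV eAM) // (addV eBM) // a1 b0 eAA eBA oppr0 addNr addr0.
have orb : p ^ (5 * m) <= #|orbit 'P [group of AutZ 4 J] A|.
  rewrite -(@leq_pmul2r (p ^ (3 * m))) ?expn_gt0 ?prime_gt0 // -expnD.
  apply: leq_trans (leq_mul (leqnn _) stab); rewrite card_orbit_stab.
  by apply: leq_trans le8; rewrite leq_exp2l ?prime_gt1 //; lia.
have E : orbit 'P [group of AutZ 4 J] A = A *: 'Z_4(J).
  apply/eqP; rewrite eqEcard sub /= card_lcoset; exact: leq_trans orb.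
have : g \in orbit 'P [group of AutZ 4 J] A.
  rewrite E mem_lcoset; apply/Z4P'.
  by rewrite groupM ?groupV // eAM ?eBM ?groupV // (addV eAM) // (addV eBM) // g1 g0 eAA eBA oppr0 addNr addr0.
by case/imsetP=> t t4 ->; exists t.
Qed.

Lemma trans_pow : p ^ (8 * m) <= #|AutZ 4 J| ->
  forall g (i : R), g \in J -> g ^+ P = 1 -> i \is a GRing.unit ->
  eA g = ((i : nat)%:R)%R -> eB g = 0%R -> exists2 t, t \in AutZ 4 J & t (A ^^ i) = g.
Proof.
move=> le8 g i gJ gP iu Ei E0.
have n_gt1 : 1 < n := ltnW (n_gt2).
have hJ : g ^^ (i^-1)%R \in J by exact: zx_group.
have h1 : eA (g ^^ (i^-1)%R) = 1%R.
  rewrite /zx (addX eAM) // Ei -mulrnA; apply/(natZ_eq _ 1 n_gt1).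
  have : ((i * (i^-1)%R)%N%:R = 1%:R :> R)%R by rewrite natrM !natZ_val mulrV.
  move/(natZ_eq _ _ P_gt1) => E.
  have nP : n %| P by rewrite PE // dvdn_mull.
  by rewrite -(modn_dvdm _ nP) E modn_dvdm.
have h0 : eB (g ^^ (i^-1)%R) = 0%R by rewrite /zx (addX eBM) // E0 mul0rn.
have [t t4 tA] := trans_A le8 hJ h1 h0.
have tJ : t \in Aut J by case: (Aut4P' t t4).
exists t => //; rewrite (morphin_zx (autM tJ)) // tA -(zxM P_gt1) // mulVr //.
Qed.

End Transitive.

Section Automorphisms.

Variables (gT : finGroupType) (J : {group gT}) (A B : gT).
Hypothesis presJ : presented_by J [:: A; B] (J_rels p m (1 + l * n)).
Local Notation C := [~ A, B].
Let rels := pres_rels presJ.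
Let AP : A ^+ P = 1 := J_AP rels.
Let BP : B ^+ P = 1 := J_BP rels.
Let CP : C ^+ P = 1 := expC_P rels.
Let AJ : A \in J := memA presJ.
Let BJ : B \in J := memB presJ.
Let CJ : C \in J := memC presJ.
Variables (eA eB : gT -> 'Z_n).
Hypothesis eAM : {in J &, forall x y, eA (x * y) = (eA x + eA y)%R}.
Hypothesis eBM : {in J &, forall x y, eB (x * y) = (eB x + eB y)%R}.
Hypotheses (eAA : eA A = 1%R) (eAB : eA B = 0%R) (eBA : eB A = 0%R) (eBB : eB B = 1%R).
Let presS := pres_swap presJ.
Let genJ : <<[set A; B]>> = J := pres_gen presJ.
Let ACN := J_ANBN rels.
Let zJ c := A_nu_central presJ c.
Let Z4P' := Z4P presJ eAM eBM eAA eAB eBA eBB.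
Let Aut4P' := Aut4P presJ eAM eBM eAA eAB eBA eBB.

Lemma add_lin (e : gT -> 'Z_n) g : {in J &, forall x y, e (x * y) = (e x + e y)%R} ->
  g \in J -> e g = (e A * eA g + e B * eB g)%R.
Proof.
move=> eM; move: g.
apply: (add_ext presJ (e' := fun g => (e A * eA g + e B * eB g)%R)) => //.
- by move=> x y xJ yJ; rewrite eAM // eBM //; ring.
- by rewrite eAA eBA; ring.
- by rewrite eAB eBB; ring.
Qed.

(** The exponent sum matrices of [s] and [s^-1] are inverse to each other. *)
Lemma det_unit s : s \in Aut J ->
  (eA (s A) * eB (s B) - eB (s A) * eA (s B))%R \is a GRing.unit.
Proof.
move=> sJ; have vJ : s^-1 \in Aut J by rewrite groupV.
have vc g : g \in J -> s^-1 g \in J by move=> gJ; apply: Aut_closed.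
have EA g : g \in J -> eA (s g) = (eA (s A) * eA g + eA (s B) * eB g)%R.
  exact: (add_lin (e_aut eAM sJ)).
have EB g : g \in J -> eB (s g) = (eB (s A) * eA g + eB (s B) * eB g)%R.
  exact: (add_lin (e_aut eBM sJ)).
have := EA _ (vc A AJ); have := EB _ (vc A AJ); have := EA _ (vc B BJ); have := EB _ (vc B BJ).
rewrite !permKV eAA eAB eBA eBB => h1 h2 h3 h4.
have E : ((eA (s A) * eB (s B) - eB (s A) * eA (s B)) *
   (eA (s^-1 A) * eB (s^-1 B) - eB (s^-1 A) * eA (s^-1 B)) = 1)%R.
  transitivity ((eA (s A) * eA (s^-1 A) + eA (s B) * eB (s^-1 A)) *
      (eB (s A) * eA (s^-1 B) + eB (s B) * eB (s^-1 B)) -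
    (eA (s A) * eA (s^-1 B) + eA (s B) * eB (s^-1 B)) *
      (eB (s A) * eA (s^-1 A) + eB (s B) * eB (s^-1 A)))%R; first by ring.
  by rewrite -h1 -h2 -h3 -h4; ring.
by apply/unitrP; eexists; split; [rewrite mulrC | ]; exact: E.
Qed.

(** The pair [(s A, s B)] satisfies both relations; [rel_exponents], in [J] and with the generators
    exchanged, supplies the four equations of [exponents_unit]. *)
Lemma unit_case s : s \in Aut J -> eA (s A) \is a GRing.unit ->
  [/\ eB (s A) = 0, eA (s B) = 0 & eA (s A) * eB (s B) = 1]%R.
Proof.
move=> sJ Iu; have sM := autM sJ.
have XJ : s A \in J by apply: Aut_closed.
have YJ : s B \in J by apply: Aut_closed.
have rX : s A ^ [~ s A, s B] = s A ^+ (1 + l * n).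
  have [r _ _ _] := rels.
  by rewrite -(morphinX sM) // -r (morphinJ sM) // (morphinR sM).
have rY : s B ^ [~ s B, s A] = s B ^+ (1 + l * n).
  have [_ r _ _] := rels.
  by rewrite -(morphinX sM) // -r (morphinJ sM) ?groupR // (morphinR sM).
have relA := rel_exponents presJ eAM eBM eAA eAB eBA eBB.
have relB := rel_exponents presS eBM eAM eBB eBA eAB eAA.
apply: (exponents_unit (p_third) Iu (det_unit sJ)).
- exact: relA.
- exact: relB.
- exact: relA.
- exact: relB.
Qed.

Section AutClass.

Hypothesis le8 : p ^ (8 * m) <= #|AutZ 4 J|.
Hypothesis fixZ : forall t, t \in AutZ 4 J -> t (A ^^ nu) = A ^^ nu.

Lemma val_unit (x : 'Z_n) : x \is a GRing.unit -> (((x : nat)%:R : R)%R \is a GRing.unit).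
Proof.
move=> xu; apply: unit_coprime => //; move: xu; rewrite -{1}(natZ_val x) unitZpE ?n_gt1 //.
by rewrite coprime_pexpl.
Qed.

Lemma val_natR (x : 'Z_n) : (((((x : nat)%:R : R)%R : nat)%:R)%R : 'Z_n) = x.
Proof.
rewrite -[RHS](natZ_val x); apply/(natZ_eq _ _ n_gt1); rewrite val_Zp_nat ?P_gt1 //.
by rewrite modn_dvdm // PE // dvdn_mull.
Qed.

(** Up to [AutZ 4 J], which fixes [A ^^ nu], [s] raises [A] and [B] to powers [i] and [q]. As
    [B ^^ nu] is the inverse of [A ^^ nu], these powers agree modulo [n]. *)
Lemma diag_eq s : s \in Aut J -> eA (s A) \is a GRing.unit -> eA (s A) = eB (s B).
Proof.
move=> sJ Iu; have [J0 R0 IQ] := unit_case sJ Iu; have sM := autM sJ.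
have Qu : eB (s B) \is a GRing.unit by apply/unitrP; exists (eA (s A)); rewrite (mulrC (eB _)) IQ; split.
set i : R := (((eA (s A) : nat)%:R)%R : R); set q : R := (((eB (s B) : nat)%:R)%R : R).
have sAP : s A ^+ P = 1 by rewrite -(morphinX sM) // AP (morphin1 sM).
have sBP : s B ^+ P = 1 by rewrite -(morphinX sM) // BP (morphin1 sM).
have [t t4 tA] : exists2 t, t \in AutZ 4 J & t (A ^^ i) = s A.
  apply: (trans_pow presJ eAM eBM eAA eAB eBA eBB le8) => //.
  - by apply: Aut_closed.
  - exact: val_unit.
  - by rewrite val_natR.
have [t' t4' tB] : exists2 t, t \in AutZ 4 J & t (B ^^ q) = s B.
  apply: (trans_pow presS eBM eAM eBB eBA eAB eAA le8) => //.
  - by apply: Aut_closed.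
  - exact: val_unit.
  - by rewrite val_natR.
have tJ : t \in Aut J by case: (Aut4P' t t4).
have tJ' : t' \in Aut J by case: (Aut4P' t' t4').
have BnuE : B ^^ nu = A ^^ (- nu)%R by have := ACN 1%R; rewrite mulr1.
have sA_nu : s (A ^^ nu) = A ^^ (nu * i)%R.
  rewrite (morphin_zx sM) // -tA -(morphin_zx (autM tJ)) ?zx_group //.
  by rewrite zxMC (morphin_zx (autM tJ)) ?zx_group // fixZ // -(zxM P_gt1).
have sB_nu : s (B ^^ nu) = A ^^ (- nu * q)%R.
  rewrite (morphin_zx sM) // -tB -(morphin_zx (autM tJ')) ?zx_group //.
  rewrite zxMC (morphin_zx (autM tJ')) ?zx_group // BnuE !(zxN P_gt1) // (morphinV (autM tJ')) ?zx_group // fixZ // mulNr (zxN P_gt1) // (zxM P_gt1) //.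
  by rewrite /zx expVgn.
have E : (nu * i = nu * q)%R.
  apply/eqP; rewrite -subr_eq0; apply/eqP; apply: (A_eq1 presJ).
  rewrite (zxD P_gt1) // -sA_nu -mulNr -sB_nu BnuE (zxN P_gt1) // (morphinV sM) ?zx_group //.
  by rewrite mulgV.
rewrite -(natZ_val (eA (s A))) -(natZ_val (eB (s B))); apply/(natZ_eq _ _ n_gt1).
by apply/(@nuE).
Qed.

(** The relation for [A] would give [A ^ Y = C^-1 * A ^^ (1 - u)]. Comparison with [conjA_form]
    makes the exponent [k] of [C] equal to -1 modulo [nu] and [k - gs k] a multiple of [nu]. At
    [k = -1] that difference is [eps] modulo [nu], so [n] would divide [l]. *)
Lemma no_inversion s : s \in Aut J -> s A != A^-1.
Proof.
move=> sJ; apply/eqP=> sA; have sM := autM sJ; set Y := s B.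
have YJ : Y \in J by apply: Aut_closed.
have sC : s C = [~ A^-1, Y] by rewrite (morphinR sM) // sA.
have EJ : [~ A^-1, Y] \in J by rewrite groupR ?groupV.
have rel : A ^ [~ A^-1, Y] = A ^ C.
  have := congr1 s (J_AC rels).
  rewrite (morphinJ sM) // (morphin_zx sM) // sC sA conjVg (zxV P_gt1) // (zxN P_gt1) //.
  by move/invg_inj => ->; rewrite (J_AC rels).
have mem : [~ A^-1, Y] * C^-1 \in J by rewrite groupM ?groupV.
have com : commute ([~ A^-1, Y] * C^-1) A.
  by apply: commute_sym; apply/commgP/conjg_fixP; rewrite conjgM rel conjgK.
have [u Eu] := centA presJ mem com.
have AY : A ^ Y = C ^^ (- 1 : R)%R * A ^^ (1 - u)%R.
  have EE : A * (A ^ Y)^-1 = A ^^ u * C.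
    by rewrite -Eu mulgKV commgEl invgK conjVg.
  have -> : A ^ Y = (A^-1 * (A ^^ u * C))^-1 by rewrite -EE mulKg invgK.
  have -> : C ^^ (- 1 : R)%R = C^-1 by rewrite (zxN P_gt1) // (zx1 P_gt1).
  have -> : A ^^ (1 - u)%R = (A ^^ u)^-1 * A.
    by rewrite addrC (zxD P_gt1) // (zxN P_gt1) // (zx1 P_gt1).
  by rewrite 2!invMg invgK mulgA.
have [k [t Ef]] := conjA_form presJ YJ.
have SP : [~ B, A] ^+ P = 1 by rewrite -invgR expgVn CP invg1.
have Cs (e : R) : C ^^ e = [~ B, A] ^^ (- e)%R by rewrite (zx_CV presJ) // opprK.
have := Ef; rewrite AY (zx_swap _ _ AP (J_AC rels)) !Cs => E2.
have [|c [z [E3 E4 E5]]] := @nf_inj gT J B A presS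
  (- -1 : R)%R (1 - u)%R 0%R (- k)%R (al ^+ (t : nat) * al ^+ (k : nat))%R 
  ((k - gs k) * ai ^+ (t : nat))%R.
  by rewrite E2 zx0 mulg1.
have Ek : k = (-1 + nu * c)%R by rewrite -E3; ring.
have alt : (ai ^+ (t : nat) * al ^+ (t : nat) = 1)%R by rewrite -exprMn mulrC alai // expr1n.
have Es : (k - gs k = nu * (- z * al ^+ (t : nat)))%R.
  transitivity ((k - gs k) * (ai ^+ (t : nat) * al ^+ (t : nat)))%R; first by rewrite alt mulr1.
  have E6 : ((k - gs k) * ai ^+ (t : nat) = - (nu * z))%R by rewrite -E5; ring.
  by rewrite mulrA E6; ring.
rewrite gsE // natZ_val bin2_half // natZ_val in Es.
have nk : (nu * kap = 0)%R by rewrite /kap mulrBr expr2 mulrA nu_eps // mul0r subr0.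
have : (nn * l%:R = nu * ((- z * al ^+ (t : nat)) + ('C(k, 3))%:R * (l ^ 2)%:R + (l ^ 2)%:R) :> R)%R.
  rewrite -(eps_nn) !mulrDr -Es (mulrCA nu) -eps2.
  transitivity (2 * hlf * kap + eps ^+ 2 + (hlf * c * (nu * c - 3)) * (nu * kap))%R.
    by rewrite half2 // nk /kap; ring.
  by rewrite {3 4}Ek; ring.
move/(nn_nu_dvd) => nl.
by case/negP: p'l; apply: dvdn_trans nl; apply: dvdn_exp.
Qed.

Let n0 : (n%:R = 0 :> 'Z_n)%R.
Proof. by apply/(natZ_eq _ 0 n_gt1); rewrite modnn mod0n. Qed.

(** The common diagonal entry has square 1, so it is 1 or -1. If it is -1, [trans_A] provides [t] in
    [AutZ 4 J] with [t A = (s A)^-1], and [s * t^-1] inverts [A]. *)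
Lemma unit_Aut4 s : s \in Aut J -> eA (s A) \is a GRing.unit -> s \in AutZ 4 J.
Proof.
move=> sJ Iu; have [J0 R0 IQ] := unit_case sJ Iu; have QI := diag_eq sJ Iu.
have sAJ : s A \in J by apply: Aut_closed.
have two_cases : ((eA (s A) - 1) * (eA (s A) + 1) = 0)%R.
  by transitivity (eA (s A) * eA (s A) - 1)%R; [ring | rewrite {2}QI IQ subrr].
have [u1 | [y1 E1]] := unit_or_p (eA (s A) - 1)%R.
  have Im1 : eA (s A) = (- 1)%R.
    by apply/eqP; rewrite -[X in _ == X]add0r -subr_eq opprK -(mulrI_eq0 _ (mulrI u1)) two_cases.
  have [t t4 tA] : exists2 t, t \in AutZ 4 J & t A = (s A)^-1.
    apply: (trans_A presJ eAM eBM eAA eAB eBA eBB le8).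
    - by rewrite groupV.
    - by rewrite (addV eAM) // Im1 opprK.
    - by rewrite (addV eBM) // J0 oppr0.
  have tJ : t \in Aut J by case: (Aut4P' t t4).
  have tJ' : t^-1 \in Aut J by rewrite groupV.
  have stJ : s * t^-1 \in Aut J by rewrite groupM.
  case/eqP: (no_inversion stJ).
  by rewrite permM -[s A]invgK -tA (morphinV (autM tJ')) ?Aut_closed // permK.
have [u2 | [y2 E2]] := unit_or_p (eA (s A) + 1)%R.
  have I1 : eA (s A) = 1%R.
    by apply/eqP; rewrite -subr_eq0 -(mulIr_eq0 _ (mulIr u2)) two_cases.
  by apply/Aut4P'; split=> //; split=> //; rewrite -QI.
(* Here [p] would divide both the entry minus one and the entry plus one, hence the unit 2. *)
have E3 : (2 = p%:R * (y2 - y1) :> 'Z_n)%R by rewrite mulrBr -E1 -E2; ring.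
have := unitrX m (Zn_unit2).
by rewrite E3 exprMn -natrX n0 mul0r unitr0.
Qed.

Lemma swap_aut : exists2 w, w \in Aut J & w A = B /\ w B = A.
Proof.
have [f [fM fA fB]] := pres_map presJ (pres_rels presS).
have fJ g : g \in J -> f g \in J /\ f (f g) = g.
  rewrite -{1}genJ; move: g; apply: gen_ind; first by rewrite !(morphin1 fM).
  rewrite genJ => g y gJ yAB [fgJ ffg].
  have [yJ fyJ ffy] : [/\ y \in J, f y \in J & f (f y) = y].
    by case/set2P: yAB => ->; rewrite ?fA ?fB ?fA.
  by rewrite (fM g) // (fM (f g)) // groupM // ffg ffy.
have injf : 'injm (Morphism fM).
  by apply/injmP => g h gJ hJ /= E; rewrite -(fJ g gJ).2 E (fJ h hJ).2.
have imf : Morphism fM @* J = J.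
  apply/eqP; rewrite eqEcard card_injm // leqnn andbT.
  by apply/subsetP => _ /morphimP[g _ gJ ->]; apply: (fJ g gJ).1.
exists (aut injf imf); first exact: Aut_aut.
by rewrite !autE //= fA fB.
Qed.

(** Since the determinant is a unit, [eA (s A)] or [eA (s B)] is one; in the second case [unit_Aut4]
    applies after composing with the exchange [w] of the generators. *)
Lemma index2 : #|Aut J : AutZ 4 J| = 2.
Proof.
have subA : AutZ 4 J \subset Aut J by apply/subsetP=> s /setIdP[].
have [w wJ [wA wB]] := swap_aut.
have wN : w \notin AutZ 4 J.
  apply/negP => /Aut4P'[_ [+ _] _]; rewrite wA eAB => /eqP.
  by rewrite eq_sym oner_eq0.
have cover s : s \in Aut J -> s \in AutZ 4 J \/ w * s \in AutZ 4 J.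
  move=> sJ; have wsJ : w * s \in Aut J by rewrite groupM.
  have [u1 | [y1 E1]] := unit_or_p (eA (s A)).
    by left; apply: unit_Aut4.
  have [u2 | [y2 E2]] := unit_or_p (eA (s B)).
    by right; apply: unit_Aut4; rewrite // permM wA.
  have := unitrX m (det_unit sJ); rewrite E1 E2.
  have -> : (p%:R * y1 * eB (s B) - eB (s A) * (p%:R * y2) =
    p%:R * (y1 * eB (s B) - eB (s A) * y2) :> 'Z_n)%R by ring.
  by rewrite exprMn -natrX n0 mul0r unitr0.
apply/eqP; rewrite eqn_leq; apply/andP; split; last first.
  by rewrite indexg_gt1; apply/negP => /subsetP/(_ w wJ); apply/negP.
rewrite -divgS // leq_divLR ?cardSg //.
have -> : (2 * #|AutZ 4 J| = #|AutZ 4 J| + #|w^-1 *: AutZ 4 J|)%N.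
  by rewrite card_lcoset mul2n addnn.
apply: leq_trans (leq_card_setU _ _); apply/subset_leq_card/subsetP => s /cover[sM | sM].
  by rewrite inE sM.
by rewrite inE mem_lcoset invgK sM orbT.
Qed.

End AutClass.

(** * Order and generators of [AutZ 4 J] *)

Section AutOrder.

Variables (x D : {perm gT}).
Hypotheses (xJ : x \in Aut J) (DJ : D \in Aut J).
Hypotheses (xA : x A = A * A ^^ nu) (xB : x B = B * A ^^ (- nu)%R).
Hypotheses (DA : D A = A * B ^^ nn) (DB : D B = B * B ^^ (nn * (d - 2))%R * A ^^ nn).
Variables U W : R.
Hypothesis EU : (nu * (l%:R * U + W) = - nu)%R.
Hypothesis EW : (nu * (l%:R * U - W) = nu * (3 - d))%R.

Local Notation cj := (conj_aut J).
Local Notation I := (cj @* J)%G.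

Let cjI g : g \in J -> cj g \in I.
Proof. by move=> gJ; apply: mem_morphim => //; apply: (subsetP (normG J)). Qed.

Lemma InnP s : reflect (exists2 g, g \in J & s = cj g) (s \in cj @* J).
Proof.
apply: (iffP morphimP) => [[g _ gJ ->] | [g gJ ->]]; first by exists g.
by exists g => //; apply: (subsetP (normG J)).
Qed.

(** The inner automorphisms form [J] modulo its centre, and the centre has at most [n] elements. *)
Lemma card_Inn : p ^ (6 * m) <= #|cj @* J|.
Proof.
have cZ : #|'Z(J)| <= n.
  rewrite -[X in _ <= X]card_ord.
  apply: (leq_trans _ (leq_imset_card (fun r : 'I_n => A ^^ (nu * r%:R)%R) 'I_n)).
  apply/subset_leq_card/subsetP => g.
  move=> /(centerE presJ) [c ->].
  have [r rn ->] := nu_cancel c.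
  by apply/imsetP; exists (Ordinal rn).
have Zle : (p ^ (7 * m) = p ^ (6 * m) * n)%N by rewrite -expnD; congr (_ ^ _)%N; lia.
rewrite -(leq_pmul2r n_gt0) -Zle -(card_J presJ).
apply: leq_trans (leq_mul (leqnn _) cZ).
rewrite card_morphim (setIidPr (normG J)) ker_conj_aut.
by rewrite mulnC LagrangeI.
Qed.

Lemma Aut_normI s : s \in Aut J -> s \in 'N(cj @* J).
Proof.
move=> sJ; rewrite inE; apply/subsetP => _ /imsetP[_ /InnP[g gJ ->] ->].
by rewrite conj_autJ // cjI // Aut_closed.
Qed.

Local Notation K1 := (I <*> <[x]>)%G.
Local Notation K := (K1 <*> <[D]>)%G.

Lemma D_normK1 : D \in 'N(K1).
Proof.
rewrite -cycle_subG normsY // cycle_subG ?Aut_normI //.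
apply: (subsetP (cent_sub _)); rewrite cent_cycle; apply/cent1P.
by apply/esym/commgP/conjg_fixP; apply: (xD_comm presJ).
Qed.

Lemma xn_I : x ^+ n \in I.
Proof. by rewrite (x_order presJ xJ xA xB) group1. Qed.

Lemma x_min k : x ^+ k \in I -> n %| k.
Proof.
by case/InnP=> g gJ E; apply: (x_Inn presJ xJ xA xB gJ E).
Qed.

Lemma Dn_K1 : D ^+ n \in K1.
Proof.
rewrite (D_n presJ xJ DJ xA xB DA DB EU EW) groupM //.
  by rewrite (subsetP (joing_subl _ _)) // cjI // zx_group.
by rewrite (subsetP (joing_subr _ _)) // mem_cycle.
Qed.

Lemma D_min k : D ^+ k \in K1 -> n %| k.
Proof.
case/(cycextP (Aut_normI xJ)) => _ /InnP[g gJ ->] [v E].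
exact: (D_Inn presJ xJ DJ xA DA DB gJ E).
Qed.

Lemma card_K : p ^ (8 * m) <= #|K|.
Proof.
have -> : (p ^ (8 * m) = n * (n * p ^ (6 * m)))%N by rewrite -!expnD; congr (_ ^ _)%N; lia.
apply: leq_trans (card_cycext D_normK1 D_min).
rewrite leq_mul2l; apply/orP; right.
apply: leq_trans (card_cycext (Aut_normI xJ) x_min).
by rewrite leq_mul2l card_Inn orbT.
Qed.

Lemma sub_K : K \subset AutZ 4 J.
Proof.
have eX (e : gT -> 'Z_n) g (u : R) : {in J &, forall x y, e (x * y) = (e x + e y)%R} ->
    g \in J -> e (g ^^ (nn * u)%R) = 0%R.
  move=> eM gJ; rewrite /zx (addX eM) // -[LHS]mulr_natr (dvd_nn).
  exact: mulr0.
have nuE' : nu = (nn * nn)%R by rewrite nnE.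
rewrite !join_subG !cycle_subG; apply/andP; split; first (apply/andP; split).
- apply/subsetP => _ /InnP[g gJ ->]; apply/Aut4P'; split; first exact: conj_aut_Aut.
    by rewrite conj_autE // (addJ eAM) // (addJ eBM).
  by rewrite conj_autE // (addJ eAM) // (addJ eBM).
- apply/Aut4P'; split=> //; rewrite ?xA ?xB !eAM ?eBM ?zx_group // nuE' -?mulrN !eX // ?addr0 //.
apply/Aut4P'; rewrite DA DB !eAM ?eBM ?groupM ?zx_group // -(mulr1 nn) -?mulrA !eX // !addr0 //.
Qed.

(** [K] lies in [AutZ 4 J], and the lower bound [card_K] equals the upper bound [card_Aut4_le]. *)
Lemma Aut4_K : AutZ 4 J = K.
Proof.
apply/esym/eqP; rewrite eqEcard sub_K.
apply: leq_trans card_K.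
exact: (card_Aut4_le presJ eAM eBM eAA eAB eBA eBB).
Qed.

Lemma Aut4_fix_nu t : t \in AutZ 4 J -> t (A ^^ nu) = A ^^ nu.
Proof.
rewrite Aut4_K => tK.
suff : K \subset 'C[A ^^ nu | 'P] by move/subsetP/(_ t tK)/astab1P.
rewrite !join_subG !cycle_subG; apply/andP; split; first (apply/andP; split).
- apply/subsetP => _ /InnP[g gJ ->]; apply/astab1P; rewrite /= apermE conj_autE ?zx_group //.
  by have := zJ 1%R gJ; rewrite mulr1 => /commgP/conjg_fixP.
- apply/astab1P; rewrite /= apermE; have := x_nu presJ xJ xA 1%R.
  by rewrite mulr1.
apply/astab1P; rewrite /= apermE; have := D_nu presJ DJ DA 1%R.
by rewrite mulr1.
Qed.

Lemma card_Aut4 : #|AutZ 4 J| = (p ^ (8 * m))%N.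
Proof.
apply/eqP; rewrite eqn_leq {2}Aut4_K card_K andbT.
exact: (card_Aut4_le presJ eAM eBM eAA eAB eBA eBB).
Qed.

Lemma index_Aut4 : #|Aut J : AutZ 4 J| = 2.
Proof.
apply: (index2).
  by rewrite card_Aut4.
exact: Aut4_fix_nu.
Qed.

(** * The universal property of the presentation *)

Section UniversalProperty.

Variables (T : groupType) (a b x' D' : T).
Local Notation q := (1 + l * n)%N.
Hypotheses (rab : a ^ [~ a, b] = a ^+ q) (rba : b ^ [~ b, a] = b ^+ q).
Hypotheses (aN : a ^+ N = 1) (bN : b ^+ N = 1).
Hypotheses (xn : x' ^+ n = 1) (axC : a ^ x' = a) (bxC : b ^ x' = b).
Hypotheses (aD : a ^ D' = a * b ^^ nn) (bD : b ^ D' = b * b ^^ (nn * (d - 2))%R * a ^^ nn).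
Hypotheses (xD : x' ^ D' = x') (DnE : D' ^+ n = [~ a, b] ^^ (nn * U)%R * x' ^^ W).

Lemma hom_ext (f g : gT -> T) : {in J &, {morph f : y z / y * z}} ->
  {in J &, {morph g : y z / y * z}} -> f A = g A -> f B = g B -> {in J, f =1 g}.
Proof.
move=> fM gM EA EB y; rewrite -{1}genJ; move: y; apply: gen_ind.
  by rewrite (morphin1 fM) (morphin1 gM).
rewrite genJ => y z yJ zAB E.
have zJ' : z \in J by rewrite -genJ mem_gen.
by rewrite fM // gM // E; case/set2P: zAB => ->; rewrite ?EA ?EB.
Qed.

(** As [a ^+ N = 1], the homomorphism [f] from [J] kills the centre, so it factors through the inner
    automorphisms as [phi]. *)
Lemma Inn_map : exists f : gT -> T, exists phi : {perm gT} -> T,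
  [/\ {in J &, {morph f : y z / y * z}}, f A = a /\ f B = b,
      (forall c, f (A ^^ (nu * c)%R) = 1), {in J, forall g, phi (cj g) = f g} &
      {in I &, {morph phi : y z / y * z}}].
Proof.
have NP : N %| P by apply: dvdn_exp2l; rewrite leq_mul2r orbT.
have aP : a ^+ P = 1 by apply/eqP; case/dvdnP: NP => k ->; rewrite mulnC expgnA aN expg1n.
have bP : b ^+ P = 1 by apply/eqP; case/dvdnP: NP => k ->; rewrite mulnC expgnA bN expg1n.
have [|f [fM fA fB]] := pres_map presJ (a := a) (b := b); first by [].
have fnu c : f (A ^^ (nu * c)%R) = 1.
  by rewrite (morphin_zx fM) // fA (zxM P_gt1) // (zx_nat P_gt1) // aN /zx expg1n.
have fE g h : g \in J -> h \in J -> cj g = cj h -> f g = f h.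
  move=> gJ hJ E; have ghJ : g * h^-1 \in J by rewrite groupM ?groupV.
  have : g * h^-1 \in 'Z(J).
    apply/centerP; split=> // y yJ; apply/commute_sym/commgP/conjg_fixP.
    have Eg : cj g y = y ^ g by rewrite conj_autE.
    by rewrite conjgM -Eg E conj_autE // conjgK.
  move=> /(centerE presJ) [c Ec].
  by rewrite -(mulgKV h g) Ec (fM _ h) ?zx_group // fnu mul1g.
pose phi s := if [pick g in J | cj g == s] is Some g then f g else 1.
have phiE : {in J, forall g, phi (cj g) = f g}.
  move=> g gJ; rewrite /phi; case: pickP => [h /andP[hJ /eqP E] | /(_ g)]; first exact: fE.
  by rewrite gJ eqxx.
exists f, phi; split=> // _ _ /InnP[g gJ ->] /InnP[h hJ ->].
by rewrite -conj_autM // !phiE ?groupM // fM.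
Qed.

(** [phi] is extended by [cycext_map] first to [x], then to [D]. The compatibility with conjugation
    is checked on [A] and [B], and that with [n]-th powers is the relation for [x' ^+ n] or
    [D' ^+ n]. *)
Lemma Aut4_map : exists f : {perm gT} -> T,
  {in AutZ 4 J &, {morph f : y z / y * z}} /\ [/\ f (cj A) = a, f (cj B) = b, f x = x' & f D = D'].
Proof.
have [f [phi [fM [fA fB] fnu phiE phiM]]] := Inn_map.
have phiJ (s : {perm gT}) (t : T) : s \in Aut J -> f (s A) = a ^ t -> f (s B) = b ^ t ->
    {in I, forall h, phi (h ^ s) = phi h ^ t}.
  move=> sJ EA EB _ /InnP[g gJ ->].
  rewrite conj_autJ // !phiE ?Aut_closed //; move: g gJ.
  apply: (hom_ext (f := f \o s) (g := fun g => f g ^ t)).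
  - by move=> g h gJ hJ /=; rewrite (autM sJ) // fM ?Aut_closed.
  - by move=> g h gJ hJ /=; rewrite fM // conjMg.
  - by rewrite /= EA fA.
  - by rewrite /= EB fB.
have nuN c : f (A ^^ (- (nu * c))%R) = 1 by rewrite -mulrN.
have fxA : f (x A) = a ^ x'.
  by rewrite xA fM ?zx_group // fA -[nu]mulr1 fnu mulg1 axC.
have fxB : f (x B) = b ^ x'.
  by rewrite xB fM ?zx_group // fB -[nu]mulr1 nuN mulg1 bxC.
have fDA : f (D A) = a ^ D' by rewrite DA fM ?zx_group // (morphin_zx fM) // fA fB aD.
have fDB : f (D B) = b ^ D'.
  by rewrite DB !fM ?groupM ?zx_group // !(morphin_zx fM) // fA fB bD.
have xord := x_order presJ xJ xA xB.
have [|phi1 [phi1M phi1E phi1x]] := cycext_map n_gt0 (Aut_normI xJ)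
  (xn_I)
  (x_min) phiM (phiJ x x' xJ fxA fxB).
  by rewrite xord xn (morphin1 phiM).
have DK : D \in 'N(K1) := D_normK1.
have DnK := Dn_K1.
have IK1 h : h \in I -> h \in K1 by apply/subsetP/joing_subl.
have xK1 : x \in K1 by apply: (subsetP (joing_subr _ _)); apply: cycle_id.
have xDc := xD_comm presJ xJ DJ xA xB DA DB.
have phi1J : {in K1, forall h, phi1 (h ^ D) = phi1 h ^ D'}.
  move=> _ /(cycextP (Aut_normI xJ)) [h hI [k ->]].
  have hDI : h ^ D \in I by rewrite memJ_norm // Aut_normI.
  have xkK : x ^+ k \in K1 by rewrite groupX.
  rewrite conjMg conjXg xDc (phi1M _ _ (IK1 _ hDI) xkK) (phi1M _ _ (IK1 _ hI) xkK).
  rewrite (phi1E _ hDI) (phi1E _ hI) (phiJ D D') //.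
  by rewrite !(morphinX phi1M) // phi1x conjMg conjXg xD.
have phi1X : phi1 (D ^+ n) = D' ^+ n.
  rewrite (D_n presJ xJ DJ xA xB DA DB EU EW) DnE.
  have CI : cj (C ^^ (nn * U)%R) \in I by rewrite cjI ?zx_group.
  rewrite phi1M ?zx_group // ?IK1 // phi1E // phiE ?zx_group // !(morphin_zx fM) //.
  by rewrite (morphin_zx phi1M) // phi1x (morphinR fM) // fA fB.
have [f2 [f2M f2E f2D]] := cycext_map n_gt0 DK DnK
  (D_min) phi1M phi1J phi1X.
exists f2; split.
  rewrite (Aut4_K).
  exact: f2M.
have f2cj g : g \in J -> f2 (cj g) = f g by move=> gJ; rewrite f2E ?IK1 ?cjI // phi1E ?cjI // phiE.
by split=> //; rewrite ?f2cj // f2E.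
Qed.

End UniversalProperty.

End AutOrder.

End Automorphisms.

(** * The parameters [u] and [v] *)

Section UVParameters.

Lemma nu_int (a b : int) : (a = b %[mod n%:Z])%Z -> (nu * a%:~R = nu * b%:~R :> R)%R.
Proof.
move/eqP; rewrite eqz_mod_dvd => /dvdzP[k E].
apply/eqP; rewrite -subr_eq0 -mulrBr -rmorphB /= E rmorphM /= mulrCA -pmulrn.
suff -> : (nu * n%:R = 0 :> R)%R by rewrite mulr0.
rewrite /nu -natrM; apply/(natZ_eq _ 0 P_gt1); rewrite mod0n.
by apply/eqP; rewrite -expnD addnC -mulSn; apply: dvdnn.
Qed.

Lemma zexpg_zx q (T : groupType) (y : T) (z : int) : 1 < q -> y ^+ q = 1 ->
  zexpg y z = y ^^ (z%:~R : 'Z_q)%R.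
Proof.
move=> q1 yq; case: z => k /=; first by rewrite -pmulrn zx_nat.
by rewrite NegzE rmorphN /= -pmulrn (zxN q1) // zx_nat.
Qed.

Lemma Delta_snd_zx (T : groupType) (y z : T) : y ^+ (p ^ (3 * m)) = 1 -> z ^+ (p ^ (3 * m)) = 1 ->
  Delta_snd p m l y z =
  y * y ^^ (n%:R * ((third * l)%:R - 2) : R)%R * z ^^ (n%:R : R)%R.
Proof.
move=> yP zP; rewrite /Delta_snd (zexpg_zx _ P_gt1) // (zx_nat P_gt1) //.
congr (_ * y ^^ _ * _); rewrite dparE rmorphM rmorphN rmorphB /= -!pmulrn; ring.
Qed.

Lemma uv_exists : exists u v : int, uv_spec p m l u v.
Proof.
have [k [w E]] : exists k w : int, (k * l%:Z + w * n%:Z = 1)%R.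
  have [k [w E]] := Bezoutz l%:Z n%:Z; exists k, w; rewrite E /gcdz /=.
  by congr (Posz _); apply/eqP; rewrite -/(coprime l n) coprimeXr // coprime_sym prime_coprime.
have [h Eh] : exists h : int, (h * 2 = 1 + n%:Z)%R.
  by exists (Posz (n.+1)./2); rewrite -PoszM muln2 halfK /= n_odd // subn0.
set d := ((dpar p m l)%:Z)%R.
have kl : (k * l%:Z = 1 - w * n%:Z)%R by rewrite -E; ring.
(* With [k] inverse to [l] and [h] inverse to 2 modulo [n], these solve [u * l = (2 - d) / 2] and
   [v = (d - 4) / 2], the half sum and half difference of the congruences. *)
exists (k * h * (2 - d))%R, (h * (d - 4))%R; split; apply/eqP; rewrite eqz_mod_dvd -/d; apply/dvdzP.
  exists (1 + w * h * (2 - d))%R.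
  transitivity (- 1 - ((k * l%:Z) * h * (2 - d) + h * (d - 4)))%R; first by ring.
  rewrite kl; transitivity (- 1 + h * 2 + w * n%:Z * h * (2 - d))%R; first by ring.
  by rewrite Eh; ring.
exists (w * h * (2 - d) - (3 - d))%R.
transitivity (3 - d - ((k * l%:Z) * h * (2 - d) - h * (d - 4)))%R; first by ring.
rewrite kl; transitivity ((3 - d) * (1 - h * 2) + w * n%:Z * h * (2 - d))%R; first by ring.
by rewrite Eh; ring.
Qed.

(** The linear system has determinant [- 2 * l], prime to [n]. *)
Lemma uv_unique (u v u' v' : int) : uv_spec p m l u v -> uv_spec p m l u' v' ->
  (u = u' %[mod n%:Z])%Z /\ (v = v' %[mod n%:Z])%Z.
Proof.
move=> [/eqP + /eqP +] [/eqP + /eqP +]; rewrite !eqz_mod_dvd.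
move=> H1 H2 H3 H4.
have c2 : coprimez n%:Z 2 by rewrite coprimezE /= coprime_sym coprime2n n_odd.
have cl : coprimez n%:Z l%:Z by rewrite coprimezE /= coprimeXl // prime_coprime.
split; apply/eqP; rewrite eqz_mod_dvd.
  rewrite -(Gauss_dvdzr _ cl) -(Gauss_dvdzr _ c2).
  have -> : (2 * (l%:Z * (u - u')) = 
   (- 1 - (u' * l%:Z + v') + (3 - (dpar p m l)%:Z - (u' * l%:Z - v'))) - (- 1 - (u * l%:Z + v) + (3 - (dpar p m l)%:Z - (u * l%:Z - v))))%R by ring.
  by rewrite rpredB // rpredD.
rewrite -(Gauss_dvdzr _ c2).
have -> : (2 * (v - v') = (- 1 - (u' * l%:Z + v') - (3 - (dpar p m l)%:Z - (u' * l%:Z - v'))) - (- 1 - (u * l%:Z + v) - (3 - (dpar p m l)%:Z - (u * l%:Z - v))))%R by ring.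
by apply: rpredB; apply: rpredB.
Qed.
End UVParameters.

End MacdonaldGroup.

(** * Order, index and presentation of [AutZ 4 J] *)

Theorem theorem4p6 (p m l alpha : nat)
    (p_prime : prime p) (p_odd : odd p) (m_ge1 : 1 <= m) (alpha_gt1 : 1 < alpha)
    (v_alpha : logn p (alpha - 1) = m)
    (alphaE : alpha = (1 + l * p ^ m)%N)
    (case3 : p = 3 -> m = 1%N -> (alpha - 1) %/ 3 = 1 %[mod 3])
    (gT : finGroupType) (J : {group gT}) (A B : gT)
    (presJ : presented_by J [:: A; B] (J_rels p m alpha))
    (x Delta : {perm gT})
    (x_aut : x \in Aut J)
    (xA : x A = A * A ^+ (p ^ (2 * m)))
    (xB : x B = B * A ^- (p ^ (2 * m)))
    (Delta_aut : Delta \in Aut J)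
    (DeltaA : Delta A = A * B ^+ (p ^ m))
    (DeltaB : Delta B = Delta_snd p m l B A) :
  let a := conj_aut J A in
  let b := conj_aut J B in
  [/\ AutZ 4 J <| Aut J,
      p.-Sylow(Aut J) (AutZ 4 J),
      #|AutZ 4 J| = (p ^ (8 * m))%N
    & #|Aut J : AutZ 4 J| = 2]
  /\ (exists u v : int, uv_spec p m l u v)
  /\ (forall u v u' v' : int, uv_spec p m l u v -> uv_spec p m l u' v' ->
        (u = u' %[mod (p ^ m)%N%:Z])%Z /\ (v = v' %[mod (p ^ m)%N%:Z])%Z)
  /\ (forall u v : int, uv_spec p m l u v ->
        presented_by (AutZ 4 J) [:: a; b; x; Delta] (Aut4_rels p m l alpha u v)).
Proof.
move=> a b; subst alpha.
have a1 : (1 + l * p ^ m - 1 = l * p ^ m)%N by rewrite addKn.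
have p'l : ~~ (p %| l)%N.
  have l0 : 0 < l by move: alpha_gt1; case: (l).
  have pm0 : 0 < p ^ m by rewrite expn_gt0 prime_gt0.
  apply/negP => pl; move: v_alpha; rewrite a1 (lognM p l0 pm0) pfactorK //.
  have : 0 < logn p l by rewrite logn_gt0 mem_primes p_prime l0.
  lia.
have case3' : p = 3 -> m = 1%N -> l = 1 %[mod 3].
  by move=> p3 m1; rewrite -(case3 p3 m1) a1 p3 m1 mulnK.
have rels := pres_rels presJ.
have Pgt1 := P_gt1 p_prime p_odd m_ge1.
have AP := J_AP rels; have BP := J_BP rels.
have CP := expC_P p_prime p_odd m_ge1 p'l case3' rels.
have AJ := memA presJ; have BJ := memB presJ; have CJ := memC presJ.
have genJ := pres_gen presJ.
have [eA [eAM eAA eAB]] := exp_map_exists p_prime p_odd m_ge1 presJ.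
have [eB [eBM eBB eBA]] := exp_map_exists p_prime p_odd m_ge1 (pres_swap presJ).
have xA' : x A = A * A ^^ (nu p m) by rewrite xA (zx_nat Pgt1).
have xB' : x B = B * A ^^ (- nu p m)%R by rewrite xB (zxN Pgt1) // (zx_nat Pgt1).
have DA' : Delta A = A * B ^^ ((p ^ m)%:R : 'Z_(p ^ (3 * m)))%R by rewrite DeltaA (zx_nat Pgt1).
have DB' := DeltaB; rewrite (Delta_snd_zx _ p_prime p_odd m_ge1) // in DB'.
have cardM := card_Aut4 p_prime p_odd m_ge1 p'l case3' presJ eAM eBM eAA eAB eBA eBB
  x_aut Delta_aut xA' xB' DA' DB'.
have indM := index_Aut4 p_prime p_odd m_ge1 p'l case3' presJ eAM eBM eAA eAB eBA eBB
  x_aut Delta_aut xA' xB' DA' DB'.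
have MK := Aut4_K p_prime p_odd m_ge1 p'l case3' presJ eAM eBM eAA eAB eBA eBB
  x_aut Delta_aut xA' xB' DA' DB'.
have subM : AutZ 4 J \subset Aut J by apply/subsetP=> s /setIdP[].
split; last split; last split.
- split=> //; first exact: index2_normal.
  rewrite /pHall subM /pgroup cardM indM pnatX pnat_id //=.
  by rewrite pnatE // inE /= inE; apply: contraTneq p_odd => <-.
- exact: uv_exists.
- by move=> u v u' v'; apply: uv_unique.
move=> u v uv; have [uv1 uv2] := uv; pose R := 'Z_(p ^ (3 * m)); pose U : R := (u%:~R)%R; pose W : R := (v%:~R)%R.
have EU : (nu p m * (l%:R * U + W) = - nu p m :> R)%R.
  have -> : (l%:R * U + W = (u * l%:Z + v)%:~R)%R by rewrite rmorphD rmorphM /= -pmulrn mulrC.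
  by rewrite -(nu_int p_prime p_odd m_ge1 uv1) rmorphN /= mulrN mulr1.
have EW : (nu p m * (l%:R * U - W) = nu p m * (3 - (third p m * l)%:R) :> R)%R.
  have -> : (l%:R * U - W = (u * l%:Z - v)%:~R)%R by rewrite rmorphB rmorphM /= -pmulrn mulrC.
  by rewrite -(nu_int p_prime p_odd m_ge1 uv2) dparE rmorphB /= -!pmulrn.
have NP : p ^ (2 * m) %| p ^ (3 * m) by apply: dvdn_exp2l; rewrite leq_mul2r orbT.
have nP : p ^ m %| p ^ (3 * m) by apply: dvdn_exp2l; rewrite leq_pmull.
have powP (T : groupType) (y : T) k : k %| p ^ (3 * m) -> y ^+ k = 1 -> y ^+ (p ^ (3 * m)) = 1.
  by case/dvdnP=> j -> yk; rewrite mulnC expgnA yk expg1n.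
have expUW : (((u * (p ^ m)%N%:Z)%R)%:~R = (p ^ m)%:R * U :> R)%R.
  by rewrite rmorphM /= -pmulrn mulrC.
split.
- apply/eqP; rewrite eqEsubset gen_subG; apply/andP; split.
    rewrite /= MK; apply/subsetP => g; rewrite !inE => /or4P[] /eqP ->.
    + by apply/(subsetP (joing_subl _ _))/(subsetP (joing_subl _ _))/InnP; exists A.
    + by apply/(subsetP (joing_subl _ _))/(subsetP (joing_subl _ _))/InnP; exists B.
    + by apply/(subsetP (joing_subl _ _))/(subsetP (joing_subr _ _))/cycle_id.
    by apply/(subsetP (joing_subr _ _))/cycle_id.
  rewrite /= MK !join_subG !cycle_subG; apply/andP; split; first (apply/andP; split).
  + have E : conj_aut J @* J = <<conj_aut J @* [set A; B]>>.
      rewrite -morphim_gen ?genJ //.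
      by apply: subset_trans (normG J); rewrite -genJ subset_gen.
    rewrite /= E; apply: genS; apply/subsetP => _ /morphimP[g _ /set2P[] -> ->]; by rewrite !inE eqxx ?orbT.
  + by rewrite mem_gen // !inE eqxx ?orbT.
  by rewrite mem_gen // !inE eqxx ?orbT.
- have cjM := @conj_autM gT J.
  have cN c : conj_aut J (A ^^ (nu p m * c)%R) = 1.
    exact: (conj_aut_nu p_prime p_odd m_ge1 p'l case3' presJ).
  have cA0 : conj_aut J (A ^^ nu p m) = 1 by rewrite -[nu p m]mulr1.
  have cB0 : conj_aut J (B ^^ nu p m) = 1.
    by rewrite -[nu p m]mulr1 (conj_aut_nu p_prime p_odd m_ge1 p'l case3' (pres_swap presJ)).
  have aN : a ^+ (p ^ (2 * m)) = 1 by rewrite -(morphinX cjM) // -(zx_nat Pgt1) // cA0.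
  have bN : b ^+ (p ^ (2 * m)) = 1 by rewrite -(morphinX cjM) // -(zx_nat Pgt1) // cB0.
  have xn := x_order p_prime p_odd m_ge1 p'l case3' presJ x_aut xA' xB'.
  have Dn := D_n p_prime p_odd m_ge1 p'l case3' presJ x_aut Delta_aut xA' xB' DA' DB' EU EW.
  have abC : [~ a, b] = conj_aut J [~ A, B] by rewrite (morphinR cjM).
  have CcP : conj_aut J [~ A, B] ^+ (p ^ (3 * m)) = 1.
    by rewrite -(morphinX cjM) // CP (morphin1 cjM).
  have [r1 r2 _ _] := rels.
  split; first split=> //.
  + by rewrite abC -(morphinJ cjM) // r1 (morphinX cjM).
  + by rewrite -(morphinR cjM) // -(morphinJ cjM) ?groupR // r2 (morphinX cjM).
  split; first split=> //.
  + by rewrite conj_autJ // xA' cjM ?zx_group // cA0 mulg1.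
  + by rewrite conj_autJ // xB' cjM ?zx_group // -[nu p m]mulr1 -mulrN cN mulg1.
  split.
    rewrite Dn abC (zexpg_zx _ Pgt1) // expUW (morphin_zx cjM) //.
    by rewrite (zexpg_zx _ Pgt1) // (powP _ _ _ nP xn).
  split.
  + by rewrite conj_autJ // DeltaA cjM ?groupX // (morphinX cjM).
  + rewrite conj_autJ // (Delta_snd_zx _ p_prime p_odd m_ge1) ?(powP _ _ _ NP) // DB'.
    by rewrite !cjM ?groupM ?zx_group // !(morphin_zx cjM).
  exact: (xD_comm p_prime p_odd m_ge1 p'l case3' presJ x_aut Delta_aut xA' xB' DA' DB').
move=> T [|a' [|b' [|x' [|D' []]]]] //.
move=> [[r1 r2 r3 r4] [[r5 r6 r7] [r8 [r9 r10 r11]]]].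
have aP := powP _ _ _ NP r3; have bP := powP _ _ _ NP r4.
have [||||f [fM [fA fB fx fD]]] := Aut4_map p_prime p_odd m_ge1 p'l case3' presJ eAM eBM eAA eAB
  eBA eBB x_aut Delta_aut xA' xB' DA' DB' EU EW r1 r2 r3 r4 r5 r6 r7 (D' := D').
- by rewrite r9 (zx_nat Pgt1).
- by rewrite r10 Delta_snd_zx.
- by [].
(* Since [a'] and [b'] satisfy the relations of [J], their commutator has order dividing [P], and
   its integer exponent may be read in [Z/P]. *)
- have CT : [~ a', b'] ^+ (p ^ (3 * m)) = 1.
    exact: (expC_P p_prime p_odd m_ge1 p'l case3').
  by rewrite r8 !(zexpg_zx _ Pgt1) ?(powP _ _ _ nP r5) // expUW.
exists f; split=> //.
by rewrite /= fA fB fx fD.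
Qed.
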